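(* Let $0\leq\gamma\leq 1$ and let $D:H(\mathbb{C})\to H(\mathbb{C})$, $f\mapsto f'$, be the differentiation operator. (1) Let $p\in(1,\infty]$. (1a) Suppose $0\leq\gamma<1$. For every $c>0$ there is an entire function $f$ that is $\mathscr{U}_{\beta^\gamma}$-frequently hypercyclic for $D$ and satisfies $$M_p(f,r)\leq c\,\frac{e^r}{r^{\alpha(p,\gamma)}}\quad\text{for all } r>0.$$ This is optimal in the sense that every entire function $f$ that is $\mathscr{U}_{\beta^\gamma}$-frequently hypercyclic for $D$ satisfies $\limsup_{r\to\infty}\left(r^{\alpha(p,\gamma)}e^{-r}M_p(f,r)\right)>0$. (1b) Suppose $\gamma=1$. For every increasing function $\psi:\mathbb{R}_+\to\mathbb{R}_+$ with $\psi(r)\to\infty$ as $r\to\infty$, there is an entire function $f$ that is $\mathscr{U}_{\beta^1}$-frequently hypercyclic (equivalently, hypercyclic) for $D$ and satisfies $$M_p(f,r)\leq \psi(r)\frac{e^r}{r^{1/2}}\quad\text{for all sufficiently large } r.$$ This is optimal in the sense that every entire function $f$ that is $\mathscr{U}_{\beta^1}$-frequently hypercyclic (equivalently, hypercyclic) for $D$ satisfies $\limsup_{r\to\infty}\left(r^{1/2}e^{-r}M_p(f,r)\right)=\infty$. (2) Let $p=1$. For every increasing function $\psi:\mathbb{R}_+\to\mathbb{R}_+$ with $\psi(r)\to\infty$ as $r\to\infty$, there is an entire function $f$ that is $\mathscr{U}_{\beta^\gamma}$-frequently hypercyclic for $D$ and satisfies $$M_1(f,r)\leq \psi(r)\frac{e^r}{r^{1/2}}\quad\text{for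 all sufficiently large } r.$$ This is optimal in the sense that every entire function $f$ that is $\mathscr{U}_{\beta^\gamma}$-frequently hypercyclic for $D$ satisfies $\limsup_{r\to\infty}\left(r^{1/2}e^{-r}M_1(f,r)\right)=\infty$.
   Context: $\mathbb{N}=\{1,2,3,\dots\}$ and $\mathbb{R}_+=[0,\infty)$. $H(\mathbb{C})$ is the space of entire functions with the compact-open topology (uniform convergence on compact sets). For an entire function $f$ and $r>0$, $M_p(f,r)=\left(\frac{1}{2\pi}\int_0^{2\pi}|f(re^{it})|^p\,dt\right)^{1/p}$ for $1\leq p<\infty$, and $M_\infty(f,r)=\sup_{|z|=r}|f(z)|$. For $1\leq p\leq\infty$, $q$ is the conjugate exponent, $\frac1p+\frac1q=1$ ($q=\infty$ if $p=1$, $q=1$ if $p=\infty$). For $p\in[1,\infty]$ and $0\leq\gamma\leq1$, $$\alpha(p,\gamma):=\frac12-\frac{\min(1,2(1-\gamma))}{2\max(2,q)}.$$ For a sequence $\beta=(\beta_n)_{n\geq1}$ of positive reals with $\sum_{k=1}^n\beta_k\to\infty$, the upper $\beta$-density of $E\subset\mathbb{N}$ is $\overline{d}_\beta(E)=\limsup_{n\to\infty}\frac{\sum_{k=1}^n\beta_k\mathds{1}_E(k)}{\sum_{k=1}^n\beta_k}$, where $\mathds{1}_E$ is the indicator function of $E$. For $0\leq\gamma\leq1$, $\beta^\gamma$ denotes the sequence $(e^{n^\gamma})_{n\geq1}$. Let $T$ be a continuous linear operator on a separable Fréchet space $X$. A vector $x\in X$ is hypercyclic for $T$ if $\{T^nx:n\in\mathbb{N}\}$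 is dense in $X$; it is $\mathscr{U}_\beta$-frequently hypercyclic for $T$ if $\overline{d}_\beta(\{n\in\mathbb{N}:T^nx\in U\})>0$ for every non-empty open $U\subset X$. *)

(* Defs.v *)
From HB Require Import structures.
From mathcomp Require Import all_boot all_order all_algebra.
From mathcomp Require Import all_classical all_reals all_analysis.
From mathcomp Require Import complex.

Set Implicit Arguments.
Unset Strict Implicit.
Unset Printing Implicit Defensive.

Import Order.TTheory GRing.Theory Num.Theory.
Import numFieldNormedType.Exports.

Local Open Scope classical_set_scope.
Local Open Scope ring_scope.
Local Open Scope complex_scope.

(* numFieldNormedType only reaches abstract structures; the concrete type R[i]
   gets the topology and norm of R[i]^o here. *)
HB.instance Definition _ (R : rcfType) := GRing.ComAlgebra.copy R[i] R[i]^o.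
HB.instance Definition _ (R : rcfType) := Vector.copy R[i] R[i]^o.
HB.instance Definition _ (R : rcfType) := NormedModule.copy R[i] R[i]^o.

Section LinearDynamics.
Context {R : realType}.

(* Subsets of {1, 2, ...} are sets of nat; whether 0 belongs to E is
   irrelevant, and the value of the quotient at n = 0 does not affect the
   limit superior. *)
Definition upper_density (beta : nat -> R) (E : set nat) : \bar R :=
  limn_esup (fun n => ((\sum_(1 <= k < n.+1) beta k * \1_E k)
                       / \sum_(1 <= k < n.+1) beta k)%:E).

Definition beta_gamma (gamma : R) (n : nat) : R := expR (n%:R `^ gamma).

(* The phase space is a subset X of an ambient topological space Y, with the
   subspace topology, and the operator is the restriction to X of T : Y -> Y,
   which is meant to map X to X.  The nonempty open subsets of X are the U `&` X
   with U open in Y and U meeting X. *)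
Definition hypercyclic (Y : topologicalType) (X : set Y) (T : Y -> Y) (x : Y) :=
  X x /\ X `<=` closure [set iter n T x | n in [set n | (0 < n)%N]].

Definition Ubeta_freq_hypercyclic (beta : nat -> R)
    (Y : topologicalType) (X : set Y) (T : Y -> Y) (x : Y) :=
  X x /\
  forall U : set Y, open U -> U `&` X !=set0 ->
    (0 < upper_density beta [set n | (0 < n)%N /\ (U `&` X) (iter n T x)])%E.

End LinearDynamics.

Section EntireFunctions.
Context {R : realType}.
Local Notation C := R[i].

Definition entire : set {compact-open, C -> C} :=
  [set f : C -> C | forall z : C, derivable f z 1].

Definition D (f : {compact-open, C -> C}) : {compact-open, C -> C} :=
  derive1 (f : C -> C).

Definition hypercyclic_D (f : {compact-open, C -> C}) := hypercyclic entire D f.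

Definition Ubeta_freq_hypercyclic_D (beta : nat -> R)
  (f : {compact-open, C -> C}) := Ubeta_freq_hypercyclic beta entire D f.

(* Only used for 1 <= p <= +oo; the value at -oo is a dummy. *)
Definition M (p : \bar R) (f : C -> C) (r : R) : \bar R :=
  match p with
  | s%:E => (((2 * pi)^-1)%R%:E *
             \int[lebesgue_measure]_(t in `[0%R, (2 * pi)%R])
               (Normc.normc (f ((r * cos t)%R +i* (r * sin t)%R)) `^ s)%:E)
            `^ s^-1
  | +oo => ereal_sup [set (Normc.normc (f z))%:E
                      | z in [set z | Normc.normc z = r]]
  | -oo => 0
  end%E.

Definition alpha (p : \bar R) (gamma : R) : R :=
  2^-1 - fine ((Num.min 1 (2 * (1 - gamma)))%:E
               / (2%:E * maxe 2%:E (hoelder_conjugate p)))%E.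

Definition growth_limsup (p : \bar R) (a : R) (f : C -> C) : \bar R :=
  limf_esup (fun r : R => ((r `^ a * expR (- r))%:E * M p f r)%E)
            (pinfty_nbhs R).

Definition increasing_to_infty (psi : R -> R) :=
  [/\ forall r, 0 <= r -> 0 <= psi r,
      forall r s, 0 <= r -> r <= s -> psi r <= psi s
    & psi r @[r --> +oo] --> +oo].

End EntireFunctions.

(* Main.v *)
Require Import Defs.
From HB Require Import structures.
From mathcomp Require Import all_boot all_order all_algebra.
From mathcomp Require Import all_classical all_reals all_analysis.
From mathcomp Require Import complex ring lra zify.

Set Implicit Arguments.
Unset Strict Implicit.
Unset Printing Implicit Defensive.

Import Order.TTheory GRing.Theory Num.Theory.
Import numFieldNormedType.Exports.

Local Open Scope classical_set_scope.
Local Open Scope ring_scope.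

(** Write an entire function as [f z = \sum a k / k! * z ^ k].  Then [D] shifts the
    sequence [a], and on the circle of radius [r] the [k]-th term has modulus
    [N (a k) * pw r k], where the Poisson weights [pw r k = r ^ k / k!] live on
    [`|k - r| = O(sqrt r)] and are at most [Om = e ^ r / sqrt r].

    Lower bounds.  Put [sigma = min (1/2, 1 - gamma)] and [theta = 1 / max (2, q)],
    so that [alpha = 1/2 - sigma * theta] ([alphaE]).  If [f] is
    U-frequently hypercyclic, the set [E] of the [n] with [N (a n) = N (D^n f 0) > 1]
    has positive upper density.  The weights [e ^ (k ^ gamma)] are comparable over
    windows of length [m ^ (1 - gamma)], hence arbitrarily large [m] have a positive
    proportion of the window of length about [m ^ sigma] below [m] inside [E]
    ([upper_density_windows]); [sigma <= 1/2] keeps that window within the bulk of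
    the Poisson weights of parameter [m].  Testing [f] against the polynomial with
    unimodular coefficients on those indices gives
    [M p f m >= c * Om * (m ^ sigma) ^ theta] ([M_lower_bound]).  When [p = 1] or
    [gamma = 1] one coefficient is enough: [a n] is unbounded, and so is
    [M p f n / Om] along a subsequence.

    Existence.  [f] is a sum of blocks whose supports [[n, 4 n)] are very far apart,
    each devoted to one target, a polynomial with rational coefficients and a disc,
    every target occurring infinitely often ([assembly]).  Only the block with
    [n / 2 <= r <= 8 n] contributes to [M p f r]; the others are killed by
    Chebyshev's inequality.  In a block, the coefficients of the target are repeated
    with period [s] over a window of length about [n ^ (1 - gamma)], the [m]-th copy
    being multiplied by a weight [e m].  A fixed proportion of the [e m] are 1, so
    the block visits the neighbourhood of the target on a set of positive density
    ([window_density]), while the other weights serve to keep the mean small.  If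
    [p >= 2] or [gamma = 1], the [e m] are Rudin-Shapiro signs: their sums over
    intervals have square root cancellation, and summation by parts against the
    Poisson weights bounds the sup norm ([rs_progression]).  If [p < 2], the [e m]
    are a trapezoidal profile: the polynomial is then a smoothed Dirichlet kernel,
    with mean [O(Om)] and mean square [O(Om ^ 2 * n ^ sigma / s)], and one
    interpolates ([trig_mean_le], [M_weighted_sum]).  Both give
    [O(Om * (n ^ sigma / s) ^ theta)] times the size of the target, and a period [s]
    large in terms of the target makes the constant uniform ([room]).

    For [gamma = 1] a single visit at time [n] carries a fixed proportion of
    [\sum_(k <= n) e ^ k], so U-frequent hypercyclicity is hypercyclicity
    ([hypercyclic_Ubeta1]).

    That entire functions are the sums of such power series is proved from complex
    differentiability by Goursat's argument, on real integrals only
    ([cauchy_circle_Re], [taylor_on_disc]). *)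

Local Notation N := Normc.normc.
Local Notation Re := complex.Re.
Local Notation Im := complex.Im.

(** * Complex numbers: modulus, unit circle, differentiability *)

Section ComplexModulus.
Context {R : realType}.
Local Notation C := R[i].
Implicit Types (z w : C) (x y : R).

Lemma normcE_norm z : `|z| = (N z)%:C%C.
Proof. by []. Qed.

Lemma normc_ge0 z : 0 <= N z.
Proof. by case: z => a b; rewrite sqrtr_ge0. Qed.

Lemma normc_eq0 z : (N z == 0) = (z == 0).
Proof.
apply/eqP/eqP => [|->]; [exact: Normc.eq0_normc|exact: Normc.normc0].
Qed.

Lemma normc_gt0 z : (0 < N z) = (z != 0).
Proof. by rewrite lt_def normc_ge0 andbT normc_eq0. Qed.

Lemma normcD z w : N (z + w) <= N z + N w.
Proof. exact: le_normcD. Qed.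

Lemma normcN z : N (- z) = N z.
Proof. exact: normcN. Qed.

Lemma normcB z w : N (z - w) = N (w - z).
Proof. by rewrite -normcN opprB. Qed.

Lemma normcX z n : N (z ^+ n) = N z ^+ n.
Proof.
elim: n => [|n IH]; first by rewrite !expr0 Normc.normc1.
by rewrite !exprS Normc.normcM IH.
Qed.

Lemma normc_real x : N (x%:C%C) = `|x|.
Proof. by rewrite /= expr0n addr0 sqrtr_sqr. Qed.

Lemma normc_nat n : N (n%:R : C) = n%:R.
Proof.
have -> : (n%:R : C) = ((n%:R : R)%:C)%C by rewrite rmorph_nat.
by rewrite normc_real normr_nat.
Qed.

Lemma ler_norm_Re z : `|Re z| <= N z.
Proof. by have := normc_ge_Re z; rewrite lecR. Qed.

Lemma ler_norm_Im z : `|Im z| <= N z.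
Proof.
case: z => a b /=; rewrite -(sqrtr_sqr b); apply: ler_wsqrtr.
by rewrite lerDr sqr_ge0.
Qed.

Lemma normc_le_ReIm z : N z <= `|Re z| + `|Im z|.
Proof.
rewrite {1}[z]complexE; apply: le_trans (normcD _ _) _.
by rewrite Normc.normcM !normc_real /= expr0n expr1n add0r sqrtr1 mul1r.
Qed.

Lemma ler_Re z : Re z <= N z.
Proof. exact: le_trans (ler_norm _) (ler_norm_Re z). Qed.

Lemma normc_sum I (r : seq I) (P : pred I) (F : I -> C) :
  N (\sum_(i <- r | P i) F i) <= \sum_(i <- r | P i) N (F i).
Proof.
elim/big_ind2 : _ => //; first by rewrite Normc.normc0.
by move=> a b c d ab cd; apply: le_trans (normcD _ _) _; rewrite lerD.
Qed.

Lemma normc_subl z w : N z - N w <= N (z - w).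
Proof. by rewrite lerBlDr; apply: le_trans (normcD _ _); rewrite subrK. Qed.

Lemma normcV z : N z^-1 = (N z)^-1.
Proof. exact: Normc.normcV. Qed.

Lemma cReM z w : Re (z * w) = Re z * Re w - Im z * Im w.
Proof. by case: z w => a b [c d]. Qed.
Lemma cImM z w : Im (z * w) = Re z * Im w + Im z * Re w.
Proof. by case: z w => a b [c d]. Qed.
Lemma cReD z w : Re (z + w) = Re z + Re w.
Proof. by case: z w => a b [c d]. Qed.
Lemma cImD z w : Im (z + w) = Im z + Im w.
Proof. by case: z w => a b [c d]. Qed.
Lemma cReN z : Re (- z) = - Re z.
Proof. by case: z => a b. Qed.
Lemma cImN z : Im (- z) = - Im z.
Proof. by case: z => a b. Qed.
Lemma cReB z w : Re (z - w) = Re z - Re w.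
Proof. by rewrite cReD cReN. Qed.
Lemma cImB z w : Im (z - w) = Im z - Im w.
Proof. by rewrite cImD cImN. Qed.
Lemma cRe_sum I (r : seq I) (P : pred I) (F : I -> C) :
  Re (\sum_(i <- r | P i) F i) = \sum_(i <- r | P i) Re (F i).
Proof. by elim/big_ind2 : _ => // a b c d <- <-; rewrite cReD. Qed.
Lemma cIm_sum I (r : seq I) (P : pred I) (F : I -> C) :
  Im (\sum_(i <- r | P i) F i) = \sum_(i <- r | P i) Im (F i).
Proof. by elim/big_ind2 : _ => // a b c d <- <-; rewrite cImD. Qed.

Lemma normc_sqr z : N z ^+ 2 = Re z ^+ 2 + Im z ^+ 2.
Proof. by case: z => a b /=; rewrite sqr_sqrtr// addr_ge0// sqr_ge0. Qed.

Lemma normc_sqr_conj z : N z ^+ 2 = Re (z * z^*%C).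
Proof. by case: z => a b; rewrite normc_sqr /=; ring. Qed.

Lemma normc_conj z : N (z^*%C) = N z.
Proof. by case: z => a b; rewrite /= sqrrN. Qed.

(** The point [e ^ (i t)] of the unit circle. *)
Definition cis (t : R) : C := (cos t +i* sin t)%C.

Lemma normc_cis t : N (cis t) = 1.
Proof. by rewrite /= cos2Dsin2 sqrtr1. Qed.

Lemma cisD s t : cis (s + t) = cis s * cis t.
Proof.
by apply/eqP; rewrite eq_complex /= cosD sinD; apply/andP; split; apply/eqP; ring.
Qed.

Lemma cis0 : cis 0 = 1.
Proof. by rewrite /cis cos0 sin0. Qed.

Lemma cisN t : cis (- t) = (cis t)^*%C.
Proof. by rewrite /cis cosN sinN. Qed.

Lemma cisMn t n : cis t ^+ n = cis (n%:R * t).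
Proof.
elim: n => [|n IH]; first by rewrite expr0 mul0r cis0.
by rewrite exprS IH -cisD -natr1 mulrDl mul1r addrC.
Qed.

Lemma polarE r t : (((r * cos t)%R +i* (r * sin t)%R) = r%:C * cis t)%C.
Proof. by apply/eqP; rewrite eq_complex /=; apply/andP; split; apply/eqP; ring. Qed.

Lemma normc_polar r t : 0 <= r -> N (r%:C%C * cis t) = r.
Proof. by move=> r0; rewrite Normc.normcM normc_cis mulr1 normc_real ger0_norm. Qed.

End ComplexModulus.

Section ComplexTopology.
Context {R : realType}.
Local Notation C := R[i].

(** The norm of [R[i]] takes its values in [R[i]]; this brings the topology back to the
    real-valued modulus. *)
Lemma nbhs_complexP (z : C) (P : set C) :
  nbhs z P <-> exists2 e : R, 0 < e & forall w, N (w - z) < e -> P w.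
Proof.
split=> [/nbhs_ballP [e /= e0 H]|[e e0 H]].
  have e0' : 0 < Re e by move: e0; rewrite ltcE /= => /andP[].
  have eE : e = ((Re e)%:C)%C.
    by move: e0; case: (e) => a b; rewrite ltcE /= => /andP[/eqP -> _].
  exists (Re e) => // w wz; apply: H.
  by rewrite -ball_normE /ball_ /= eE normcE_norm ltcR normcB.
apply/nbhs_ballP; exists (e%:C)%C; first by rewrite /= ltcR.
by move=> w; rewrite -ball_normE /ball_ /= normcE_norm ltcR normcB; exact: H.
Qed.

(** Stated without division, so that no punctured neighbourhood is needed. *)
Definition cderiv_at (f : C -> C) (z d : C) :=
  forall e : R, 0 < e -> exists2 dl : R, 0 < dl &
    forall h : C, N h < dl -> N (f (z + h) - f z - d * h) <= e * N h.

Lemma cderiv_atP (f : C -> C) (z d : C) :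
  ((fun h : C => h^-1 *: (f (h *: (1 : C) + z) - f z)) @ (0 : C)^' --> d)
   <-> cderiv_at f z d.
Proof.
split.
  move=> /cvgrPdist_lt H e e0.
  have /H : (0 : C) < (e%:C)%C by rewrite ltcR.
  move=> /(@nbhs_complexP 0)[dl dl0 K]; exists dl => // h hdl.
  have [->|h0] := eqVneq h 0.
    by rewrite addr0 subrr mulr0 subrr Normc.normc0 mulr0.
  have hdl' : N (h - 0) < dl by rewrite subr0.
  move: (K h hdl' h0); rewrite normcE_norm ltcR => /ltW HH.
  have -> : f (z + h) - f z - d * h = - ((d - h^-1 * (f (h * 1 + z) - f z)) * h).
    by rewrite mulr1 [h + z]addrC; field.
  by rewrite normcN Normc.normcM ler_wpM2r ?normc_ge0.
move=> H; apply/cvgrPdist_le => e e0.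
have e0' : 0 < Re e by move: e0; rewrite ltcE /= => /andP[].
have eE : e = ((Re e)%:C)%C.
  by move: e0; case: (e) => a b; rewrite ltcE /= => /andP[/eqP -> _].
have [dl dl0 K] := H _ e0'.
apply/(@nbhs_complexP 0); exists dl => // h; rewrite subr0 => hdl h0.
rewrite eE normcE_norm lecR.
have := K h hdl.
have -> : f (z + h) - f z - d * h = - ((d - h^-1 * (f (h * 1 + z) - f z)) * h).
  by rewrite mulr1 [h + z]addrC; field.
by rewrite normcN Normc.normcM ler_pM2r// normc_gt0.
Qed.

Lemma derivable_cderiv (f : C -> C) (z : C) :
  derivable f z 1 -> cderiv_at f z (derive1 f z).
Proof.
move=> /cvg_ex [d fd]; apply/cderiv_atP.
rewrite derive1E /derive; by have -> := cvg_lim (@norm_hausdorff _ _) fd.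
Qed.

Lemma cderiv_derivable (f : C -> C) (z d : C) :
  cderiv_at f z d -> derivable f z 1.
Proof. by move=> /cderiv_atP H; apply/cvg_ex; exists d. Qed.

Lemma cderiv_derive1 (f : C -> C) (z d : C) :
  cderiv_at f z d -> derive1 f z = d.
Proof.
move=> /cderiv_atP H; rewrite derive1E.
exact: (cvg_lim (@norm_hausdorff _ _) H).
Qed.

Definition ccont_at (f : C -> C) (z : C) :=
  forall e : R, 0 < e -> exists2 dl : R, 0 < dl &
    forall w : C, N (w - z) < dl -> N (f w - f z) <= e.

Lemma cderiv_cont (f : C -> C) (z d : C) : cderiv_at f z d -> ccont_at f z.
Proof.
move=> H e e0; have [dl dl0 K] := H 1 ltr01.
exists (Num.min dl (e / (1 + N d))).
  by rewrite lt_min dl0 divr_gt0// ltr_pwDl// normc_ge0.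
move=> w; rewrite lt_min => /andP[w1 w2].
have := K _ w1; rewrite mul1r [z + _]addrC subrK => K1.
have -> : f w - f z = (f w - f z - d * (w - z)) + d * (w - z) by rewrite subrK.
apply: le_trans (normcD _ _) _; rewrite Normc.normcM.
move: w2; rewrite ltr_pdivlMr; last by rewrite ltr_pwDl// normc_ge0.
by move=> w2; lra.
Qed.

End ComplexTopology.

(** * Integrals over segments and continuous curves *)

Section SegmentIntegral.
Context {R : realType}.
Implicit Types (a b c : R) (h k F : R -> R).

Definition segint a b h : R := (\int[lebesgue_measure]_(x in `[a, b]) h x)%R.

Lemma cont_integrable a b h : continuous h ->
  lebesgue_measure.-integrable `[a, b] (EFin \o h).
Proof.
move=> ch; apply: continuous_compact_integrable; first exact: segment_compact.
exact: continuous_subspaceT.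
Qed.

Lemma segintD a b h k : continuous h -> continuous k ->
  segint a b (fun x => h x + k x) = segint a b h + segint a b k.
Proof. by move=> ch ck; apply: RintegralD => //; exact: cont_integrable. Qed.

Lemma segintB a b h k : continuous h -> continuous k ->
  segint a b (fun x => h x - k x) = segint a b h - segint a b k.
Proof. by move=> ch ck; apply: RintegralB => //; exact: cont_integrable. Qed.

Lemma segintZ a b r h : continuous h ->
  segint a b (fun x => r * h x) = r * segint a b h.
Proof. by move=> ch; apply: RintegralZl => //; exact: cont_integrable. Qed.

Lemma segint_cst a b r : a <= b -> segint a b (fun=> r) = r * (b - a).
Proof.
move=> ab; rewrite /segint Rintegral_cst//; congr (_ * _).
apply: etrans (congr1 fine (lebesgue_measure_itv _)) _; rewrite /= lte_fin.
by case: ltgtP ab => // -> _; rewrite subrr.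
Qed.

Lemma ler_segint a b h k : continuous h -> continuous k ->
  (forall x, a <= x <= b -> h x <= k x) -> segint a b h <= segint a b k.
Proof.
move=> ch ck hk; apply: le_Rintegral => //; try exact: cont_integrable.
Qed.

Lemma eq_segint a b h k : (forall x, a <= x <= b -> h x = k x) ->
  segint a b h = segint a b k.
Proof.
by move=> hk; apply: eq_Rintegral => x; rewrite inE/= in_itv/=; exact: hk.
Qed.

Lemma segint_le_cst a b h B : a <= b -> continuous h ->
  (forall x, a <= x <= b -> h x <= B) -> segint a b h <= B * (b - a).
Proof.
move=> ab ch hB; rewrite -segint_cst//; apply: ler_segint => //.
exact: cst_continuous.
Qed.

Lemma segint_split a b c h : a <= c -> c <= b -> continuous h ->
  segint a b h = segint a c h + segint c b h.
Proof.
move=> ac cb ch; apply/eqP; rewrite addrC -subr_eq; apply/eqP.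
rewrite /segint Rintegral_itvB//; last exact: cont_integrable.
apply: Rintegral_itv_obnd_cbnd.
have /= := cont_integrable c b ch; apply: integrableS => //.
by apply: subset_itv; rewrite bnd_simp.
Qed.

Lemma segint_FTC a b F h : a <= b -> continuous h ->
  (forall x : R, is_derive x 1 F (h x)) -> segint a b h = F b - F a.
Proof.
rewrite le_eqVlt => /predU1P[<- _ _|ab ch dF].
  by rewrite /segint set_itv1 Rintegral_set1 subrr.
have cF (x : R) : {for x, continuous F}.
  by apply: differentiable_continuous; apply/derivable1_diffP; case: (dF x).
rewrite /segint /Rintegral (@continuous_FTC2 _ h F)//.
- exact: continuous_subspaceT.
- split => [x _||]; first by case: (dF x).
  + by apply: cvg_at_right_filter; exact: cF.
  + by apply: cvg_at_left_filter; exact: cF.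
- by move=> x _; rewrite derive1E; apply: derive_val.
Qed.

Lemma continuous_finite_sum I (s : seq I) (f : I -> R -> R) :
  (forall i, continuous (f i)) -> continuous (fun x => \sum_(i <- s) f i x).
Proof.
move=> cf; elim: s => [|i s IH] x.
  by under eq_fun do rewrite big_nil; exact: cst_continuous.
under eq_fun do rewrite big_cons.
by apply: (@cvgD _ R); [exact: cf|exact: IH].
Qed.

Lemma segint_sum a b I (r : seq I) (f : I -> R -> R) :
  (forall i, continuous (f i)) ->
  segint a b (fun x => \sum_(i <- r) f i x) = \sum_(i <- r) segint a b (f i).
Proof.
move=> cf; have cs s := @continuous_finite_sum I s f cf.
elim: r => [|i s IH].
  rewrite big_nil; under eq_fun do rewrite big_nil.
  by rewrite /segint /Rintegral integral0.
rewrite big_cons -IH -segintD//.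
by congr segint; apply/funext => x; rewrite big_cons.
Qed.

End SegmentIntegral.

Section ContinuousCurves.
Context {R : realType}.
Local Notation C := R[i].

Definition ccurve (k : R -> C) :=
  continuous (fun t => Re (k t)) /\ continuous (fun t => Im (k t)).

Lemma ccurve_cst (z : C) : ccurve (fun=> z).
Proof. by split; exact: cst_continuous. Qed.

Lemma ccurveD k l : ccurve k -> ccurve l -> ccurve (fun t => k t + l t).
Proof.
move=> [k1 k2] [l1 l2]; split => t.
  by under eq_fun do rewrite cReD; apply: (@cvgD _ R); [exact: k1|exact: l1].
by under eq_fun do rewrite cImD; apply: (@cvgD _ R); [exact: k2|exact: l2].
Qed.

Lemma ccurveN k : ccurve k -> ccurve (fun t => - k t).
Proof.
move=> [k1 k2]; split => t.
  by under eq_fun do rewrite cReN; apply: (@cvgN _ R); exact: k1.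
by under eq_fun do rewrite cImN; apply: (@cvgN _ R); exact: k2.
Qed.

Lemma ccurveB k l : ccurve k -> ccurve l -> ccurve (fun t => k t - l t).
Proof. by move=> kc lc; apply: ccurveD => //; apply: ccurveN. Qed.

Lemma ccurveM k l : ccurve k -> ccurve l -> ccurve (fun t => k t * l t).
Proof.
move=> [k1 k2] [l1 l2]; split => t.
  under eq_fun do rewrite cReM; apply: (@cvgB _ R); apply: cvgM;
  by [exact: k1|exact: l1|exact: k2|exact: l2].
under eq_fun do rewrite cImM; apply: (@cvgD _ R); apply: cvgM;
by [exact: k1|exact: l1|exact: k2|exact: l2].
Qed.

Lemma ccurve_sum I (r : seq I) (k : I -> R -> C) : (forall i, ccurve (k i)) ->
  ccurve (fun t => \sum_(i <- r) k i t).
Proof.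
move=> kc; elim: r => [|i r IH].
  by under eq_fun do rewrite big_nil; exact: ccurve_cst.
by under eq_fun do rewrite big_cons; exact: ccurveD.
Qed.

Lemma ccurve_cis : ccurve cis.
Proof. by split; [exact: continuous_cos|exact: continuous_sin]. Qed.

Lemma ccurve_polar (r : R) : ccurve (fun t => (r%:C)%C * cis t).
Proof. by apply: ccurveM; [exact: ccurve_cst|exact: ccurve_cis]. Qed.

Lemma ccurve_comp (g : C -> C) k : (forall z, ccont_at g z) -> ccurve k ->
  ccurve (fun t => g (k t)).
Proof.
move=> cg [k1 k2].
have H (t e : R) : 0 < e -> \forall s \near t, N (g (k s) - g (k t)) <= e.
  move=> e0; have [d d0 Hd] := cg (k t) e e0.
  have d2 : 0 < d / 2 by lra.
  have /cvgrPdist_lt/(_ _ d2) H1 := k1 t.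
  have /cvgrPdist_lt/(_ _ d2) H2 := k2 t.
  near=> s; apply: Hd.
  have A1 : `|Re (k t) - Re (k s)| < d / 2 by near: s; exact: H1.
  have A2 : `|Im (k t) - Im (k s)| < d / 2 by near: s; exact: H2.
  apply: le_lt_trans (normc_le_ReIm _) _; rewrite cReB cImB.
  by rewrite distrC [X in _ + X]distrC; lra.
split => t; apply/cvgrPdist_le => e e0; near=> s.
  apply: le_trans (_ : N (g (k s) - g (k t)) <= _); last by near: s; exact: H.
  by rewrite distrC -cReB ler_norm_Re.
apply: le_trans (_ : N (g (k s) - g (k t)) <= _); last by near: s; exact: H.
by rewrite distrC -cImB ler_norm_Im.
Unshelve. all: by end_near.
Qed.

Lemma ccurve_normc k : ccurve k -> continuous (fun t => N (k t)).
Proof.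
move=> [k1 k2]; have -> : (fun t => N (k t)) =
    (fun t => Num.sqrt (Re (k t) ^+ 2 + Im (k t) ^+ 2)).
  by apply/funext => t; case: (k t).
move=> t; apply: continuous_comp; last exact: sqrt_continuous.
by apply: (@cvgD _ R); rewrite /=; apply: cvgM => //; [exact: k1|exact: k1|exact: k2|exact: k2].
Qed.

End ContinuousCurves.

(** * Goursat's theorem and Cauchy's formula on a disc *)

Section AdditiveRectangleFunctions.
Context {R : realType}.
Variable L : R -> R -> R -> R -> R.
Variables A B C D : R.
Hypotheses (AB : A <= B) (CD : C <= D).
Hypothesis L_split1 : forall a m b c d, a <= m -> m <= b -> c <= d ->
  L a b c d = L a m c d + L m b c d.
Hypothesis L_split2 : forall a b c m d, a <= b -> c <= m -> m <= d ->
  L a b c d = L a b c m + L a b m d.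
Hypothesis L_small : forall a0 c0, A <= a0 <= B -> C <= c0 <= D ->
  forall e, 0 < e -> exists2 dl, 0 < dl &
  forall a b c d, A <= a -> a <= a0 -> a0 <= b -> b <= B ->
    C <= c -> c <= c0 -> c0 <= d -> d <= D -> b - a <= dl -> d - c <= dl ->
    `|L a b c d| <= e * ((b - a) + (d - c)) ^+ 2.

Lemma exists_pow2_gt (x : R) : exists n, x < 2 ^+ n.
Proof.
have [n xn] : exists n : nat, x < n%:R.
  exists (Num.trunc x).+1; exact: truncnS_gt.
exists n; apply: lt_le_trans xn _.
by rewrite -natrX ler_nat ltnW// ltn_expl.
Qed.

Let w n : R := (B - A) / 2 ^+ n.
Let v n : R := (D - C) / 2 ^+ n.
Let ws n : w n = w n.+1 + w n.+1.
Proof. by rewrite /w exprS; field; rewrite expf_neq0//. Qed.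
Let vs n : v n = v n.+1 + v n.+1.
Proof. by rewrite /v exprS; field; rewrite expf_neq0//. Qed.
Let w_ge0 n : 0 <= w n.
Proof. by rewrite divr_ge0 ?subr_ge0// exprn_ge0. Qed.
Let v_ge0 n : 0 <= v n.
Proof. by rewrite divr_ge0 ?subr_ge0// exprn_ge0. Qed.

(** If the value on the whole rectangle is nonzero, repeated quartering produces
    shrinking rectangles on which it is at least a fixed multiple of the area;
    their common point contradicts the local bound. *)
Lemma additive_rect_zero : L A B C D = 0.
Proof.
apply/eqP; apply: contraT => L0; set eta := `|L A B C D|.
have eta0 : 0 < eta by rewrite normr_gt0.
pose bad n (p : R * R) := [/\ A <= p.1, p.1 + w n <= B, C <= p.2, p.2 + v n <= D
   & eta / 4 ^+ n <= `|L p.1 (p.1 + w n) p.2 (p.2 + v n)|].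
have step n p : exists q, bad n p -> [/\ bad n.+1 q,
    p.1 <= q.1 & q.1 + w n.+1 <= p.1 + w n] /\
    (p.2 <= q.2 /\ q.2 + v n.+1 <= p.2 + v n).
  have [|nb] := pselect (bad n p); last by exists p => /nb.
  case: p => a c [/= Aa aB Cc cD big].
  have w1 := w_ge0 n.+1; have v1 := v_ge0 n.+1.
  have wE := ws n; have vE := vs n.
  have E4 : eta / 4 ^+ n = 4 * (eta / 4 ^+ n.+1).
    by rewrite exprS; field; rewrite expf_neq0.
  have LE : L a (a + w n) c (c + v n) =
      L a (a + w n.+1) c (c + v n.+1) +
      L a (a + w n.+1) (c + v n.+1) (c + v n.+1 + v n.+1) +
      (L (a + w n.+1) (a + w n.+1 + w n.+1) c (c + v n.+1) +
      L (a + w n.+1) (a + w n.+1 + w n.+1) (c + v n.+1) (c + v n.+1 + v n.+1)).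
    rewrite (@L_split1 a (a + w n.+1)); [|lra..].
    rewrite (@L_split2 a _ c (c + v n.+1)); [|lra..].
    rewrite (@L_split2 (a + w n.+1) _ c (c + v n.+1)); [|lra..].
    by rewrite wE vE !addrA.
  move: big; rewrite LE E4.
  set e4 := eta / 4 ^+ n.+1.
  set l1 := L a _ _ _; set l2 := L a _ _ _; set l3 := L _ _ c _; set l4 := L _ _ _ _.
  move=> big.
  have := ler_normD (l1 + l2) (l3 + l4).
  have := ler_normD l1 l2; have := ler_normD l3 l4 => n1 n2 n3.
  have [b1|b1] := leP e4 `|l1|.
    by exists (a, c) => _; split; [split; [split|..]|split] => /=; first [exact: b1|lra].
  have [b2|b2] := leP e4 `|l2|.
    by exists (a, c + v n.+1) => _; split; [split; [split|..]|split] => /=; first [exact: b2|lra].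
  have [b3|b3] := leP e4 `|l3|.
    by exists (a + w n.+1, c) => _; split; [split; [split|..]|split] => /=; first [exact: b3|lra].
  exists (a + w n.+1, c + v n.+1) => _.
  have b4 : e4 <= `|l4| by lra.
  by split; [split; [split|..]|split] => /=; first [exact: b4|lra].
have [nxt nxtP] := choice (fun x : nat * (R * R) => step x.1 x.2).
pose s := fix s n := if n is m.+1 then nxt (m, s m) else (A, C).
have s_bad n : bad n (s n).
  elim: n => [|n IH] /=; last by have [[]] := nxtP (n, s n) IH.
  by split => //=; rewrite /w /v !expr0 !divr1 ?subrKC.
have s_next n : [/\ (s n).1 <= (s n.+1).1, (s n.+1).1 + w n.+1 <= (s n).1 + w n,
   (s n).2 <= (s n.+1).2 & (s n.+1).2 + v n.+1 <= (s n).2 + v n].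
  by have [[_ ? ?] [? ?]] := nxtP (n, s n) (s_bad n); split.
have s_mono n k : [/\ (s n).1 <= (s (n + k)%N).1,
   (s (n + k)%N).1 + w (n + k)%N <= (s n).1 + w n,
   (s n).2 <= (s (n + k)%N).2 & (s (n + k)%N).2 + v (n + k)%N <= (s n).2 + v n].
  elim: k => [|k [i1 i2 i3 i4]]; first by rewrite addn0.
  rewrite addnS; have [j1 j2 j3 j4] := s_next (n + k)%N.
  by split; [exact: le_trans j1|exact: le_trans i2|exact: le_trans j3|exact: le_trans i4].
have s_cross1 n m : (s m).1 <= (s n).1 + w n.
  have [nm|/ltnW mn] := leqP n m.
    have [_ h _ _] := s_mono n (m - n)%N; rewrite subnKC// in h.
    by have := w_ge0 m; lra.
  have [h _ _ _] := s_mono m (n - m)%N; rewrite subnKC// in h.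
  by have := w_ge0 n; lra.
have s_cross2 n m : (s m).2 <= (s n).2 + v n.
  have [nm|/ltnW mn] := leqP n m.
    have [_ _ _ h] := s_mono n (m - n)%N; rewrite subnKC// in h.
    by have := v_ge0 m; lra.
  have [_ _ h _] := s_mono m (n - m)%N; rewrite subnKC// in h.
  by have := v_ge0 n; lra.
(* the common point of the nested rectangles *)
pose a0 := sup [set (s n).1 | n in setT]; pose c0 := sup [set (s n).2 | n in setT].
have a0l n : (s n).1 <= a0.
  apply: ub_le_sup; last by exists n.
  by exists ((s 0%N).1 + w 0%N) => _ [m _ <-].
have a0u n : a0 <= (s n).1 + w n.
  by apply: ge_sup; [exists (s 0%N).1; exists 0%N|move=> _ [m _ <-]].
have c0l n : (s n).2 <= c0.
  apply: ub_le_sup; last by exists n.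
  by exists ((s 0%N).2 + v 0%N) => _ [m _ <-].
have c0u n : c0 <= (s n).2 + v n.
  by apply: ge_sup; [exists (s 0%N).2; exists 0%N|move=> _ [m _ <-]].
have a0AB : A <= a0 <= B.
  have [? ? _ _ _] := s_bad 0%N; have := a0l 0%N; have := a0u 0%N.
  by move=> ? ?; lra.
have c0CD : C <= c0 <= D.
  have [_ _ ? ? _] := s_bad 0%N; have := c0l 0%N; have := c0u 0%N.
  by move=> ? ?; lra.
pose T := (B - A) + (D - C) + 1.
have T0 : 0 < T by rewrite /T; lra.
have e0 : 0 < eta / (2 * T ^+ 2) by rewrite divr_gt0// mulr_gt0// exprn_gt0.
have [dl dl0 small] := L_small a0AB c0CD e0.
have [n nT] := exists_pow2_gt (T / dl).
have p2 : 0 < 2 ^+ n :> R by rewrite exprn_gt0.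
have Tn : T / 2 ^+ n < dl by rewrite ltr_pdivrMr// mulrC -ltr_pdivrMr.
have wn : w n <= dl.
  by apply: le_trans (ltW Tn); rewrite /w ler_pM2r ?invr_gt0// /T; lra.
have vn : v n <= dl.
  by apply: le_trans (ltW Tn); rewrite /v ler_pM2r ?invr_gt0// /T; lra.
have [h1 h2 h3 h4 h5] := s_bad n.
have := small _ _ _ _ h1 (a0l n) (a0u n) h2 h3 (c0l n) (c0u n) h4.
rewrite ![_ + w n - _]addrC ![_ + v n - _]addrC !addKr => /(_ wn vn) h6.
have wvT : (w n + v n) ^+ 2 <= T ^+ 2 / 4 ^+ n.
  have -> : w n + v n = ((B - A) + (D - C)) / 2 ^+ n by rewrite /w /v -mulrDl.
  have -> : 4 ^+ n = (2 ^+ n) ^+ 2 :> R.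
    have -> : (4 : R) = 2 ^+ 2; first by ring.
    by rewrite -!exprM mulnC.
  rewrite expr_div_n ler_pM2r ?invr_gt0 ?exprn_gt0//.
  by rewrite ler_sqr ?nnegrE /T; lra.
have : eta / 4 ^+ n <= eta / (2 * T ^+ 2) * (T ^+ 2 / 4 ^+ n).
  by apply: le_trans h5 _; apply: le_trans h6 _; rewrite ler_pM2l.
have -> : eta / (2 * T ^+ 2) * (T ^+ 2 / 4 ^+ n) = (eta / 4 ^+ n) / 2.
  by field; rewrite ?expf_neq0 ?(gt_eqF T0)//.
have : 0 < eta / 4 ^+ n by rewrite divr_gt0// exprn_gt0.
by lra.
Qed.

End AdditiveRectangleFunctions.

Section CurveDerivatives.
Context {R : realType}.
Local Notation C := R[i].
Implicit Types k l : R -> C.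

(** Differentiability along a curve, coordinate by coordinate: all integrals below are
    integrals of real parts. *)
Definition cvdiff k dk := forall t : R,
  is_derive t 1 (fun s => Re (k s)) (Re (dk t)) /\
  is_derive t 1 (fun s => Im (k s)) (Im (dk t)).

Lemma cvdiff_cst (c : C) : cvdiff (fun=> c) (fun=> 0).
Proof. by move=> t; split; exact: is_derive_cst. Qed.

Lemma cvdiffD k l dk dl : cvdiff k dk -> cvdiff l dl ->
  cvdiff (fun t => k t + l t) (fun t => dk t + dl t).
Proof.
move=> H K t; have [h1 h2] := H t; have [k1 k2] := K t; split.
  under eq_fun do rewrite cReD; rewrite cReD.
  exact: (@is_deriveD _ _ _ _ _ _ _ _ _ h1 k1).
under eq_fun do rewrite cImD; rewrite cImD.
exact: (@is_deriveD _ _ _ _ _ _ _ _ _ h2 k2).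
Qed.

Lemma cvdiffM k l dk dl : cvdiff k dk -> cvdiff l dl ->
  cvdiff (fun t => k t * l t) (fun t => dk t * l t + k t * dl t).
Proof.
move=> H K t; have [h1 h2] := H t; have [k1 k2] := K t; split.
  under eq_fun do rewrite cReM; rewrite cReD !cReM.
  have m1 := is_deriveM h1 k1; have m2 := is_deriveM h2 k2.
  apply: is_derive_eq (is_deriveB m1 m2) _.
  by rewrite /GRing.scale /=; ring.
under eq_fun do rewrite cImM; rewrite cImD !cImM.
have m1 := is_deriveM h1 k2; have m2 := is_deriveM h2 k1.
apply: is_derive_eq (is_deriveD m1 m2) _.
by rewrite /GRing.scale /=; ring.
Qed.

Lemma cvdiff_eq k dk dk' : cvdiff k dk -> (forall t, dk t = dk' t) ->
  cvdiff k dk'.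
Proof. by move=> H E t; rewrite -E. Qed.

Lemma cvdiff_cis : cvdiff cis (fun t => 'i%C * cis t).
Proof.
move=> t; split => /=.
  by apply: is_derive_eq (is_derive_cos _) _; ring.
by apply: is_derive_eq (is_derive_sin _) _; ring.
Qed.

Lemma cvdiff_id : cvdiff (fun t => (t%:C)%C) (fun=> 1).
Proof. by move=> t; split => /=; [exact: is_derive_id|exact: is_derive_cst]. Qed.

Lemma cvdiff_ccurve k dk : cvdiff k dk -> ccurve k.
Proof.
by move=> H; split => t; have [h1 h2] := H t;
  apply: differentiable_continuous; apply/derivable1_diffP; [case: h1|case: h2].
Qed.

Lemma segint_cvdiff a b k dk : a <= b -> ccurve dk -> cvdiff k dk ->
  segint a b (fun t => Re (dk t)) = Re (k b) - Re (k a).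
Proof.
move=> ab [cdk _] H; apply: (@segint_FTC _ a b (fun t => Re (k t))) => //.
by move=> x; have [] := H x.
Qed.

(** The mean value theorem for both coordinates. *)
Lemma cis_lip (s t : R) : N (cis s - cis t) <= 2 * `|s - t|.
Proof.
have lip (F dF : R -> R) : (forall x : R, is_derive x 1 F (dF x)) ->
    (forall x, `|dF x| <= 1) -> `|F s - F t| <= `|s - t|.
  move=> dF1 dF2; wlog st : s t / t <= s.
    move=> wl; have [/wl//|/ltW/wl] := leP t s.
    by rewrite distrC [X in _ <= X]distrC.
  have [|c _ ->] := @MVT_segment R F dF t s st (fun x _ => dF1 x).
    by apply: derivable_within_continuous => x _; case: (dF1 x).
  by rewrite normrM ler_piMl.
apply: le_trans (normc_le_ReIm _) _; rewrite cReB cImB /=.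
have h1 := lip _ _ (@is_derive_cos R); have h2 := lip _ _ (@is_derive_sin R).
rewrite mulr2n mulrDl mul1r lerD//.
  by apply: h1 => x; rewrite normrN; apply/ler_normlP; split; [rewrite lerNl; exact: sin_geN1|exact: sin_le1].
by apply: h2 => x; apply/ler_normlP; split; [rewrite lerNl; exact: cos_geN1|exact: cos_le1].
Qed.

Lemma segint_dist a b (h k : R -> R) e : a <= b -> continuous h -> continuous k ->
  (forall x, a <= x <= b -> `|h x - k x| <= e) ->
  `|segint a b h - segint a b k| <= e * (b - a).
Proof.
move=> ab ch ck hk; rewrite -segintB//.
have cB : continuous (fun x => h x - k x).
  by move=> x; apply: (@cvgB _ R); [exact: ch|exact: ck].
rewrite ler_norml; apply/andP; split; last first.
  by apply: segint_le_cst => // x /hk; rewrite ler_norml => /andP[].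
rewrite -mulNr -segint_cst//; apply: ler_segint => //; first exact: cst_continuous.
by move=> x /hk; rewrite ler_norml => /andP[].
Qed.

End CurveDerivatives.

Section CauchyOnTheDisc.
Context {R : realType}.
Local Notation C := R[i].
Variables (z : C) (r : R) (g : C -> C).
Hypothesis zr : N z < r.
Hypothesis g_cont : forall w, ccont_at g w.
Hypothesis g_deriv : forall w, w != z -> exists d, cderiv_at g w d.

Let r0 : 0 < r.
Proof. exact: le_lt_trans (normc_ge0 z) zr. Qed.

Let k (t : R) : C := (r%:C)%C * cis t - z.
Let sg (l t : R) : C := z + (l%:C)%C * k t.
Let sgt (l t : R) : C := (l%:C)%C * ((r%:C)%C * ('i%C * cis t)).

Let k_le t : N (k t) <= 2 * r.
Proof.
apply: le_trans (normcD _ _) _; rewrite normcN normc_polar ?(ltW r0)//.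
by move: (ltW zr); lra.
Qed.

Let k_neq0 t : k t != 0.
Proof.
rewrite -normc_gt0; apply: lt_le_trans (normc_subl _ _).
by rewrite normc_polar ?(ltW r0)// subr_gt0.
Qed.

Let cvdiff_k : cvdiff k (fun t => (r%:C)%C * ('i%C * cis t)).
Proof.
have := cvdiffD (cvdiffM (cvdiff_cst (r%:C)%C) cvdiff_cis) (cvdiff_cst (- z)).
by move/cvdiff_eq; apply => t; rewrite mul0r add0r addr0.
Qed.

Let cvdiff_sgt l : cvdiff (sg l) (sgt l).
Proof.
have := cvdiffD (cvdiff_cst z) (cvdiffM (cvdiff_cst (l%:C)%C) cvdiff_k).
by move/cvdiff_eq; apply => t; rewrite mul0r !add0r.
Qed.

Let cvdiff_sgl t : cvdiff (sg ^~ t) (fun=> k t).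
Proof.
have := cvdiffD (cvdiff_cst z) (cvdiffM cvdiff_id (cvdiff_cst (k t))).
by move/cvdiff_eq; apply => s; rewrite mulr0 addr0 add0r mul1r.
Qed.

Let ccurve_sgt l : ccurve (sgt l).
Proof.
apply: ccurveM; first exact: ccurve_cst.
apply: ccurveM; first exact: ccurve_cst.
by apply: ccurveM; [exact: ccurve_cst|exact: ccurve_cis].
Qed.

Let P (G : C -> C) l t := Re (G (sg l t) * sgt l t).
Let Q (G : C -> C) l t := Re (G (sg l t) * k t).

(* the integral of [Re (G d zeta)] along the image of the boundary of
   [a, b] x [c, d] *)
Let L (G : C -> C) a b c d :=
  segint c d (P G b) - segint c d (P G a) - segint a b (Q G ^~ d) + segint a b (Q G ^~ c).

Let P_cont G l : (forall w, ccont_at G w) -> continuous (P G l).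
Proof.
move=> cG; suff [] : ccurve (fun t => G (sg l t) * sgt l t) by [].
apply: ccurveM => //; apply: ccurve_comp => //.
exact: cvdiff_ccurve (cvdiff_sgt l).
Qed.

Let Q_cont G t : (forall w, ccont_at G w) -> continuous (Q G ^~ t).
Proof.
move=> cG; suff [] : ccurve (fun l => G (sg l t) * k t) by [].
apply: ccurveM; last exact: ccurve_cst.
by apply: ccurve_comp => //; exact: cvdiff_ccurve (cvdiff_sgl t).
Qed.

Let L_affine (a0 b0 w0 : C) a b c d : a <= b -> c <= d ->
  L (fun w => a0 + b0 * (w - w0)) a b c d = 0.
Proof.
move=> ab cd; pose Phi w : C := a0 * w + (b0 / 2) * ((w - w0) * (w - w0)).
have dPhi s ds : cvdiff s ds ->
    cvdiff (fun t => Phi (s t)) (fun t => (a0 + b0 * (s t - w0)) * ds t).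
  move=> H; have H1 := cvdiffD H (cvdiff_cst (- w0)).
  have := cvdiffD (cvdiffM (cvdiff_cst a0) H)
     (cvdiffM (cvdiff_cst (b0 / 2)) (cvdiffM H1 H1)).
  by move/cvdiff_eq; apply => t; field.
have cc s ds : ccurve s -> ccurve ds ->
    ccurve (fun t => (a0 + b0 * (s t - w0)) * ds t).
  move=> cs cds; apply: ccurveM => //; apply: ccurveD; first exact: ccurve_cst.
  apply: ccurveM; first exact: ccurve_cst.
  by apply: ccurveB => //; exact: ccurve_cst.
have e1 l := segint_cvdiff cd
  (cc _ _ (cvdiff_ccurve (cvdiff_sgt l)) (ccurve_sgt l)) (dPhi _ _ (cvdiff_sgt l)).
have e2 t := segint_cvdiff ab
  (cc _ _ (cvdiff_ccurve (cvdiff_sgl t)) (ccurve_cst (k t))) (dPhi _ _ (cvdiff_sgl t)).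
by rewrite /L /P /Q !e1 !e2; lra.
Qed.

Let L_dist G H a b c d e : (forall w, ccont_at G w) -> (forall w, ccont_at H w) ->
  0 <= a -> a <= b -> b <= 1 -> c <= d -> 0 <= e ->
  (forall l t, a <= l <= b -> c <= t <= d -> N (G (sg l t) - H (sg l t)) <= e) ->
  `|L G a b c d - L H a b c d| <= 4 * r * e * ((b - a) + (d - c)).
Proof.
move=> cG cH a0 ab b1 cd e0 GH.
have Pd l : a <= l <= b -> `|segint c d (P G l) - segint c d (P H l)| <= r * e * (d - c).
  move=> /andP[al lb]; apply: segint_dist; [exact: cd|exact: P_cont..|].
  move=> t ct; rewrite /P -cReB -mulrBl.
  apply: le_trans (ler_norm_Re _) _; rewrite Normc.normcM mulrC.
  apply: ler_pM; rewrite ?normc_ge0//; last by apply: GH => //; rewrite al.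
  rewrite /sgt !Normc.normcM normc_cis !normc_real !ger0_norm ?(ltW r0)//; last lra.
  rewrite (_ : N 'i%C = 1) ?mul1r ?mulr1 ?ler_piMl ?(ltW r0)//; first lra.
  by rewrite /= expr0n expr1n add0r sqrtr1.
have Qd t : c <= t <= d ->
    `|segint a b (Q G ^~ t) - segint a b (Q H ^~ t)| <= 2 * r * e * (b - a).
  move=> ct; apply: segint_dist; [exact: ab|exact: Q_cont..|].
  move=> l al; rewrite /Q -cReB -mulrBl.
  apply: le_trans (ler_norm_Re _) _; rewrite Normc.normcM mulrC.
  by apply: ler_pM; rewrite ?normc_ge0 ?k_le//; exact: GH.
have aa : a <= a <= b by rewrite lexx.
have bb : a <= b <= b by rewrite lexx andbT.
have ccd : c <= c <= d by rewrite lexx.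
have dd : c <= d <= d by rewrite lexx andbT.
have := Pd _ aa; have := Pd _ bb; have := Qd _ ccd; have := Qd _ dd.
rewrite /L; set x1 := segint _ _ _; set y1 := segint _ _ _.
set x2 := segint _ _ _; set y2 := segint _ _ _.
set x3 := segint _ _ _; set y3 := segint _ _ _.
set x4 := segint _ _ _; set y4 := segint _ _ _.
have re : 0 <= r * e * (d - c).
  by rewrite !mulr_ge0 ?(ltW r0)// subr_ge0.
rewrite !ler_norml => /andP[? ?] /andP[? ?] /andP[? ?] /andP[? ?].
by apply/andP; split; lra.
Qed.

Let ccont_affine (a0 b0 w0 : C) w : ccont_at (fun w => a0 + b0 * (w - w0)) w.
Proof.
apply: (@cderiv_cont _ _ _ b0) => e e0; exists 1; first exact: ltr01.
move=> h _; have -> : a0 + b0 * (w + h - w0) - (a0 + b0 * (w - w0)) - b0 * h = 0.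
  by ring.
by rewrite Normc.normc0 mulr_ge0 ?(ltW e0) ?normc_ge0.
Qed.

Let goursat l0 : 0 < l0 -> l0 <= 1 -> L g l0 1 0 (2 * pi) = 0.
Proof.
move=> l00 l01.
have pi2 : 0 <= 2 * pi :> R by rewrite mulr_ge0// pi_ge0.
apply: (@additive_rect_zero _ (L g)) => //.
- move=> a m b c d am mb cd; rewrite /L.
  by rewrite !(@segint_split _ a b m)//; try (exact: Q_cont); lra.
- move=> a b c m d ab cm md; rewrite /L.
  by rewrite !(@segint_split _ c d m)//; try (exact: P_cont); lra.
move=> a0 c0 /andP[la0 a01] /andP[c00 c0p] e e0.
(* near [w0] the function [g] is affine up to [o(`|w - w0|)], and affine functions have
   zero integral along the image of a rectangle *)
pose w0 := sg a0 c0.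
have w0z : w0 != z.
  rewrite /w0 /sg -subr_eq0 addrC addKr mulf_neq0 ?k_neq0//.
  by rewrite -normc_gt0 normc_real normr_gt0 gt_eqF// (lt_le_trans l00).
have [d0 Hd] := g_deriv w0z.
have e1 : 0 < e / (8 * r ^+ 2) by rewrite divr_gt0// mulr_gt0// exprn_gt0.
have [dl dl0 Hdl] := Hd _ e1.
have dl1 : 0 < dl / (8 * r) by rewrite divr_gt0// mulr_gt0.
exists (dl / (8 * r)) => // a b c d la aa0 a0b b1 c1 cc0 c0d d1.
rewrite !ler_pdivlMr ?mulr_gt0// => sa sc.
set s := (b - a) + (d - c).
have sg_near l t : a <= l <= b -> c <= t <= d -> N (sg l t - w0) <= 2 * r * s.
  move=> /andP[al lb] /andP[ct td].
  have -> : sg l t - w0 = ((l - a0)%:C)%C * k t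
      + (a0%:C)%C * ((r%:C)%C * (cis t - cis c0)).
    by rewrite /w0 /sg /k rmorphB /=; ring.
  apply: le_trans (normcD _ _) _; rewrite !Normc.normcM !normc_real.
  rewrite [`|a0|]ger0_norm; last lra.
  rewrite [`|r|]ger0_norm ?(ltW r0)//.
  have h1 : `|l - a0| * N (k t) <= (b - a) * (2 * r).
    by apply: ler_pM; rewrite ?normc_ge0// ler_norml; apply/andP; split; lra.
  have h2 : a0 * (r * N (cis t - cis c0)) <= 1 * (r * (2 * (d - c))).
    apply: ler_pM => //; [lra|by rewrite mulr_ge0 ?normc_ge0 ?(ltW r0)|].
    rewrite ler_pM2l//; apply: le_trans (cis_lip _ _) _.
    by rewrite ler_pM2l// ler_norml; apply/andP; split; lra.
  by rewrite /s; lra.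
have := @L_dist g (fun w => g w0 + d0 * (w - w0)) a b c d
   (e / (8 * r ^+ 2) * (2 * r * s)) g_cont (ccont_affine _ _ _).
have s0 : 0 <= s by rewrite /s; lra.
rewrite L_affine ?subr0; [|lra..].
have -> : 4 * r * (e / (8 * r ^+ 2) * (2 * r * s)) * (b - a + (d - c)) = e * s ^+ 2.
  by rewrite -/s; field; rewrite gt_eqF.
apply; [lra..| |].
  by rewrite !mulr_ge0 ?(ltW r0) ?(ltW e0)// invr_ge0 mulr_ge0// sqr_ge0.
move=> l t al ct; have hh := sg_near l t al ct.
have := Hdl (sg l t - w0); rewrite [w0 + _]addrC subrK => Hx.
rewrite [X in N X](_ : _ = g (sg l t) - g w0 - d0 * (sg l t - w0)); last by ring.
apply: le_trans (Hx _) _; last by rewrite ler_pM2l.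
by apply: le_lt_trans hh _; rewrite /s; lra.
Qed.

(** By [goursat], the integral over the circle of radius [r] centred at 0 is that over
    its homothetic image of ratio [l0] towards [z]; [g] is bounded near [z], so this is
    [O(l0)]. *)
Lemma cauchy_circle_Re :
  segint 0 (2 * pi) (fun t => Re (g ((r%:C)%C * cis t) * ((r%:C)%C * ('i%C * cis t)))) = 0.
Proof.
have pi2 : 0 <= 2 * pi :> R by rewrite mulr_ge0// pi_ge0.
have k2 : k (2 * pi) = k 0.
  by rewrite /k /cis cos0 sin0 [2 * pi]mulr_natl cos2pi sin2pi.
have sg2 l : sg l (2 * pi) = sg l 0 by rewrite /sg k2.
have L0 l0 : 0 < l0 -> l0 <= 1 -> segint 0 (2 * pi) (P g 1) = segint 0 (2 * pi) (P g l0).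
  move=> h1 h2; have := goursat h1 h2; rewrite /L.
  have -> : Q g ^~ (2 * pi) = Q g ^~ 0.
    by apply/funext => l; rewrite /Q sg2 k2.
  by lra.
have -> : (fun t => Re (g ((r%:C)%C * cis t) * ((r%:C)%C * ('i%C * cis t)))) = P g 1.
  apply/funext => t; rewrite /P /sg /sgt /k.
  by rewrite !mul1r addrC subrK.
have [dl dl0 Hdl] := g_cont z ltr01.
set I := segint _ _ _; set B := N (g z) + 1.
have B0 : 0 < B by rewrite /B ltr_wpDl ?normc_ge0.
have key l0 : 0 < l0 -> l0 <= 1 -> l0 * (2 * r) < dl ->
    `|I| <= l0 * (r * B * (2 * pi)).
  move=> h1 h2 h3; rewrite /I (L0 _ h1 h2).
  have := @segint_dist _ 0 (2 * pi) (P g l0) (fun=> 0) (l0 * r * B) pi2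
     (P_cont g_cont) (@cst_continuous _ _ _).
  rewrite segint_cst// mul0r subr0 => /(_ _)/le_trans; apply; last by lra.
  move=> t _; rewrite subr0 /P; apply: le_trans (ler_norm_Re _) _.
  rewrite Normc.normcM mulrC; apply: ler_pM; rewrite ?normc_ge0//.
    rewrite /sgt !Normc.normcM normc_cis !normc_real !ger0_norm ?(ltW r0) ?(ltW h1)//.
    by rewrite (_ : N 'i%C = 1) ?mul1r ?mulr1// /= expr0n expr1n add0r sqrtr1.
  have : N (g (sg l0 t) - g z) <= 1.
    apply: Hdl; rewrite /sg addrC addKr Normc.normcM normc_real ger0_norm ?(ltW h1)//.
    by apply: le_lt_trans h3; rewrite ler_pM2l.
  by have := normc_subl (g (sg l0 t)) (g z); rewrite /B; lra.
apply/eqP; apply: contraT => I0.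
have I0' : 0 < `|I| by rewrite normr_gt0.
pose K := r * B * (2 * pi).
have K0 : 0 < K by rewrite /K !mulr_gt0// pi_gt0.
(* small enough for [key] to contradict [I != 0] *)
pose l0 := Num.min 1 (Num.min (dl / (4 * r)) (`|I| / (2 * K))).
have l00 : 0 < l0.
  by rewrite /l0 !lt_min ltr01 /=; apply/andP; split; apply: divr_gt0 => //; apply: mulr_gt0.
have l01 : l0 <= 1 by rewrite /l0 ge_min lexx.
have l02 : l0 <= dl / (4 * r) by rewrite /l0 !ge_min lexx orbT.
have l03 : l0 <= `|I| / (2 * K) by rewrite /l0 !ge_min lexx !orbT.
have := key l0 l00 l01; rewrite -/K.
have h1 : l0 * (2 * r) < dl.
  have l0r := mulr_gt0 l00 r0.
  move: l02; rewrite ler_pdivlMr ?mulr_gt0// => l02.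
  apply: lt_le_trans l02; rewrite !mulrA ltr_pM2r//.
  by rewrite ltr_pM2l// ltr_nat.
move=> /(_ h1); move: l03; rewrite ler_pdivlMr; last by apply: mulr_gt0.
by clearbody K l0; lra.
Qed.

End CauchyOnTheDisc.

(** * Means over the circle and Parseval's identity *)

Section TrigonometricMeans.
Context {R : realType}.
Local Notation C := R[i].
Implicit Types (k l : R -> C) (h : R -> R).

Definition avg h : R := (2 * pi)^-1 * segint 0 (2 * pi) h.

Lemma pi2_gt0 : 0 < 2 * pi :> R.
Proof. by rewrite mulr_gt0 ?pi_gt0. Qed.
Let pi2_ge0 := ltW pi2_gt0.

Lemma avgD h1 h2 : continuous h1 -> continuous h2 ->
  avg (fun x => h1 x + h2 x) = avg h1 + avg h2.
Proof. by move=> c1 c2; rewrite /avg segintD// mulrDr. Qed.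

Lemma avgB h1 h2 : continuous h1 -> continuous h2 ->
  avg (fun x => h1 x - h2 x) = avg h1 - avg h2.
Proof. by move=> c1 c2; rewrite /avg segintB// mulrBr. Qed.

Lemma avgZ a h : continuous h -> avg (fun x => a * h x) = a * avg h.
Proof. by move=> ch; rewrite /avg segintZ// mulrCA. Qed.

Lemma avg_cst a : avg (fun=> a) = a.
Proof. by rewrite /avg segint_cst// subr0 mulrC mulfK// gt_eqF ?pi2_gt0. Qed.

Lemma avg_sum I (r : seq I) (f : I -> R -> R) : (forall i, continuous (f i)) ->
  avg (fun x => \sum_(i <- r) f i x) = \sum_(i <- r) avg (f i).
Proof. by move=> cf; rewrite /avg segint_sum// mulr_sumr. Qed.

Lemma ler_avg h1 h2 : continuous h1 -> continuous h2 ->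
  (forall x, h1 x <= h2 x) -> avg h1 <= avg h2.
Proof.
move=> c1 c2 h12; rewrite /avg ler_pM2l ?invr_gt0 ?pi2_gt0//.
by apply: ler_segint => // x _.
Qed.

Lemma avg_le_cst h B : continuous h -> (forall x, h x <= B) -> avg h <= B.
Proof.
move=> ch hB; rewrite -[leRHS]avg_cst; apply: ler_avg => //.
exact: cst_continuous.
Qed.

Lemma norm_avg_le h B : continuous h -> (forall x, `|h x| <= B) -> `|avg h| <= B.
Proof.
move=> ch hB; rewrite ler_norml; apply/andP; split.
  rewrite -[leLHS]avg_cst; apply: ler_avg => //; first exact: cst_continuous.
  by move=> x; have := hB x; rewrite ler_norml => /andP[].
by apply: avg_le_cst => // x; have := hB x; rewrite ler_norml => /andP[].
Qed.

Lemma cvdiff_cisM (w : R) :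
  cvdiff (fun t => cis (w * t)) (fun t => (w%:C)%C * ('i%C * cis (w * t))).
Proof.
have dw (t : R) : is_derive t 1 (fun s : R => w * s) w.
  apply: is_derive_eq (is_deriveM (is_derive_cst w t 1) (is_derive_id t 1)) _.
  by rewrite /GRing.scale /=; ring.
move=> t; split => /=.
  by apply: is_derive_eq (is_derive1_comp (is_derive_cos (w * t)) (dw t)) _; ring.
by apply: is_derive_eq (is_derive1_comp (is_derive_sin (w * t)) (dw t)) _; ring.
Qed.

Lemma ccurve_cisM (w : R) : ccurve (fun t => cis (w * t)).
Proof. exact: cvdiff_ccurve (cvdiff_cisM w). Qed.

Lemma avg_cis (c : C) (w : R) : w != 0 -> cis (w * (2 * pi)) = 1 ->
  avg (fun t => Re (c * cis (w * t))) = 0.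
Proof.
move=> w0 per; pose A : C := c / ('i%C * (w%:C)%C).
have i0 : 'i%C != 0 :> C by rewrite eq_complex /= oner_eq0 andbF.
have w0' : (w%:C)%C != 0 :> C by rewrite eq_complex /= (negbTE w0).
have dA : cvdiff (fun t => A * cis (w * t)) (fun t => c * cis (w * t)).
  have := cvdiffM (cvdiff_cst A) (cvdiff_cisM w).
  by move/cvdiff_eq; apply => t; rewrite /A mul0r add0r; field; rewrite i0 w0'.
rewrite /avg (segint_cvdiff pi2_ge0 _ dA).
  by rewrite per mulr0 cis0 subrr mulr0.
by apply: ccurveM; [exact: ccurve_cst|exact: ccurve_cisM].
Qed.

Lemma cis_2pi_nat n : cis (n%:R * (2 * pi)) = 1 :> C.
Proof. by rewrite -cisMn /cis [2 * pi]mulr_natl cos2pi sin2pi expr1n. Qed.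

Lemma cis_2pi_natB m n : cis ((m%:R - n%:R) * (2 * pi)) = 1 :> C.
Proof. by rewrite mulrBl cisD cisN !cis_2pi_nat conjc1 mulr1. Qed.

Lemma avg_cis_natB (c : C) m n :
  avg (fun t => Re (c * cis ((m%:R - n%:R) * t))) = (m == n)%:R * Re c.
Proof.
have [->|mn] := eqVneq m n.
  rewrite mul1r -[RHS]avg_cst; congr avg; apply/funext => t.
  by rewrite subrr mul0r cis0 mulr1.
by rewrite mul0r avg_cis ?cis_2pi_natB// subr_eq0 eqr_nat.
Qed.

(** The step [s] allows for polynomials in [y ^ s]. *)
Lemma trig_orthogonality (s n : nat) (c d : nat -> C) : (0 < s)%N ->
  avg (fun t => Re ((\sum_(0 <= j < n) c j * cis ((s * j)%:R * t)) *
                    (\sum_(0 <= j < n) d j * cis ((s * j)%:R * t))^*%C)) =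
  \sum_(0 <= j < n) Re (c j * (d j)^*%C).
Proof.
move=> s0.
have E t : Re ((\sum_(0 <= j < n) c j * cis ((s * j)%:R * t)) *
               (\sum_(0 <= j < n) d j * cis ((s * j)%:R * t))^*%C) =
   \sum_(0 <= i < n) \sum_(0 <= j < n)
     Re (c i * (d j)^*%C * cis (((s * i)%:R - (s * j)%:R) * t)).
  rewrite mulr_suml cRe_sum; apply: eq_bigr => i _.
  rewrite rmorph_sum mulr_sumr cRe_sum; apply: eq_bigr => j _.
  by congr Re; rewrite rmorphM mulrBl cisD cisN; ring.
under eq_fun do rewrite E.
have cc i j : continuous (fun t : R => Re (c i * (d j)^*%C * cis (((s * i)%:R - (s * j)%:R) * t))).
  suff [] : ccurve (fun t : R => c i * (d j)^*%C * cis (((s * i)%:R - (s * j)%:R) * t)) by [].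
  by apply: ccurveM; [exact: ccurve_cst|exact: ccurve_cisM].
have cs (r : seq nat) i : continuous (fun t : R => \sum_(j <- r) Re (c i * (d j)^*%C * cis (((s * i)%:R - (s * j)%:R) * t))).
  elim: r => [|j r IH] x.
    by under eq_fun do rewrite big_nil; exact: cst_continuous.
  under eq_fun do rewrite big_cons.
  by apply: (@cvgD _ R); [exact: cc|exact: IH].
rewrite avg_sum//; apply: eq_big_nat => i /andP[_ iltn].
rewrite avg_sum//.
under eq_bigr do rewrite avg_cis_natB eqn_pmul2l//.
rewrite (bigD1_seq i) ?mem_index_iota ?iltn ?iota_uniq//= eqxx mul1r.
rewrite big1 ?addr0// => j ji; by rewrite eq_sym (negbTE ji) mul0r.
Qed.

Lemma parseval (s n : nat) (c : nat -> C) : (0 < s)%N ->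
  avg (fun t => N (\sum_(0 <= j < n) c j * cis ((s * j)%:R * t)) ^+ 2) =
  \sum_(0 <= j < n) N (c j) ^+ 2.
Proof.
move=> s0; under [in RHS]eq_bigr do rewrite normc_sqr_conj.
by rewrite -(trig_orthogonality _ c c s0); congr avg; apply/funext => t; rewrite normc_sqr_conj.
Qed.

Definition cavg k : C := (avg (fun t => Re (k t)) +i* avg (fun t => Im (k t)))%C.

Lemma Re_cavg (u : C) k : ccurve k -> Re (u * cavg k) = avg (fun t => Re (u * k t)).
Proof.
move=> [k1 k2]; rewrite cReM /=; under [in RHS]eq_fun do rewrite cReM.
rewrite avgB ?avgZ//; by move=> x; apply: cvgM; [exact: cvg_cst|exact: k1 || exact: k2].
Qed.

Lemma normc_cavg_le k B : ccurve k -> (forall t, N (k t) <= B) -> N (cavg k) <= 2 * B.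
Proof.
move=> [k1 k2] kB; apply: le_trans (normc_le_ReIm _) _; rewrite mulr2n mulrDl !mul1r /=.
rewrite lerD//; apply: norm_avg_le => // t; apply: le_trans (kB t).
  exact: ler_norm_Re.
exact: ler_norm_Im.
Qed.

End TrigonometricMeans.

(** * Taylor expansions of entire functions *)

Section CauchyTaylor.
Context {R : realType}.
Local Notation C := R[i].

(** The difference quotient at [z], extended by the derivative [d]: it is continuous,
    and differentiable away from [z], which is all that [cauchy_circle_Re] requires. *)
Definition slope (f : C -> C) (z d w : C) : C :=
  if w == z then d else (f w - f z) / (w - z).

Lemma slope_cont_center f z d : cderiv_at f z d -> ccont_at (slope f z d) z.
Proof.
move=> H e e0; have [dl dl0 K] := H e e0; exists dl => // w wz.
rewrite /slope eqxx; case: eqVneq => [_|neq].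
  by rewrite subrr Normc.normc0 ltW.
have wz0 : w - z != 0 by rewrite subr_eq0.
have := K _ wz; rewrite [z + _]addrC subrK => K1.
have -> : (f w - f z) / (w - z) - d = (f w - f z - d * (w - z)) / (w - z) by field.
by rewrite Normc.normcM normcV ler_pdivrMr// normc_gt0.
Qed.

Lemma slope_deriv f z d w dw : w != z -> cderiv_at f w dw ->
  cderiv_at (slope f z d) w ((dw * (w - z) - (f w - f z)) / (w - z) ^+ 2).
Proof.
move=> wz H e e0; set x := w - z; set F := f w - f z.
have x0 : x != 0 by rewrite subr_eq0.
have Nx : 0 < N x by rewrite normc_gt0.
pose K := N (dw * x - F) + 1.
have K0 : 0 < K by rewrite /K ltr_wpDl ?normc_ge0.
have e1 : 0 < e * N x / 4 by rewrite divr_gt0// mulr_gt0.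
have [dl dl0 Hdl] := H _ e1.
exists (Num.min dl (Num.min (N x / 2) (e * N x ^+ 3 / (4 * K)))).
  by rewrite !lt_min dl0 /= !divr_gt0 ?mulr_gt0 ?exprn_gt0.
move=> h; rewrite !lt_min => /and3P[h1 h2 h3].
have xh : N x / 2 <= N (x + h).
  by have := normc_subl x (- h); rewrite normcN opprK; lra.
have xh0 : x + h != 0 by rewrite -normc_gt0; lra.
have whz : w + h != z by rewrite -subr_eq0 addrAC.
rewrite /slope (negbTE wz) (negbTE whz) -/x -/F.
set r := f (w + h) - f w - dw * h.
have -> : (f (w + h) - f z) / (w + h - z) - F / x - (dw * x - F) / x ^+ 2 * h =
   r / (x + h) - h * h * ((dw * x - F) / (x ^+ 2 * (x + h))).
  have -> : f (w + h) = r + f w + dw * h by rewrite /r; ring.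
  have -> : w + h - z = x + h by rewrite /x; ring.
  have -> : f z = f w - F by rewrite /F; ring.
  by field; rewrite x0 xh0.
apply: le_trans (normcD _ _) _; rewrite normcN.
have rb : N (r / (x + h)) <= e / 2 * N h.
  rewrite Normc.normcM normcV ler_pdivrMr; last by lra.
  apply: le_trans (Hdl _ h1) _.
  have -> : e * N x / 4 * N h = e / 2 * N h * (N x / 2) by field.
  by apply: ler_wpM2l => //; rewrite mulr_ge0 ?normc_ge0//; lra.
have qb : N (h * h * ((dw * x - F) / (x ^+ 2 * (x + h)))) <= e / 2 * N h.
  rewrite !Normc.normcM normcV Normc.normcM normcX.
  have xx : N x ^+ 3 / 2 <= N x ^+ 2 * N (x + h).
    rewrite exprS [N x * _]mulrC -mulrA ler_pM2l ?exprn_gt0//.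
  have : N (dw * x - F) / (N x ^+ 2 * N (x + h)) <= K / (N x ^+ 3 / 2).
    apply: ler_pM; rewrite ?normc_ge0 ?invr_ge0 ?mulr_ge0 ?sqr_ge0 ?normc_ge0//.
      by rewrite /K lerDl.
    by rewrite lef_pV2 ?posrE ?mulr_gt0 ?divr_gt0 ?exprn_gt0//; lra.
  move=> /(ler_wpM2l (normc_ge0 h)) hK.
  rewrite -mulrA; apply: le_trans (ler_wpM2l (normc_ge0 h) hK) _.
  rewrite mulrC; apply: ler_wpM2r; first exact: normc_ge0.
  have -> : K / (N x ^+ 3 / 2) = 2 * K / N x ^+ 3 by field; rewrite gt_eqF.
  rewrite mulrA ler_pdivrMr ?exprn_gt0//.
  move: h3; rewrite ltr_pdivlMr ?mulr_gt0//; lra.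
by lra.
Qed.

Variable f : C -> C.
Hypothesis f_hol : forall z, exists d, cderiv_at f z d.

Let f_cont z : ccont_at f z.
Proof. by have [d /cderiv_cont] := f_hol z. Qed.

Lemma slope_cont z d : cderiv_at f z d -> forall w, ccont_at (slope f z d) w.
Proof.
move=> H w; have [->|wz] := eqVneq w z; first exact: slope_cont_center.
have [dw Hw] := f_hol w.
exact: cderiv_cont (slope_deriv d wz Hw).
Qed.

(** Cauchy's theorem for the difference quotient; the factor [v] selects the real or the
    imaginary part. *)
Lemma cauchy_formula_Re (z v : C) (r : R) : N z < r ->
  avg (fun t => let x := (r%:C)%C * cis t in
                Re (v * ((f x - f z) * (x / (x - z))))) = 0.
Proof.
move=> zr; have [d Hd] := f_hol z.
pose g w : C := - 'i%C * v * slope f z d w.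
have cst_mul_cont (c : C) (k : C -> C) w : ccont_at k w -> ccont_at (fun w => c * k w) w.
  move=> H e e0; have e1 : 0 < e / (N c + 1).
    by rewrite divr_gt0// ltr_wpDl ?normc_ge0.
  have [dl dl0 K] := H _ e1; exists dl => // x /K.
  rewrite -mulrBr Normc.normcM ler_pdivlMr; last by rewrite ltr_wpDl ?normc_ge0.
  by move=> Hx; have := normc_ge0 (k x - k w); lra.
have cst_mul_deriv (c : C) (k : C -> C) w dk : cderiv_at k w dk -> cderiv_at (fun w => c * k w) w (c * dk).
  move=> H e e0; have e1 : 0 < e / (N c + 1).
    by rewrite divr_gt0// ltr_wpDl ?normc_ge0.
  have [dl dl0 K] := H _ e1; exists dl => // h /K.
  have -> : c * k (w + h) - c * k w - c * dk * h = c * (k (w + h) - k w - dk * h) by ring.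
  rewrite Normc.normcM mulrAC ler_pdivlMr; last by rewrite ltr_wpDl ?normc_ge0.
  by move=> Hx; have := normc_ge0 (k (w + h) - k w - dk * h); lra.
have gc w : ccont_at g w by apply: cst_mul_cont; exact: slope_cont.
have gd w : w != z -> exists d, cderiv_at g w d.
  move=> wz; have [dw Hw] := f_hol w; eexists; apply: cst_mul_deriv.
  exact: slope_deriv wz Hw.
have r0 := le_lt_trans (normc_ge0 z) zr.
have := cauchy_circle_Re zr gc gd; rewrite /avg => E.
rewrite [X in _ * X](_ : _ = 0) ?mulr0//; rewrite -[RHS]E.
apply: eq_segint => t _ /=; set x := (r%:C)%C * cis t.
have xz : x != z.
  apply/eqP => xz; move: zr; rewrite -xz normc_polar ?ltxx//; exact: ltW.
rewrite /g /slope (negbTE xz); congr Re.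
have ii : 'i%C * 'i%C = -1 :> C by rewrite -expr2 sqr_i.
have -> : - 'i%C * v * ((f x - f z) / (x - z)) * ((r%:C)%C * ('i%C * cis t)) =
  - ('i%C * 'i%C) * (v * ((f x - f z) / (x - z)) * x) by rewrite /x; ring.
by rewrite ii; ring.
Qed.

Definition circle_coef (r : R) (j : nat) : C :=
  cavg (fun t => f ((r%:C)%C * cis t) * ((r%:C)%C * cis t) ^- j).

Let polarVX (r t : R) j : 0 < r ->
  ((r%:C)%C * cis t) ^- j = ((r ^- j)%:C)%C * cis ((0%:R - j%:R) * t) :> C.
Proof.
move=> r0; rewrite exprMn cisMn sub0r mulNr cisN invfM.
have -> : (cis (j%:R * t))^-1 = (cis (j%:R * t))^*%C.
  rewrite -cisN; have : cis (j%:R * t) * cis (- (j%:R * t)) = 1 :> C.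
    by rewrite -cisD subrr cis0.
  by move=> /(congr1 (fun x => (cis (j%:R * t))^-1 * x)); rewrite mulrA mulr1 mulVf ?mul1r//;
    rewrite -normc_gt0 normc_cis.
by rewrite -rmorphXn -fmorphV.
Qed.

Let ccurve_polarV (r : R) j : 0 < r -> ccurve (fun t => ((r%:C)%C * cis t) ^- j).
Proof.
move=> r0; under eq_fun do rewrite polarVX//.
by apply: ccurveM; [exact: ccurve_cst|exact: ccurve_cisM].
Qed.

Lemma circle_bound (r : R) : exists2 B, 0 <= B & forall t, N (f ((r%:C)%C * cis t)) <= B.
Proof.
have cc : continuous (fun t : R => N (f ((r%:C)%C * cis t))).
  by apply: ccurve_normc; apply: ccurve_comp => //; exact: ccurve_polar.
have [c _ cM] := @EVT_max R (fun t : R => N (f ((r%:C)%C * cis t))) 0 (2 * pi)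
  (ltW pi2_gt0) (continuous_subspaceT cc).
exists (N (f ((r%:C)%C * cis c))) => [|t]; first exact: normc_ge0.
pose m := Num.floor (t / (2 * pi)).
have m1 : m%:~R <= t / (2 * pi) by rewrite floor_le.
have m2 : t / (2 * pi) < m%:~R + 1.
  by have := floorD1_gt (t / (2 * pi)); rewrite intrD.
have p0 := @pi2_gt0 R.
have -> : cis t = cis (t - m%:~R * (2 * pi)) :> C.
  suff E : cis (m%:~R * (2 * pi)) = 1 :> C.
    by rewrite cisD cisN E conjc1 mulr1.
  case: (m) => n; first exact: cis_2pi_nat.
  by rewrite NegzE mulrNz mulNr cisN cis_2pi_nat conjc1.
apply: cM; rewrite in_itv/=; apply/andP; split.
  by move: m1; rewrite ler_pdivlMr//; lra.
by move: m2; rewrite ltr_pdivrMr//; lra.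
Qed.

Lemma circle_coef_bound (r B : R) j : 0 < r ->
  (forall t, N (f ((r%:C)%C * cis t)) <= B) -> N (circle_coef r j) * r ^+ j <= 2 * B.
Proof.
move=> r0 fB; rewrite -ler_pdivlMr ?exprn_gt0// -mulrA.
apply: normc_cavg_le.
  apply: ccurveM; last exact: ccurve_polarV.
  by apply: ccurve_comp => //; exact: ccurve_polar.
move=> t; rewrite Normc.normcM normcV normcX normc_polar ?(ltW r0)//.
by apply: ler_wpM2r; rewrite ?invr_ge0 ?exprn_ge0 ?(ltW r0).
Qed.

(** Expanding the Cauchy kernel to order [n], the averages of the powers of
    [z / zeta] give the Taylor polynomial, and the last term of the geometric
    sum is the remainder. *)
Lemma taylor_on_disc (z : C) (r B : R) (n : nat) : N z < r ->
  (forall t, N (f ((r%:C)%C * cis t)) <= B) ->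
  N (f z - \sum_(0 <= j < n.+1) circle_coef r j * z ^+ j) <=
    2 * ((B + N (f z)) * (r / (r - N z)) * (N z / r) ^+ n.+1).
Proof.
move=> zr fB; have r0 := le_lt_trans (normc_ge0 z) zr.
set S := \sum_(_ <= _ < _) _; set E := _ * _ * _.
suff H v : N v <= 1 -> `|Re (v * (f z - S))| <= E.
  apply: le_trans (normc_le_ReIm _) _; rewrite mulr2n mulrDl !mul1r; apply: lerD.
    by have := H 1; rewrite mul1r Normc.normc1 lexx; apply.
  have := H ('i%C); rewrite mulrC ReiNIm normrN; apply.
  by rewrite /= expr0n expr1n add0r sqrtr1.
move=> v1.
pose X t : C := (r%:C)%C * cis t.
have X0 t : X t != 0 by rewrite -normc_gt0 normc_polar ?(ltW r0).
have NX t : N (X t) = r by rewrite normc_polar ?(ltW r0).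
have Xz t : X t - z != 0.
  by rewrite -normc_gt0; apply: lt_le_trans (normc_subl _ _); rewrite NX; lra.
pose G t := v * ((f (X t) - f z) * (X t / (X t - z))).
pose T t := \sum_(0 <= j < n.+1) (v * z ^+ j * (f (X t) * X t ^- j)).
pose U t := \sum_(0 <= j < n.+1) (v * f z * z ^+ j * X t ^- j).
pose W t := v * ((f (X t) - f z) * ((z / X t) ^+ n.+1 * (X t / (X t - z)))).
have GE t : G t = T t - U t + W t.
  have geo : X t / (X t - z) =
      \sum_(0 <= j < n.+1) (z / X t) ^+ j + (z / X t) ^+ n.+1 * (X t / (X t - z)).
    elim: n {S E T U W} => [|m IH].
      by rewrite big_nat1 expr0 expr1; field; rewrite X0 Xz.
    rewrite big_nat_recr//= {1}IH -addrA; congr (_ + _).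
    by rewrite [(z / X t) ^+ m.+2]exprS; set y := (z / X t) ^+ _; field; rewrite X0 Xz.
  rewrite /G {1}geo mulrDr mulrDr; congr (_ + _).
  rewrite /T /U mulrBl mulrBr; congr (_ - _).
    rewrite mulrA mulr_sumr; apply: eq_bigr => j _; rewrite expr_div_n; ring.
  by rewrite mulrA mulr_sumr; apply: eq_bigr => j _; rewrite expr_div_n; ring.
have cX := ccurve_polar r.
have cfX : ccurve (fun t => f (X t)) by apply: ccurve_comp.
have cT : ccurve T.
  apply: ccurve_sum => j; apply: ccurveM; first exact: ccurve_cst.
  by apply: ccurveM => //; exact: ccurve_polarV.
have cU : ccurve U.
  apply: ccurve_sum => j; apply: ccurveM; first exact: ccurve_cst.
  exact: ccurve_polarV.
have cG : ccurve G.
  apply: ccurveM; first exact: ccurve_cst.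
  have [d Hd] := f_hol z.
  have -> : (fun t => (f (X t) - f z) * (X t / (X t - z))) =
      (fun t => slope f z d (X t) * X t).
    apply/funext => t; rewrite /slope -subr_eq0 (negbTE (Xz t)); ring.
  apply: ccurveM => //; apply: ccurve_comp => //.
  exact: slope_cont Hd.
have cW : ccurve W.
  have -> : W = (fun t => G t - (T t - U t)) by apply/funext => t; rewrite GE; ring.
  by apply: ccurveB => //; apply: ccurveB.
have := cauchy_formula_Re v zr; rewrite -/(X _) => G0.
have aT : avg (fun t => Re (T t)) = Re (v * S).
  rewrite /T; under eq_fun do rewrite cRe_sum.
  rewrite avg_sum; last first.
    move=> j; suff [] : ccurve (fun t => v * z ^+ j * (f (X t) * X t ^- j)) by [].
    apply: ccurveM; first exact: ccurve_cst.
    by apply: ccurveM => //; exact: ccurve_polarV.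
  rewrite /S mulr_sumr cRe_sum; apply: eq_bigr => j _.
  rewrite -Re_cavg; last by apply: ccurveM => //; exact: ccurve_polarV.
  by congr Re; rewrite -/(circle_coef r j); ring.
have aU : avg (fun t => Re (U t)) = Re (v * f z).
  rewrite /U; under eq_fun do rewrite cRe_sum.
  rewrite avg_sum; last first.
    move=> j; suff [] : ccurve (fun t => v * f z * z ^+ j * X t ^- j) by [].
    by apply: ccurveM; [exact: ccurve_cst|exact: ccurve_polarV].
  rewrite big_nat_recl// big1_seq ?addr0 => [|j _].
    rewrite -[RHS]avg_cst; congr avg; apply/funext => t.
    by rewrite !expr0 invr1 !mulr1.
  have -> : (fun t => Re (v * f z * z ^+ j.+1 * X t ^- j.+1)) =
     (fun t => Re (v * f z * z ^+ j.+1 * ((r ^- j.+1)%:C)%C * cis ((0%:R - j.+1%:R) * t))).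
    by apply/funext => t; rewrite /X polarVX// mulrA.
  by rewrite avg_cis_natB mul0r.
have aG : avg (fun t => Re (G t)) = avg (fun t => Re (T t)) - avg (fun t => Re (U t)) + avg (fun t => Re (W t)).
  have -> : (fun t => Re (G t)) = (fun t => (Re (T t) - Re (U t)) + Re (W t)).
    by apply/funext => t; rewrite GE cReD cReB.
  have [rT _] := cT; have [rU _] := cU; have [rW _] := cW.
  by rewrite avgD ?avgB// => x; apply: (@cvgB _ R); [exact: rT|exact: rU].
have WE t : `|Re (W t)| <= E.
  apply: le_trans (ler_norm_Re _) _; rewrite /W Normc.normcM.
  apply: le_trans (_ : 1 * N ((f (X t) - f z) * ((z / X t) ^+ n.+1 * (X t / (X t - z)))) <= _).
    by apply: ler_wpM2r => //; exact: normc_ge0.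
  rewrite mul1r Normc.normcM /E -[leRHS]mulrA.
  apply: ler_pM; rewrite ?normc_ge0//.
    by apply: le_trans (normcD _ _) _; rewrite normcN lerD//; exact: fB.
  rewrite Normc.normcM normcX (Normc.normcM z) normcV NX mulrC.
  apply: ler_wpM2r; first by rewrite exprn_ge0 ?divr_ge0 ?normc_ge0 ?(ltW r0).
  rewrite (Normc.normcM (X t)) normcV NX ler_pM2l// lef_pV2 ?posrE ?normc_gt0 ?subr_gt0//.
  by apply: le_trans (normc_subl _ _); rewrite NX.
have : avg (fun t => Re (W t)) = Re (v * (f z - S)).
  by move: aG; rewrite G0 aT aU mulrBr cReB; lra.
move=> <-; apply: norm_avg_le => //; by have [] := cW.
Qed.

End CauchyTaylor.

Section PowerSeries.
Context {R : realType}.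
Local Notation C := R[i].
Implicit Types (a : nat -> C) (f : C -> C) (z : C).

Definition psum a n z : C := \sum_(0 <= k < n) a k / k`!%:R * z ^+ k.

(** Equivalently, the power series has infinite radius of convergence. *)
Definition rapid a := forall rho : R, exists B, forall k,
  N (a k) * `|rho| ^+ k / k`!%:R <= B.

(** Pointwise convergence to [f] of the power series; it is locally uniform by
    [expands_tail]. *)
Definition expands f a := forall z (e : R), 0 < e ->
  exists n0, forall n, (n0 <= n)%N -> N (f z - psum a n z) <= e.

Lemma normc_term a k z : N (a k / k`!%:R * z ^+ k) = N (a k) * N z ^+ k / k`!%:R.
Proof. by rewrite !Normc.normcM normcV normc_nat normcX mulrAC. Qed.

Lemma geometric_tail_le (B : R) n m : 0 <= B ->
  \sum_(n <= k < m) B / 2 ^+ k <= 2 * B / 2 ^+ n.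
Proof.
move=> B0; have [mn|/ltnW nm] := leqP m n.
  by rewrite big_geq// divr_ge0// mulr_ge0.
suff -> : \sum_(n <= k < m) B / 2 ^+ k = 2 * B / 2 ^+ n - 2 * B / 2 ^+ m.
  by rewrite gerBl divr_ge0// mulr_ge0.
elim: m nm => [|m IH].
  by rewrite leqn0 => /eqP ->; rewrite big_geq// subrr.
rewrite leq_eqVlt => /predU1P[->|nm]; first by rewrite big_geq// subrr.
rewrite big_nat_recr//= IH// exprS; field.
by rewrite !expf_neq0.
Qed.

(** A bound at radius [2 * rho] leaves a geometric series of ratio 1/2 at radius [rho]. *)
Lemma psum_tail a (rho B : R) : 0 <= rho ->
  (forall k, N (a k) * (2 * rho) ^+ k / k`!%:R <= B) ->
  forall z n m, N z <= rho -> (n <= m)%N -> N (psum a m z - psum a n z) <= 2 * B / 2 ^+ n.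
Proof.
move=> rho0 aB z n m zr nm.
have B0 : 0 <= B by apply: le_trans (aB 0%N); rewrite expr0 fact0 divr1 mulr1 normc_ge0.
rewrite /psum [X in N (X - _)](big_cat_nat (n := n))//= addrAC subrr add0r.
apply: le_trans (normc_sum _ _ _) _; apply: le_trans _ (geometric_tail_le n m B0).
apply: ler_sum => k _; rewrite normc_term ler_pdivlMr ?exprn_gt0//.
apply: le_trans _ (aB k); rewrite exprMn.
have -> : N (a k) * N z ^+ k / k`!%:R * 2 ^+ k = (N (a k) * 2 ^+ k / k`!%:R) * N z ^+ k by ring.
have -> : N (a k) * (2 ^+ k * rho ^+ k) / k`!%:R = (N (a k) * 2 ^+ k / k`!%:R) * rho ^+ k by ring.
apply: ler_wpM2l; first by rewrite divr_ge0// mulr_ge0 ?normc_ge0 ?exprn_ge0.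
by rewrite lerXn2r ?nnegrE ?normc_ge0.
Qed.

Lemma expands_tail f a (rho B : R) : expands f a -> 0 <= rho ->
  (forall k, N (a k) * (2 * rho) ^+ k / k`!%:R <= B) ->
  forall z n, N z <= rho -> N (f z - psum a n z) <= 2 * B / 2 ^+ n.
Proof.
move=> fa rho0 aB z n zr; apply/ler_addgt0Pl => e e0.
have [n0 Hn] := fa z e e0.
have := Hn (maxn n0 n) (leq_maxl _ _).
have := psum_tail rho0 aB zr (leq_maxr n0 n).
have := normcD (f z - psum a (maxn n0 n) z) (psum a (maxn n0 n) z - psum a n z).
by rewrite addrA subrK; lra.
Qed.

Lemma rapid_bound a (rho : R) : rapid a -> 0 <= rho ->
  exists B, forall k, N (a k) * (2 * rho) ^+ k / k`!%:R <= B.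
Proof.
move=> ra rho0; have [B aB] := ra (2 * rho); exists B => k.
by have := aB k; rewrite ger0_norm// mulr_ge0.
Qed.

Lemma real_series_cvg (u : nat -> R) (B : R) : (forall k, `|u k| <= B / 2 ^+ k) ->
  cvgn (series u).
Proof.
move=> uB.
have B0 : 0 <= B.
  by have := le_trans (normr_ge0 _) (uB 0%N); rewrite expr0 divr1.
apply: normed_cvg; apply: nondecreasing_is_cvgn.
  by apply/nondecreasing_seqP => n; rewrite [leRHS]seriesSr lerDl normr_ge0.
exists (2 * B / 2 ^+ 0) => _ [n _ <-]; rewrite /series /=.
by apply: le_trans (geometric_tail_le 0 n B0); apply: ler_sum => k _.
Qed.

Lemma exists_expands a : rapid a -> exists f, expands f a.
Proof.
move=> ra; pose ur z k := Re (a k / k`!%:R * z ^+ k).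
pose ui z k := Im (a k / k`!%:R * z ^+ k).
have cv z : cvgn (series (ur z)) /\ cvgn (series (ui z)).
  have [B aB] := rapid_bound ra (normc_ge0 z).
  have tB k : N (a k / k`!%:R * z ^+ k) <= B / 2 ^+ k.
    rewrite normc_term ler_pdivlMr ?exprn_gt0//; apply: le_trans _ (aB k).
    by rewrite exprMn le_eqVlt; apply/orP; left; apply/eqP; ring.
  by split; apply: (@real_series_cvg _ B) => k; apply: le_trans _ (tB k);
    [exact: ler_norm_Re|exact: ler_norm_Im].
exists (fun z => (limn (series (ur z)) +i* limn (series (ui z)))%C) => z e e0.
have [c1 c2] := cv z; have e2 : 0 < e / 2 by lra.
move/cvgrPdist_le: c1 => /(_ _ e2) [n1 _ h1].
move/cvgrPdist_le: c2 => /(_ _ e2) [n2 _ h2].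
exists (maxn n1 n2) => n; rewrite geq_max => /andP[/h1 k1 /h2 k2].
apply: le_trans (normc_le_ReIm _) _; rewrite cReB cImB /= /psum cRe_sum cIm_sum.
by move: k1 k2; rewrite /series /=; lra.
Qed.

Lemma rapid_shift a : rapid a -> rapid (fun k => a k.+1).
Proof.
move=> ra rho; pose r := `|rho| + 1; have r0 : 0 < r by rewrite /r ltr_wpDl.
have [B aB] := rapid_bound ra (ltW r0).
have B0 : 0 <= B by apply: le_trans (aB 0%N); rewrite expr0 fact0 divr1 mulr1 normc_ge0.
exists (B / r) => k; have := aB k.+1; rewrite ler_pdivlMr// => H.
apply: le_trans H; rewrite exprMn factS natrM.
have f0 : 0 < k`!%:R :> R by rewrite ltr0n fact_gt0.
rewrite -mulrA [r ^+ _]exprS.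
have -> : N (a k.+1) * (2 ^+ k.+1 * (r * r ^+ k) ) / (k.+1%:R * k`!%:R) =
  (N (a k.+1) * r / k`!%:R) * (2 ^+ k.+1 / k.+1%:R * r ^+ k).
  by field; rewrite gt_eqF//= pnatr_eq0.
have -> : N (a k.+1) * (`|rho| ^+ k / k`!%:R) * r = (N (a k.+1) * r / k`!%:R) * `|rho| ^+ k by ring.
apply: ler_wpM2l; first by rewrite divr_ge0 ?mulr_ge0 ?normc_ge0 ?(ltW r0).
rewrite -[leLHS]mul1r; apply: ler_pM => //.
  by rewrite ler_pdivlMr ?ltr0Sn// mul1r -natrX ler_nat ltnW// ltn_expl.
by rewrite lerXn2r ?nnegrE ?(ltW r0)// /r lerDl.
Qed.

(** Crude, but of second order in [h] and geometric in [k], which is enough to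
    differentiate a series with [rapid] coefficients term by term. *)
Lemma binomial_remainder (z h : C) (rho : R) k : 1 <= rho -> N z <= rho -> N h <= rho ->
  N ((z + h) ^+ k - z ^+ k - k%:R * z ^+ k.-1 * h) <= N h ^+ 2 * (4 * rho) ^+ k.
Proof.
move=> r1 zr hr; elim: k => [|k IH].
  by rewrite !expr0 subrr mul0r mul0r subrr Normc.normc0 mulr1 sqr_ge0.
have -> : (z + h) ^+ k.+1 - z ^+ k.+1 - k.+1%:R * z ^+ k * h =
    (z + h) * ((z + h) ^+ k - z ^+ k - k%:R * z ^+ k.-1 * h) + k%:R * z ^+ k.-1 * h ^+ 2.
  case: k {IH} => [|k]; first by rewrite !expr1 !expr0; ring.
  by rewrite /= !exprS -[k.+2%:R]natr1; ring.
apply: le_trans (normcD _ _) _; rewrite !Normc.normcM !normcX normc_nat.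
have r0 : 0 <= rho by lra.
have h1 : N (z + h) * N ((z + h) ^+ k - z ^+ k - k%:R * z ^+ k.-1 * h) <=
    (2 * rho) * (N h ^+ 2 * (4 * rho) ^+ k).
  apply: ler_pM; rewrite ?normc_ge0//.
  by apply: le_trans (normcD _ _) _; lra.
have h2 : k%:R * N z ^+ k.-1 * N h ^+ 2 <= (2 * rho) * (N h ^+ 2 * (4 * rho) ^+ k).
  rewrite [leLHS]mulrC [leRHS]mulrCA; apply: ler_wpM2l; first exact: sqr_ge0.
  apply: le_trans (_ : 4 ^+ k * rho ^+ k <= _).
    apply: ler_pM; rewrite ?ler0n ?exprn_ge0 ?normc_ge0//.
      by rewrite -natrX ler_nat ltnW// ltn_expl.
    apply: le_trans (_ : rho ^+ k.-1 <= _); first by rewrite lerXn2r ?nnegrE ?normc_ge0.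
    by case: k {IH h1} => [|k]//=; rewrite exprS ler_peMl ?exprn_ge0.
  by rewrite -exprMn ler_peMl ?exprn_ge0 ?mulr_ge0//; lra.
have -> : N h ^+ 2 * (4 * rho) ^+ k.+1 =
   (2 * rho) * (N h ^+ 2 * (4 * rho) ^+ k) + (2 * rho) * (N h ^+ 2 * (4 * rho) ^+ k).
  by rewrite [(4 * rho) ^+ k.+1]exprS; ring.
exact: lerD.
Qed.

Lemma expands_deriv f g a : rapid a -> expands f a -> expands g (fun k => a k.+1) ->
  forall z, cderiv_at f z (g z).
Proof.
move=> ra fa ga z e e0; pose rho := N z + 1.
have rho1 : 1 <= rho by rewrite /rho lerDr normc_ge0.
have r40 : 0 <= 4 * rho by lra.
have [B aB] := rapid_bound ra r40.
have B0 : 0 <= B by apply: le_trans (aB 0%N); rewrite expr0 fact0 divr1 mulr1 normc_ge0.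
exists (Num.min 1 (e / (2 * B + 1))).
  by rewrite lt_min ltr01 divr_gt0// ltr_wpDl// mulr_ge0.
move=> h; rewrite lt_min => /andP[h1].
rewrite ltr_pdivlMr; last by rewrite ltr_wpDl// mulr_ge0.
move=> h2; apply/ler_addgt0Pl => d d0.
have d3 : 0 < d / 4 by lra.
have d4 : 0 < d / (4 * (N h + 1)) by rewrite divr_gt0// mulr_gt0// ltr_wpDl ?normc_ge0.
have [n1 H1] := fa (z + h) _ d3; have [n2 H2] := fa z _ d3; have [n3 H3] := ga z _ d4.
pose n := (maxn n1 (maxn n2 n3)).
have {}H1 := H1 n.+1 (leqW (leq_maxl _ _)).
have {}H2 : N (f z - psum a n.+1 z) <= d / 4.
  by apply: H2; rewrite leqW// /n maxnCA leq_maxl.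
have {}H3 : N (g z - psum (fun k => a k.+1) n z) <= d / (4 * (N h + 1)).
  by apply: H3; rewrite /n maxnA leq_maxr.
have gh : N ((g z - psum (fun k => a k.+1) n z) * h) <= d / 4.
  rewrite Normc.normcM; move: H3; rewrite ler_pdivlMr ?mulr_gt0 ?ltr_wpDl ?normc_ge0//.
  by have := normc_ge0 (g z - psum (fun k => a k.+1) n z); lra.
have pb : N (psum a n.+1 (z + h) - psum a n.+1 z - psum (fun k => a k.+1) n z * h) <=
    2 * B * N h ^+ 2.
  have -> : psum a n.+1 (z + h) - psum a n.+1 z - psum (fun k => a k.+1) n z * h =
     \sum_(0 <= k < n.+1) a k / k`!%:R * ((z + h) ^+ k - z ^+ k - k%:R * z ^+ k.-1 * h).
    have -> : psum (fun k => a k.+1) n z * h = \sum_(0 <= k < n.+1) a k / k`!%:R * (k%:R * z ^+ k.-1 * h).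
      rewrite /psum big_nat_recl// mul0r mul0r mulr0 add0r mulr_suml.
      apply: eq_bigr => k _; rewrite /= factS natrM; field.
      by rewrite [1 + _]addrC natr1 !pnatr_eq0 -lt0n fact_gt0.
    rewrite /psum -!sumrB; apply: eq_bigr => k _; ring.
  apply: le_trans (normc_sum _ _ _) _.
  apply: le_trans (_ : \sum_(0 <= k < n.+1) (B * N h ^+ 2) / 2 ^+ k <= _); last first.
    apply: le_trans (geometric_tail_le _ _ _) _; first by rewrite mulr_ge0// sqr_ge0.
    by rewrite expr0 divr1 mulrA.
  apply: ler_sum => k _; rewrite !Normc.normcM normcV normc_nat.
  have := binomial_remainder k rho1 _ (le_trans (ltW h1) rho1) => /(_ z).
  have zr : N z <= rho by rewrite /rho lerDl.
  move=> /(_ zr) br.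
  have c0 : 0 <= N (a k) / k`!%:R by rewrite divr_ge0 ?normc_ge0.
  apply: le_trans (ler_wpM2l c0 br) _.
  rewrite ler_pdivlMr ?exprn_gt0//.
  have -> : N (a k) / k`!%:R * (N h ^+ 2 * (4 * rho) ^+ k) * 2 ^+ k =
     N (a k) * (2 * (4 * rho)) ^+ k / k`!%:R * N h ^+ 2.
    by rewrite [(2 * _) ^+ k]exprMn; ring.
  by apply: ler_wpM2r; rewrite ?sqr_ge0.
have -> : f (z + h) - f z - g z * h =
  (f (z + h) - psum a n.+1 (z + h)) + (- (f z - psum a n.+1 z) +
  (- ((g z - psum (fun k => a k.+1) n z) * h) +
   (psum a n.+1 (z + h) - psum a n.+1 z - psum (fun k => a k.+1) n z * h))) by ring.
apply: le_trans (normcD _ _) _.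
apply: le_trans (lerD (lexx _) (normcD _ _)) _.
apply: le_trans (lerD (lexx _) (lerD (lexx _) (normcD _ _))) _.
rewrite !normcN.
have : 2 * B * N h ^+ 2 <= e * N h.
  rewrite expr2 mulrA; apply: ler_wpM2r; first exact: normc_ge0.
  by have := normc_ge0 h; lra.
by lra.
Qed.

(** By [taylor_on_disc] the coefficients computed on a circle expand [f] inside it;
    those of two circles agree because both expand [f] near 0. *)
Lemma entire_expands f : (forall z, derivable f z 1) ->
  exists2 a, rapid a & expands f a.
Proof.
move=> fe; have fh z : exists d, cderiv_at f z d.
  by exists (derive1 f z); exact: derivable_cderiv.
have rr r : 2 <= r -> circle_coef f r = circle_coef f 2.
  move=> r2; have r0 : 0 < r by lra.
  have [B1 B10 f1] := circle_bound fh r; have [B2 B20 f2] := circle_bound fh 2.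
  pose c j := circle_coef f r j - circle_coef f 2 j.
  pose B := 2 * B1 + 2 * B2.
  have cB j : N (c j) <= B / 2 ^+ j.
    rewrite ler_pdivlMr ?exprn_gt0//.
    have h1 := circle_coef_bound fh j r0 f1; have h2 := circle_coef_bound fh j (ltr0n R 2) f2.
    have := normcD (circle_coef f r j) (- circle_coef f 2 j); rewrite normcN -/(c j).
    move=> /(ler_wpM2r (exprn_ge0 j (ler0n R 2))) h3.
    apply: le_trans h3 _; rewrite mulrDl /B; apply: lerD => //.
    by apply: le_trans h1; rewrite ler_wpM2l ?normc_ge0// lerXn2r ?nnegrE// ltW.
  have sm (x e : R) : 0 < x -> x < 1 -> 0 < e -> exists n0, forall n, (n0 <= n)%N ->
      N (\sum_(0 <= j < n.+1) c j * (x%:C)%C ^+ j) <= e.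
    move=> x0 x1 e0.
    have Nx : N ((x%:C)%C) = x by rewrite normc_real gtr0_norm.
    pose K1 := (B1 + N (f (x%:C)%C)) * (r / (r - x)).
    pose K2 := (B2 + N (f (x%:C)%C)) * (2 / (2 - x)).
    pose K := 2 * K1 + 2 * K2 + 1.
    have K10 : 0 <= K1.
      by rewrite mulr_ge0 ?addr_ge0 ?normc_ge0// divr_ge0 ?(ltW r0)//; lra.
    have K20 : 0 <= K2.
      by rewrite mulr_ge0 ?addr_ge0 ?normc_ge0// divr_ge0//; lra.
    have K0 : 0 < K by rewrite /K; lra.
    have [n0 Hn0] := exists_pow2_gt (K / e).
    exists n0 => n n0n.
    have q1 s : 2 <= s -> (x / s) ^+ n.+1 <= 2 ^- n.
      move=> s2; rewrite -exprVn; apply: le_trans (_ : 2^-1 ^+ n.+1 <= _).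
        rewrite lerXn2r ?nnegrE ?divr_ge0 ?invr_ge0//; try lra.
        by rewrite ler_pdivrMr; lra.
      by rewrite exprS ler_piMl ?exprn_ge0//; lra.
    have t1 : N (f (x%:C)%C - \sum_(0 <= j < n.+1) circle_coef f r j * (x%:C)%C ^+ j) <= 2 * K1 * 2 ^- n.
      have xr : N ((x%:C)%C) < r by rewrite Nx; lra.
      apply: le_trans (taylor_on_disc fh n xr f1) _; rewrite Nx -[leRHS]mulrA ler_pM2l//.
      by apply: ler_wpM2l => //; exact: q1.
    have t2 : N (f (x%:C)%C - \sum_(0 <= j < n.+1) circle_coef f 2 j * (x%:C)%C ^+ j) <= 2 * K2 * 2 ^- n.
      have xr : N ((x%:C)%C) < 2 by rewrite Nx; lra.
      apply: le_trans (taylor_on_disc fh n xr f2) _; rewrite Nx -[leRHS]mulrA ler_pM2l//.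
      by apply: ler_wpM2l => //; exact: q1.
    have -> : \sum_(0 <= j < n.+1) c j * (x%:C)%C ^+ j =
      (f (x%:C)%C - \sum_(0 <= j < n.+1) circle_coef f 2 j * (x%:C)%C ^+ j) -
      (f (x%:C)%C - \sum_(0 <= j < n.+1) circle_coef f r j * (x%:C)%C ^+ j).
      rewrite opprB addrC addrA subrK -sumrB.
      by apply: eq_bigr => j _; rewrite /c mulrBl.
    apply: le_trans (normcD _ _) _; rewrite normcN.
    apply: le_trans (lerD t2 t1) _ => {t1 t2}.
    have : K * 2 ^- n <= e.
      rewrite ler_pdivrMr ?exprn_gt0//; move: Hn0; rewrite ltr_pdivrMr// => /ltW h.
      apply: le_trans h _; rewrite mulrC; apply: ler_wpM2l; first exact: ltW.
      by apply: ler_weXn2l => //; rewrite ler1n.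
    have : 0 < 2 ^- n :> R by rewrite invr_gt0 exprn_gt0.
    by rewrite /K; clearbody K1 K2; clear -K10; lra.
  apply/funext => j; apply/eqP; rewrite -subr_eq0 -/(c j); apply/eqP.
  have [m] := ubnP j; elim: m => // m IH in j *; rewrite ltnS => jm.
  have c0 i : (i < j)%N -> c i = 0 by move=> ij; apply: IH; exact: leq_trans jm.
  have B0 : 0 <= B by rewrite /B; lra.
  apply/eqP; rewrite -normc_eq0 eq_le normc_ge0 andbT.
  have key x : 0 < x -> x < 1 -> N (c j) <= x * (2 * B).
    move=> x0 x1; have xj : 0 < x ^+ j by rewrite exprn_gt0.
    rewrite -(ler_pM2r xj); apply/ler_addgt0Pl => e e0.
    have [n0 Hn] := sm x e x0 x1 e0.
    have := Hn (maxn n0 j) (leq_maxl _ _).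
    rewrite (big_cat_nat (n := j))//=; last by rewrite leqW// leq_maxr.
    rewrite big1_seq ?add0r; last by move=> i; rewrite mem_index_iota => /andP[_ /c0 ->]; rewrite mul0r.
    rewrite big_ltn ?ltnS ?leq_maxr//.
    set S := \sum_(_ <= _ < _) _ => h1.
    have hS : N S <= x * (2 * B) * x ^+ j.
      apply: le_trans (normc_sum _ _ _) _.
      apply: le_trans (_ : \sum_(j.+1 <= i < (maxn n0 j).+1) (B * x ^+ j.+1) / 2 ^+ i <= _).
        rewrite big_nat_cond [leRHS]big_nat_cond; apply: ler_sum => i /andP[/andP[ji _] _].
        rewrite Normc.normcM normcX normc_real gtr0_norm// mulrAC.
        apply: ler_pM; rewrite ?normc_ge0 ?exprn_ge0 ?(ltW x0)//.
        by rewrite ler_wiXn2l ?(ltW x0) ?(ltW x1).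
      apply: le_trans (geometric_tail_le _ _ _) _.
        by rewrite mulr_ge0// exprn_ge0// ltW.
      rewrite ler_pdivrMr ?exprn_gt0// exprS.
      have -> : 2 * (B * (x * x ^+ j)) = x * (2 * B) * x ^+ j by ring.
      rewrite ler_peMr//.
        by rewrite !mulr_ge0 ?(ltW x0)// ltW.
      by rewrite -natrX ler1n expn_gt0.
    have cE : N (c j * (x%:C)%C ^+ j) = N (c j) * x ^+ j.
      by rewrite Normc.normcM normcX normc_real (gtr0_norm x0).
    have := normc_subl (c j * (x%:C)%C ^+ j) (- S); rewrite opprK normcN cE => h2.
    have h3 := le_trans h2 h1; rewrite lerBlDr in h3; apply: le_trans h3 _.
    by rewrite lerD2l.
  apply/ler_addgt0Pl => e e0; rewrite addr0.
  pose x := Num.min (1/2) (e / (2 * B + 1)).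
  have BB : 0 < 2 * B + 1 by lra.
  have x0 : 0 < x by rewrite lt_min !divr_gt0.
  have x1 : x < 1 by rewrite gt_min; apply/orP; left; lra.
  have xe : x <= e / (2 * B + 1) by rewrite ge_min lexx orbT.
  apply: le_trans (key x x0 x1) _.
  by move: xe; rewrite ler_pdivlMr//; lra.
pose a k : C := circle_coef f 2 k * k`!%:R.
have f0 k : (k`!%:R : C) != 0 by rewrite pnatr_eq0 -lt0n fact_gt0.
exists a.
  move=> rho; pose r := `|rho| + 2.
  have r2 : 2 <= r by rewrite /r lerDr.
  have [B B0 fB] := circle_bound fh r.
  exists (2 * B) => k; rewrite /a -(rr r)// Normc.normcM normc_nat mulrAC mulfK; last first.
    by rewrite pnatr_eq0 -lt0n fact_gt0.
  have r0 : 0 < r by lra.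
  apply: le_trans (circle_coef_bound fh k r0 fB).
  rewrite ler_wpM2l ?normc_ge0// lerXn2r ?nnegrE ?(ltW r0)// /r lerDl//.
move=> z e e0; pose r := N z + 2.
have r2 : 2 <= r by rewrite /r lerDr normc_ge0.
have zr : N z < r by rewrite /r ltrDl.
have zq : N z / r < 1 by rewrite ltr_pdivrMr ?mul1r//; lra.
have [B B0 fB] := circle_bound fh r.
pose K := 2 * ((B + N (f z)) * (r / (r - N z))) + 1.
have K0 : 0 < K.
  rewrite /K ltr_wpDl// mulr_ge0// mulr_ge0 ?addr_ge0 ?normc_ge0//.
  by rewrite divr_ge0//; lra.
have qn : (N z / r) ^+ n @[n --> \oo] --> (0 : R).
  apply: cvg_expr; rewrite ger0_norm// divr_ge0 ?normc_ge0//; lra.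
have eK : 0 < e / K by rewrite divr_gt0.
move/cvgrPdist_le : qn => /(_ _ eK) [n0 _ Hn].
exists n0.+1 => -[//|n]; rewrite ltnS => n0n.
have -> : psum a n.+1 z = \sum_(0 <= j < n.+1) circle_coef f r j * z ^+ j.
  by rewrite (rr r r2); apply: eq_bigr => k _; rewrite /a mulfK.
apply: le_trans (taylor_on_disc fh n zr fB) _.
have := Hn n.+1 (leqW n0n); rewrite /= sub0r normrN ger0_norm; last first.
  by rewrite exprn_ge0// divr_ge0 ?normc_ge0//; lra.
rewrite ler_pdivlMr//; set q := _ ^+ _ => hq.
have q0 : 0 <= q by rewrite exprn_ge0// divr_ge0 ?normc_ge0//; lra.
by move: hq; rewrite /K; lra.
Qed.

End PowerSeries.

(** * The differentiation operator on the space of entire functions *)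

Section DifferentiationOperator.
Context {R : realType}.
Local Notation C := R[i].
Implicit Types (a : nat -> C) (f g : C -> C).

Lemma expands_entire f a : rapid a -> expands f a -> entire f.
Proof.
move=> ra fa z; have [g ga] := exists_expands (rapid_shift ra).
exact: cderiv_derivable (expands_deriv ra fa ga z).
Qed.

Lemma expands_D f a : rapid a -> expands f a -> expands (D f) (fun k => a k.+1).
Proof.
move=> ra fa; have [g ga] := exists_expands (rapid_shift ra).
suff -> : D f = g by [].
by apply/funext => z; apply: cderiv_derive1; exact: (expands_deriv ra fa ga z).
Qed.

Lemma rapid_shiftn a n : rapid a -> rapid (fun k => a (n + k)%N).
Proof.
elim: n => [//|n IH] /IH /rapid_shift.
by under eq_fun do rewrite addnS.
Qed.

Lemma expands_iterD f a n : rapid a -> expands f a ->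
  expands (iter n D f) (fun k => a (n + k)%N).
Proof.
move=> ra fa; elim: n => [//|n IH].
have := expands_D (rapid_shiftn n ra) IH.
by under eq_fun do rewrite addnS -addSn.
Qed.

Lemma entire_iterD f a n : rapid a -> expands f a -> entire (iter n D f).
Proof.
move=> ra fa; exact: expands_entire (rapid_shiftn n ra) (expands_iterD n ra fa).
Qed.

Lemma psum0 a n : psum a n.+1 0 = a 0%N.
Proof.
rewrite /psum big_nat_recl// expr0 mulr1 fact0 divr1 big1 ?addr0// => k _.
by rewrite expr0n mulr0.
Qed.

Lemma expands_at0 f a : expands f a -> f 0 = a 0%N.
Proof.
move=> fa; apply/eqP; rewrite -subr_eq0 -normc_eq0 eq_le normc_ge0 andbT.
apply/ler_addgt0Pl => e e0; rewrite addr0.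
by have [n0 /(_ n0.+1 (leqnSn _))] := fa 0 e e0; rewrite psum0.
Qed.

Lemma iterD_at0 f a n : rapid a -> expands f a -> iter n D f 0 = a n.
Proof. by move=> ra fa; rewrite (expands_at0 (expands_iterD n ra fa)) addn0. Qed.

End DifferentiationOperator.

Section CompactOpenNeighbourhoods.
Context {R : realType}.
Local Notation C := R[i].
Local Notation H := {compact-open, C -> C}.

Lemma ccont_continuous (g : C -> C) : (forall z, ccont_at g z) -> continuous g.
Proof.
move=> cg z A /nbhs_complexP [e e0 HA]; apply/(@nbhs_complexP _ z).
have e2 : 0 < e / 2 by lra.
have [d d0 Hd] := cg z _ e2.
by exists d => // w /Hd h; apply: HA; lra.
Qed.

Lemma normc_continuous : continuous (fun z : C => N z).
Proof.
move=> z A /nbhs_ballP [e /= e0 HA]; apply/(@nbhs_complexP _ z).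
exists e => // w wz; apply: HA; rewrite -ball_normE /ball_ /=.
rewrite ltr_norml; apply/andP; split.
  by have := normc_subl w z; lra.
by have := normc_subl z w; rewrite normcB; lra.
Qed.

Lemma compact_bounded_normc (K : set C) : compact K ->
  exists B, forall z, K z -> N z <= B.
Proof.
move=> cK; have := continuous_compact (continuous_subspaceT normc_continuous) cK.
move=> /compact_bounded [M [_ HM]].
exists (M + 1) => z Kz; have M1 : M < M + 1 by rewrite ltrDl.
by have := HM _ M1 (N z); rewrite /= ger0_norm ?normc_ge0//; apply; exists z.
Qed.

(** The compact-open topology is that of uniform convergence on compact sets,
    and compact sets lie in discs. *)
Lemma open_contains_uniform_disc (U : set H) (g : C -> C) :
  (forall z, ccont_at g z) -> open U -> U g ->
  exists rho, exists2 e, 0 < e &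
    forall h : C -> C, (forall z, N z <= rho -> N (h z - g z) <= e) -> U h.
Proof.
move=> cg oU Ug.
pose F : set_system (C -> C) := [set A | exists rho, exists2 e, 0 < e &
    forall h : C -> C, (forall z, N z <= rho -> N (h z - g z) <= e) -> A h].
have FF : Filter F.
  split; first by exists 0, 1 => //; exact: ltr01.
    move=> A B [r1 [e1 e10 H1]] [r2 [e2 e20 H2]].
    exists (Num.max r1 r2), (Num.min e1 e2); first by rewrite lt_min e10.
    move=> h hg; split.
      by apply: H1 => z zr; have := hg z; rewrite le_max zr le_min => /(_ isT)/andP[].
    by apply: H2 => z zr; have := hg z; rewrite le_max zr orbT le_min => /(_ isT)/andP[].
  by move=> A B AB [r [e e0 K]]; exists r, e => // h /K /AB.
have : {compact-open, F --> g}.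
  apply/(compact_open_fam_compactP (ccont_continuous cg)).
  apply/fam_cvgP => K cK A /uniform_nbhs [E [entE EA]].
  have [B KB] := compact_bounded_normc cK.
  move: entE; rewrite -entourage_ballE => -[e /= e0 eE].
  have e0' : 0 < Re e by move: e0; rewrite ltcE /= => /andP[].
  have eE' : e = ((Re e)%:C)%C.
    by move: e0; case: (e) => a b; rewrite ltcE /= => /andP[/eqP -> _].
  exists B, (Re e / 2); first lra.
  move=> h hg; apply: EA => /= y Ky; apply: eE => /=.
  rewrite -ball_normE /ball_ /= eE' normcE_norm ltcR normcB.
  by have := hg y (KB _ Ky); lra.
by move=> /(_ U); apply; apply: open_nbhs_nbhs; split.
Qed.

Lemma open_eval0 (O : set C) : open O -> open ([set h : C -> C | O (h 0)] : set H).
Proof.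
move=> oO.
have -> : [set h : C -> C | O (h 0)] = [set h | [set h x | x in [set (0 : C)]] `<=` O].
  apply/seteqP; split => h /= hO; first by move=> _ [_ -> <-].
  by apply: hO; exists 0.
by apply: compact_open_open => //; exact: compact_set1.
Qed.

Lemma open_normc_gt (B : R) : open [set w : C | B < N w].
Proof.
have -> : [set w : C | B < N w] = (fun w : C => N w) @^-1` [set x | B < x] by [].
by apply: open_comp; [move=> z _; exact: normc_continuous|exact: open_gt].
Qed.

End CompactOpenNeighbourhoods.

(** * Poisson weights *)

Section PoissonWeights.
Context {R : realType}.
Implicit Types (r : R) (k n m : nat).

Definition pw r k : R := r ^+ k / k`!%:R.

Lemma pw_ge0 r k : 0 <= r -> 0 <= pw r k.
Proof. by move=> r0; rewrite divr_ge0 ?exprn_ge0. Qed.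

Lemma pwS r k : k.+1%:R * pw r k.+1 = r * pw r k.
Proof.
rewrite /pw exprS factS natrM; field.
by rewrite [1 + _]addrC natr1 !pnatr_eq0 -lt0n fact_gt0.
Qed.

Lemma sum_pw_cvg r : \sum_(0 <= k < n) pw r k @[n --> \oo] --> expR r.
Proof. exact: is_cvg_series_exp_coeff. Qed.

Lemma sum_pw_le r n : 0 <= r -> \sum_(0 <= k < n) pw r k <= expR r.
Proof.
move=> r0; have c := @sum_pw_cvg r; rewrite -(cvg_lim (@Rhausdorff R) c).
apply: (nondecreasing_cvgn_le (u_ := fun n => \sum_(0 <= k < n) pw r k)).
  by apply: nondecreasing_series => k _ _; exact: pw_ge0.
by apply/cvg_ex; exists (expR r).
Qed.

(** Exact for truncated sums, the last term being the defect. *)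
Lemma poisson_variance_eq r n :
  \sum_(0 <= k < n) pw r k * (k%:R - r) ^+ 2 =
  r * \sum_(0 <= k < n) pw r k - n%:R * (n%:R - r) * pw r n.
Proof.
elim: n => [|n IH]; first by rewrite !big_geq// mulr0 !mul0r subrr.
rewrite !big_nat_recr//= IH.
have -> : n.+1%:R * (n.+1%:R - r) * pw r n.+1 = (n.+1%:R - r) * (r * pw r n).
  by rewrite -pwS; ring.
by rewrite -natr1; ring.
Qed.

(** The defect in [poisson_variance_eq] is nonnegative once [n] exceeds [r], and
    enlarging [n] only enlarges the sum. *)
Lemma poisson_variance r n : 0 <= r ->
  \sum_(0 <= k < n) pw r k * (k%:R - r) ^+ 2 <= r * expR r.
Proof.
move=> r0; pose m := maxn n (Num.trunc r).+1.
have mr : r <= m%:R.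
  by apply: le_trans (ltW (truncnS_gt r)) _; rewrite ler_nat leq_maxr.
apply: le_trans (_ : \sum_(0 <= k < m) pw r k * (k%:R - r) ^+ 2 <= _).
  rewrite [leRHS](big_cat_nat (n := n)) ?leq_maxl//= lerDl.
  by apply: sumr_ge0 => k _; rewrite mulr_ge0 ?pw_ge0 ?sqr_ge0.
rewrite poisson_variance_eq; apply: le_trans (_ : r * \sum_(0 <= k < m) pw r k <= _).
  by rewrite gerBl mulr_ge0 ?pw_ge0// mulr_ge0// subr_ge0.
by apply: ler_wpM2l => //; exact: sum_pw_le.
Qed.

(** Cauchy-Schwarz, in the form [2 * sqrt r * x <= r + x ^ 2]. *)
Lemma poisson_deviation r n : 0 < r ->
  \sum_(0 <= k < n) pw r k * `|k%:R - r| <= Num.sqrt r * expR r.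
Proof.
move=> r0; have s0 : 0 < Num.sqrt r by rewrite sqrtr_gt0.
have rE : r = Num.sqrt r ^+ 2 by rewrite sqr_sqrtr// ltW.
set s := Num.sqrt r in s0 rE *.
apply: le_trans (_ : \sum_(0 <= k < n) ((2 * s)^-1 * (pw r k * (k%:R - r) ^+ 2) + s / 2 * pw r k) <= _).
  apply: ler_sum => k _; have p0 := pw_ge0 k (ltW r0).
  have -> : (2 * s)^-1 * (pw r k * (k%:R - r) ^+ 2) + s / 2 * pw r k =
    pw r k * ((k%:R - r) ^+ 2 / (2 * s) + s / 2) by field; rewrite gt_eqF.
  apply: ler_wpM2l => //; rewrite -[(_ - _) ^+ 2]real_normK ?num_real//.
  set x := `|_|.
  have -> : x ^+ 2 / (2 * s) + s / 2 = x + (x - s) ^+ 2 / (2 * s).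
    by field; rewrite gt_eqF.
  by rewrite lerDl divr_ge0 ?sqr_ge0// mulr_ge0// ltW.
rewrite big_split/= -!mulr_sumr.
have h1 := poisson_variance n (ltW r0); have h2 := sum_pw_le n (ltW r0).
apply: le_trans (_ : (2 * s)^-1 * (r * expR r) + s / 2 * expR r <= _).
  by apply: lerD; apply: ler_wpM2l => //; rewrite ?invr_ge0 ?mulr_ge0 ?divr_ge0// ltW.
rewrite le_eqVlt; apply/orP; left; apply/eqP.
by rewrite {1}rE; field; rewrite gt_eqF.
Qed.

Lemma pw_step r k : 0 < r -> pw r k.+1 - pw r k = pw r k.+1 * (r - k.+1%:R) / r.
Proof.
move=> r0; have := pwS r k => E.
have -> : pw r k = k.+1%:R * pw r k.+1 / r by rewrite E mulrC mulKf// gt_eqF.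
by field; rewrite gt_eqF.
Qed.

(** The increments [pw_step] telescope, so the value at [k] is a partial sum of [pw r j
    * (r - j) / r], which [poisson_deviation] bounds. *)
Lemma pw_max r k : 0 < r -> pw r k <= expR r / Num.sqrt r.
Proof.
move=> r0; have E : pw r k = (\sum_(0 <= j < k.+1) pw r j * (r - j%:R)) / r.
  elim: k => [|k IH].
    by rewrite big_nat1 subr0 mulfK// gt_eqF.
  rewrite big_nat_recr//= mulrDl -IH; have := pw_step k r0; lra.
rewrite E ler_pdivrMr//.
have -> : expR r / Num.sqrt r * r = Num.sqrt r * expR r.
  have s0 : 0 < Num.sqrt r by rewrite sqrtr_gt0.
  have rE : r = Num.sqrt r ^+ 2 by rewrite sqr_sqrtr// ltW.
  by rewrite [X in _ * X]rE; field; rewrite gt_eqF.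
apply: le_trans (poisson_deviation k.+1 r0); apply: ler_sum => j _.
apply: ler_wpM2l; first by rewrite pw_ge0// ltW.
by rewrite distrC ler_norm.
Qed.

Lemma poisson_chebyshev r (d : R) n (P : pred nat) : 0 <= r -> 0 < d ->
  (forall k, P k -> d <= `|k%:R - r|) ->
  \sum_(0 <= k < n | P k) pw r k <= r * expR r / d ^+ 2.
Proof.
move=> r0 d0 Pd; rewrite ler_pdivlMr ?exprn_gt0// mulr_suml.
apply: le_trans (poisson_variance n r0).
rewrite [leRHS](bigID P)/=; apply: le_trans (_ : \sum_(0 <= k < n | P k) pw r k * (k%:R - r) ^+ 2 <= _).
  apply: ler_sum => k /Pd h; apply: ler_wpM2l; first exact: pw_ge0.
  by rewrite -[leRHS]real_normK ?num_real// lerXn2r ?nnegrE ?(ltW d0).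
by rewrite lerDl sumr_ge0// => k _; rewrite mulr_ge0 ?pw_ge0 ?sqr_ge0.
Qed.

Lemma pw_mode m k : (0 < m)%N -> pw m%:R k <= pw (m%:R : R) m.
Proof.
move=> m0; have m0' : 0 < m%:R :> R by rewrite ltr0n.
have step j : pw (m%:R : R) j.+1 = pw m%:R j * (m%:R / j.+1%:R).
  have j0 : j.+1%:R != 0 :> R by rewrite pnatr_eq0.
  by apply: (mulfI j0); rewrite pwS [RHS]mulrCA [j.+1%:R * (_ / _)]mulrCA divff// mulr1 mulrC.
have [mk|/ltnW km] := leqP m k.
  rewrite -(subnKC mk); elim: (k - m)%N => [|j IH]; first by rewrite addn0.
  apply: le_trans IH; rewrite addnS step ler_piMr ?pw_ge0 ?(ltW m0')//.
  by rewrite ler_pdivrMr ?ltr0Sn// mul1r ler_nat leqW// leq_addr.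
have up j : (j <= m - k)%N -> pw (m%:R : R) k <= pw m%:R (k + j)%N.
  elim: j => [|j IH] jm; first by rewrite addn0.
  apply: le_trans (IH (ltnW jm)) _; rewrite addnS step ler_peMr ?pw_ge0 ?(ltW m0')//.
  rewrite ler_pdivlMr ?ltr0Sn// mul1r ler_nat; lia.
by have := up _ (leqnn _); rewrite subnKC.
Qed.

Lemma sum_le_size (s : seq nat) (F : nat -> R) (c : R) : (forall k, F k <= c) ->
  \sum_(k <- s) F k <= (size s)%:R * c.
Proof.
move=> Fc; elim: s => [|k s IH]; first by rewrite big_nil mul0r.
by rewrite big_cons /= -natr1 mulrDl mul1r addrC lerD.
Qed.

(** By Chebyshev's inequality at least half of the mass lies within [2 * sqrt m] of [m],
    hence on at most [7 * sqrt m] indices, and no weight exceeds the one at [m]. *)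
Lemma pw_center_ge m : (0 < m)%N ->
  expR m%:R / (14 * Num.sqrt m%:R) <= pw (m%:R : R) m.
Proof.
move=> m0; have m0' : 0 < m%:R :> R by rewrite ltr0n.
have s0 : 0 < Num.sqrt m%:R :> R by rewrite sqrtr_gt0.
have s1 : 1 <= Num.sqrt m%:R :> R.
  by rewrite -[leLHS]sqrtr1 ler_wsqrtr// ler1n.
have mE : m%:R = Num.sqrt m%:R ^+ 2 :> R by rewrite sqr_sqrtr// ltW.
set s := Num.sqrt m%:R in s0 s1 mE *.
pose t := (Num.trunc (2 * s)).+1.
have t1 : 2 * s < t%:R by exact: truncnS_gt.
have t2 : t%:R <= 2 * s + 1.
  by rewrite /t -natr1 lerD2r truncn_le// mulr_ge0// ltW.
have E0 := expR_gt0 (m%:R : R).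
have e4 : 0 < expR m%:R / 4 :> R by rewrite divr_gt0.
move/cvgrPdist_le: (@sum_pw_cvg (m%:R : R)) => /(_ _ e4) [n _ /(_ n (leqnn n))] /= Hn.
have {Hn} : 3 / 4 * expR m%:R <= \sum_(0 <= k < n) pw (m%:R : R) k.
  by move: Hn; rewrite ler_norml => /andP[]; lra.
(* the indices at distance at most [t], just above [2 * sqrt m], from [m] *)
pose P k := (m <= k + t)%N && (k <= m + t)%N.
rewrite (bigID P)/=.
have far : \sum_(0 <= k < n | ~~ P k) pw (m%:R : R) k <= expR m%:R / 4.
  have d0 : 0 < 2 * s by rewrite mulr_gt0.
  apply: le_trans (poisson_chebyshev n (ltW m0') d0 (P := fun k => ~~ P k) _) _.
    move=> k; rewrite /P negb_and -!ltnNge => /orP[kt|kt].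
      rewrite ler0_norm; last by rewrite subr_le0 ler_nat; lia.
      have : (k + t)%:R <= m%:R :> R by rewrite ler_nat ltnW.
      by rewrite natrD; lra.
    rewrite ger0_norm; last by rewrite subr_ge0 ler_nat; lia.
    have : (m + t)%:R <= k%:R :> R by rewrite ler_nat ltnW.
    by rewrite natrD; lra.
  rewrite le_eqVlt; apply/orP; left; apply/eqP.
  by rewrite [X in X * _ / _]mE; field; rewrite gt_eqF.
have near : \sum_(0 <= k < n | P k) pw (m%:R : R) k <= 7 * s * pw m%:R m.
  rewrite -big_filter; apply: le_trans (sum_le_size _ (fun k => pw_mode k m0)) _.
  apply: ler_wpM2r; first by rewrite pw_ge0// ltW.
  have sz : (size [seq k <- index_iota 0 n | P k] <= (t + t).+1)%N.
    rewrite -[leqRHS](size_iota (m - t)); apply: uniq_leq_size.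
      by rewrite filter_uniq// iota_uniq.
    by move=> k; rewrite mem_filter mem_iota => /andP[/andP[k1 k2] _]; lia.
  have : (size [seq k <- index_iota 0 n | P k])%:R <= (t + t).+1%:R :> R by rewrite ler_nat.
  rewrite -[(t + t).+1%:R]natr1 natrD; move: t2; set T := t%:R; set Z := (size _)%:R.
  by clearbody T Z; clear -s1; lra.
set F := \sum_(_ <= _ < _ | ~~ _) _ in far *.
set G := \sum_(_ <= _ < _ | _) _ in near *.
move=> h; rewrite ler_pdivrMr ?mulr_gt0//.
by move: h far near; lra.
Qed.

(** Going down from [m], the weight is multiplied by [1 - j / m] at the [j]-th step; the
    product is at least [1 - j ^ 2 / m >= 3/4]. *)
Lemma pw_window_ge m k : (0 < m)%N -> (k <= m)%N ->
  (m - k)%:R <= Num.sqrt m%:R / 2 :> R ->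
  expR m%:R / (20 * Num.sqrt m%:R) <= pw (m%:R : R) k.
Proof.
move=> m0 km mk; have m0' : 0 < m%:R :> R by rewrite ltr0n.
have s0 : 0 < Num.sqrt m%:R :> R by rewrite sqrtr_gt0.
have mE : m%:R = Num.sqrt m%:R ^+ 2 :> R by rewrite sqr_sqrtr// ltW.
have step j : (j <= m)%N -> pw (m%:R : R) m * (1 - j%:R ^+ 2 / m%:R) <= pw m%:R (m - j).
  elim: j => [|j IH] jm; first by rewrite expr0n mul0r subr0 mulr1 subn0.
  have {}IH := IH (ltnW jm).
  have -> : pw (m%:R : R) (m - j.+1) = pw m%:R (m - j) * (1 - j%:R / m%:R).
    have E := pwS m%:R (m - j.+1); rewrite (_ : (m - j.+1).+1 = m - j)%N in E; last by lia.
    have m0'' : m%:R != 0 :> R by rewrite gt_eqF.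
    apply: (mulfI m0''); rewrite -E natrB ?(ltnW jm)// [RHS]mulrCA [m%:R * (1 - _)]mulrBr mulr1.
    by rewrite [m%:R * (_ / _)]mulrCA divff// mulr1 mulrC.
  have jm1 : j%:R / m%:R <= 1 :> R by rewrite ler_pdivrMr// mul1r ler_nat ltnW.
  apply: le_trans (_ : pw m%:R m * (1 - j%:R ^+ 2 / m%:R) * (1 - j%:R / m%:R) <= _); last first.
    by apply: ler_wpM2r => //; rewrite subr_ge0.
  rewrite -mulrA; apply: ler_wpM2l; first by rewrite pw_ge0// ltW.
  rewrite -natr1 -subr_ge0.
  have -> : (1 - j%:R ^+ 2 / m%:R) * (1 - j%:R / m%:R) - (1 - (j%:R + 1) ^+ 2 / m%:R) =
     (j%:R * (j%:R / m%:R) ^+ 2 + (j%:R + 1) / m%:R) :> R by field; rewrite gt_eqF.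
  by rewrite addr_ge0 ?mulr_ge0 ?sqr_ge0 ?divr_ge0 ?addr_ge0 ?(ltW m0').
have := step _ (leq_subr k m); rewrite subKn//.
have h : (m - k)%:R ^+ 2 / m%:R <= 1 / 4 :> R.
  rewrite ler_pdivrMr// [X in _ <= _ * X]mE.
  have -> : 1 / 4 * Num.sqrt m%:R ^+ 2 = (Num.sqrt m%:R / 2) ^+ 2 :> R by field.
  by rewrite lerXn2r ?nnegrE// divr_ge0// ltW.
apply: le_trans; have c := pw_center_ge m0.
apply: le_trans (_ : expR m%:R / (14 * Num.sqrt m%:R) * (3 / 4) <= _); last first.
  by apply: ler_pM => //; rewrite ?divr_ge0 ?expR_ge0 ?mulr_ge0 ?(ltW s0)//; lra.
set s := Num.sqrt m%:R in s0 *; set E := expR _.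
have Q : 0 < E / s by rewrite divr_gt0 ?expR_gt0.
have -> : E / (20 * s) = E / s * (1 / 20) by field; rewrite gt_eqF.
have -> : E / (14 * s) * (3 / 4) = E / s * (3 / 56) by field; rewrite gt_eqF.
by rewrite ler_pM2l//; lra.
Qed.

End PoissonWeights.

(** * Upper densities *)

Section UpperDensity.
Context {R : realType}.
Implicit Types (beta : nat -> R) (E : set nat) (n k : nat).

Definition mass beta n : R := \sum_(1 <= k < n.+1) beta k.
Definition mass_in beta E n : R := \sum_(1 <= k < n.+1) beta k * \1_E k.

Lemma massS beta n : mass beta n.+1 = mass beta n + beta n.+1.
Proof. by rewrite /mass big_nat_recr. Qed.

Lemma mass_inS beta E n : mass_in beta E n.+1 = mass_in beta E n + beta n.+1 * \1_E n.+1.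
Proof. by rewrite /mass_in big_nat_recr. Qed.

Lemma upper_density_le beta E (eta : R) n0 :
  (forall n, (n0 <= n)%N -> mass_in beta E n / mass beta n <= eta) ->
  (upper_density beta E <= eta%:E)%E.
Proof.
move=> H; apply: ereal_inf_le; exists (ereal_sup
   [set (mass_in beta E n / mass beta n)%:E | n in [set n | (n0 <= n)%N]]).
  exists [set n | (n0 <= n)%N] => //.
  by exists n0.
by apply: ge_ereal_sup => _ [n nn <-]; rewrite lee_fin; exact: H.
Qed.

Lemma upper_density_ge beta E (delta : R) :
  (forall n0, exists2 n, (n0 <= n)%N & delta <= mass_in beta E n / mass beta n) ->
  (delta%:E <= upper_density beta E)%E.
Proof.
move=> H; apply: le_ereal_inf_tmp => _ [V [n0 _ HV] <-].
have [n nn h] := H n0; apply: ereal_sup_ge.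
by exists (mass_in beta E n / mass beta n)%:E; [exists n => //; exact: HV|rewrite lee_fin].
Qed.

Variable beta : nat -> R.
Hypothesis beta_ge1 : forall k, 1 <= beta k.

Lemma mass_ge n : n%:R <= mass beta n.
Proof.
elim: n => [|n IH]; first by rewrite /mass big_geq.
by rewrite massS -natr1 lerD.
Qed.

Lemma mass_in_le E n : mass_in beta E n <= mass beta n.
Proof.
by apply: ler_sum => k _; rewrite ler_piMr ?(le_trans ler01).
Qed.

Lemma mass_in_ge0 E n : 0 <= mass_in beta E n.
Proof.
by apply: sumr_ge0 => k _; rewrite mulr_ge0//; exact: le_trans (beta_ge1 k).
Qed.

Lemma mass_homo n m : (n <= m)%N -> mass beta n <= mass beta m.
Proof.
move=> nm; rewrite /mass [leRHS](big_cat_nat (n := n.+1))//= lerDl.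
by apply: sumr_ge0 => k _; exact: le_trans (beta_ge1 _).
Qed.

Lemma upper_density_affine E (A eta : R) : 0 <= A -> 0 < eta ->
  (forall n, mass_in beta E n <= A + eta * mass beta n) ->
  (upper_density beta E <= (2 * eta)%:E)%E.
Proof.
move=> A0 eta0 H; pose n0 := (Num.trunc (A / eta)).+1.
apply: (@upper_density_le _ _ _ n0) => n nn.
have nA : A / eta <= mass beta n.
  apply: le_trans (mass_ge n); apply: le_trans (ltW (truncnS_gt _)) _.
  by rewrite ler_nat.
have m0 : 0 < mass beta n.
  by apply: lt_le_trans (mass_ge n); rewrite ltr0n; apply: leq_trans nn.
rewrite ler_pdivrMr//; apply: le_trans (H n) _.
by move: nA; rewrite ler_pdivrMr//; lra.
Qed.

(** The total mass is infinite, so a finite set has density 0. *)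
Lemma upper_density_infinite E : (0 < upper_density beta E)%E ->
  forall n0, exists2 n, (n0 <= n)%N & E n.
Proof.
move=> E0 n0; apply: contrapT => H.
have HE n : (n0 <= n)%N -> ~ E n by move=> nn En; apply: H; exists n.
have H2 n : mass_in beta E n <= mass beta n0.
  have [nn|/ltnW nn] := leqP n n0.
    by apply: le_trans (mass_in_le _ _) (mass_homo nn).
  rewrite /mass_in (big_cat_nat (n := n0.+1))//= [X in _ + X]big1_seq.
    by rewrite addr0; exact: mass_in_le.
  move=> k; rewrite mem_index_iota => /andP[_ /andP[k1 _]]; rewrite indicE.
  by rewrite memNset ?mulr0//; apply: HE; exact: ltnW.
have le0 : (upper_density beta E <= 0)%E.
  apply/lee_addgt0Pr => e e0; rewrite add0e.
  have -> : e = 2 * (e / 2) by field.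
  apply: (@upper_density_affine _ (mass beta n0)); last first.
  - move=> n; apply: le_trans (H2 n) _; rewrite lerDl mulr_ge0//; first lra.
    exact: le_trans (mass_ge n).
  - lra.
  - exact: le_trans (mass_ge n0).
by move: (lt_le_trans E0 le0); rewrite ltxx.
Qed.

(** Cover [1, n] by windows [m - h m + 1, m], going down from [n]: on each of them the
    weights are comparable, so that counting amounts to weighing. *)
Lemma upper_density_windows E (h : nat -> nat) (C eta : R) m0 :
  (forall m, (m0 <= m)%N -> (0 < h m <= m)%N) ->
  (forall m k, (m0 <= m)%N -> (m - h m < k <= m)%N -> beta k <= beta m /\ beta m <= C * beta k) ->
  0 < C -> 0 < eta ->
  (forall m, (m0 <= m)%N -> \sum_((m - h m).+1 <= k < m.+1) \1_E k <= eta * (h m)%:R :> R) ->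
  (upper_density beta E <= (2 * (C * eta))%:E)%E.
Proof.
move=> h1 h2 C0 eta0 h3; apply: (@upper_density_affine _ (mass beta m0)).
  exact: le_trans (mass_ge m0).
  by rewrite mulr_gt0.
move=> n; have [m] := ubnP n; elim: m => // m IH in n *; rewrite ltnS => nm.
have [nm0|m0n] := ltnP n m0.
  apply: le_trans (mass_in_le _ _) _; apply: le_trans (mass_homo (ltnW nm0)) _.
  rewrite lerDl mulr_ge0//; first by rewrite mulr_ge0 ?(ltW C0) ?(ltW eta0).
  exact: le_trans (mass_ge n).
have /andP[hn0 hnn] := h1 n m0n.
have n1 : (n - h n < n)%N by lia.
have {}IH := IH _ (leq_trans n1 nm).
rewrite /mass_in /mass !(@big_cat_nat _ _ _ (n - h n).+1 1 n.+1)//=; [|lia..].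
rewrite -/(mass_in beta E _) -/(mass beta (n - h n)) mulrDr addrA; apply: lerD => //.
apply: le_trans (_ : beta n * \sum_((n - h n).+1 <= k < n.+1) \1_E k <= _).
  rewrite mulr_sumr big_nat_cond [leRHS]big_nat_cond; apply: ler_sum => k /andP[/andP[k1 k2] _].
  apply: ler_wpM2r; first by rewrite indicE.
  by have [] := h2 n k m0n; rewrite ?k1.
apply: le_trans (_ : beta n * (eta * (h n)%:R) <= _).
  by apply: ler_wpM2l; [exact: le_trans (beta_ge1 _)|exact: h3].
have -> : (h n)%:R = \sum_((n - h n).+1 <= k < n.+1) 1 :> R.
  by rewrite sumr_const_nat; congr _%:R; lia.
rewrite !mulr_sumr big_nat_cond [leRHS]big_nat_cond; apply: ler_sum => k /andP[/andP[k1 k2] _].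
have [] := h2 n k m0n; first by rewrite k1.
move=> _ le_k; rewrite mulr1 mulrC.
have -> : C * eta * beta k = eta * (C * beta k) by ring.
by apply: ler_wpM2l => //; exact: ltW.
Qed.

End UpperDensity.

Section PowersOfPositives.
Context {R : realType}.

Lemma powRDp (x a b : R) : 0 < x -> x `^ (a + b) = x `^ a * x `^ b.
Proof. by move=> x0; rewrite powRD// (gt_eqF x0) implybT. Qed.

Lemma powR_mulB1 (x a : R) : 0 < x -> x `^ a = x * x `^ (a - 1).
Proof. by move=> x0; rewrite -[X in X * _]powRr1 ?(ltW x0)// -powRDp// subrKC. Qed.

End PowersOfPositives.

Section StretchedExponentialWeights.
Context {R : realType}.
Variable g : R.
Hypothesis g01 : 0 <= g <= 1.
Let g0 : 0 <= g. Proof. by case/andP: g01. Qed.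
Let g1 : g <= 1. Proof. by case/andP: g01. Qed.

Lemma beta_gamma_ge1 k : 1 <= beta_gamma g k.
Proof. by rewrite /beta_gamma -expR0 ler_expR powR_ge0. Qed.

Lemma beta_gamma_homo k m : (k <= m)%N -> beta_gamma g k <= beta_gamma g m.
Proof.
by move=> km; rewrite ler_expR; apply: ge0_ler_powR => //; rewrite ?nnegrE// ler_nat.
Qed.

(** [m^g - k^g <= (m - k) k^(g-1)], as [m^(g-1) <= k^(g-1)]. *)
Lemma beta_gamma_comparable m k (W : R) : (0 < k)%N -> (k <= m)%N -> (m <= 2 * k)%N ->
  (m - k)%:R <= W * m%:R `^ (1 - g) -> 0 <= W ->
  beta_gamma g m <= expR (2 * W) * beta_gamma g k.
Proof.
move=> k0 km m2k mk W0; rewrite /beta_gamma -expRD ler_expR -lerBlDr.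
have k0' : 0 < k%:R :> R by rewrite ltr0n.
have m0' : 0 < m%:R :> R by rewrite ltr0n (leq_trans k0).
rewrite (powR_mulB1 g m0') (powR_mulB1 g k0').
have h1 : m%:R `^ (g - 1) <= k%:R `^ (g - 1).
  rewrite -[g - 1]opprB !powRN lef_pV2 ?posrE ?powR_gt0//.
  by apply: ge0_ler_powR; rewrite ?nnegrE ?subr_ge0// ler_nat.
apply: le_trans (_ : (m%:R - k%:R) * k%:R `^ (g - 1) <= _).
  by rewrite mulrBl lerD2r ler_wpM2l.
have h2 : k%:R `^ (g - 1) <= 2 * m%:R `^ (g - 1).
  have h3 : m%:R / 2 <= k%:R :> R.
    by rewrite ler_pdivrMr// mulrC -natrM ler_nat.
  apply: le_trans (_ : (m%:R / 2) `^ (g - 1) <= _).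
    rewrite -[g - 1]opprB !powRN lef_pV2 ?posrE ?powR_gt0 ?divr_gt0//.
    by apply: ge0_ler_powR; rewrite ?nnegrE ?subr_ge0 ?divr_ge0.
  rewrite powRM ?invr_ge0 ?(ltW m0')// mulrC ler_wpM2r ?powR_ge0//.
  rewrite -[2^-1]powR_inv1// -powRrM mulN1r opprB -[leRHS]powRr1//.
  by apply: ler_powR; rewrite ?ler1n// gerBl.
rewrite natrB// in mk.
apply: le_trans (_ : W * m%:R `^ (1 - g) * (2 * m%:R `^ (g - 1)) <= _).
  apply: ler_pM => //; rewrite ?powR_ge0// subr_ge0 ler_nat//.
have -> : W * m%:R `^ (1 - g) * (2 * m%:R `^ (g - 1)) =
   2 * W * (m%:R `^ (1 - g) * m%:R `^ (g - 1)) by ring.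
by rewrite -powRDp// (_ : 1 - g + (g - 1) = 0) ?powRr0 ?mulr1//; ring.
Qed.

(** Bernoulli's inequality [k^g <= n^g - g n^(g-1) (n - k)] turns the sum into a
    geometric one. *)
Lemma mass_beta_gamma_le : exists2 K : R, 0 < K & forall n, (0 < n)%N ->
  mass (beta_gamma g) n <= K * n%:R `^ (1 - g) * beta_gamma g n.
Proof.
have [gz|gnz] := eqVneq g 0.
  exists 1; first exact: ltr01.
  move=> n n0; have -> : n%:R `^ (1 - g) = n%:R :> R by rewrite gz subr0 powRr1.
  apply: le_trans (_ : \sum_(1 <= k < n.+1) beta_gamma g n <= _).
    by apply: ler_sum_nat => k /andP[_ kn]; exact: beta_gamma_homo.
  by rewrite sumr_const_nat subn1 mul1r mulr_natl.
have gp : 0 < g by rewrite lt_def gnz.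
exists (1 + g^-1); first by rewrite addr_gt0// invr_gt0.
move=> n n0; have n0' : 0 < n%:R :> R by rewrite ltr0n.
pose x := g * n%:R `^ (g - 1).
have x0 : 0 < x by rewrite mulr_gt0// powR_gt0.
have n1 : 1 <= n%:R `^ (1 - g).
  have := @ler_powR _ n%:R _ 0 (1 - g); rewrite powRr0; apply; rewrite ?ler1n// subr_ge0//.
(* Bernoulli's inequality, a case of Young's *)
have bern k : (k <= n)%N -> (0 < k)%N -> k%:R `^ g <= n%:R `^ g - x * (n - k)%:R.
  move=> kn k0; have k0' : 0 < k%:R :> R by rewrite ltr0n.
  pose y := k%:R / n%:R : R.
  have y0 : 0 < y by rewrite divr_gt0.
  have kE : k%:R = n%:R * y :> R by rewrite /y mulrC divfK// gt_eqF.
  have yg : y `^ g <= 1 + g * (y - 1).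
    have [g1'|gn1] := eqVneq g 1; first by rewrite g1' powRr1 ?(ltW y0)// mul1r addrC subrK.
    have gl1 : g < 1 by rewrite lt_neqAle gn1.
    have := @conjugate_powR R (y `^ g) 1 g^-1 (1 - g)^-1 (powR_ge0 _ _) ler01.
    rewrite !invr_gt0 subr_gt0 gp gl1 !invrK => /(_ isT isT (subrKC _ _)).
    rewrite mulr1 -powRrM mulfV// powRr1 ?(ltW y0)// powR1 mul1r; lra.
  rewrite kE powRM ?(ltW y0) ?(ltW n0')//.
  apply: le_trans (ler_wpM2l (powR_ge0 _ _) yg) _.
  rewrite mulrDr mulr1 lerD2l natrB// kE.
  rewrite (powR_mulB1 g n0').
  by rewrite /x le_eqVlt; apply/orP; left; apply/eqP; ring.
have q1 : expR (- x) < 1 by rewrite -expR0 ltr_expR oppr_lt0.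
have geo : mass (beta_gamma g) n <= beta_gamma g n * (1 - expR (- x))^-1.
  apply: le_trans (_ : \sum_(1 <= k < n.+1) beta_gamma g n * expR (- x) ^+ (n - k) <= _).
    rewrite /mass; apply: ler_sum_nat => k /andP[k0 kn].
    rewrite -(expRM_natl (n - k) (- x)) /beta_gamma -expRD ler_expR.
    by have := bern k kn k0; lra.
  rewrite -mulr_sumr ler_wpM2l ?expR_ge0//.
  rewrite big_nat_rev/= big_add1/=.
  apply: le_trans (_ : \sum_(0 <= i < n) expR (- x) ^+ i <= _).
    by rewrite big_nat_cond [leRHS]big_nat_cond; apply: ler_sum => k /andP[/andP[_ kn] _];
       rewrite (_ : n - _ = k)%N//; lia.
  have e1 : 0 < 1 - expR (- x) by rewrite subr_gt0.
  rewrite -[leRHS]mul1r ler_pdivlMr//.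
  suff -> : (\sum_(0 <= i < n) expR (- x) ^+ i) * (1 - expR (- x)) = 1 - expR (- x) ^+ n.
    by rewrite gerBl exprn_ge0// expR_ge0.
  elim: (n) => [|m IH]; first by rewrite big_geq// mul0r expr0 subrr.
  by rewrite big_nat_recr//= mulrDl IH exprS; ring.
apply: le_trans geo _; rewrite mulrC ler_wpM2r ?expR_ge0//.
have xi : (1 - expR (- x))^-1 <= 1 + x^-1.
  rewrite -[leLHS]mul1r ler_pdivrMr ?subr_gt0//.
  have ex : expR (- x) <= (1 + x)^-1.
    by rewrite expRN lef_pV2 ?posrE ?expR_gt0 ?expR_ge1Dx//; lra.
  apply: le_trans (_ : (1 + x^-1) * (1 - (1 + x)^-1) <= _).
    by rewrite le_eqVlt; apply/orP; left; apply/eqP; field; rewrite !gt_eqF//; lra.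
  by apply: ler_wpM2l; rewrite ?lerB// addr_ge0// invr_ge0 ltW.
apply: le_trans xi _; rewrite mulrDl mul1r; apply: lerD => //.
by rewrite /x invfM -powRN opprB.
Qed.

End StretchedExponentialWeights.

(** * Integral means and their lower bounds by duality *)

Section PowerMeans.
Context {R : realType}.
Local Notation C := R[i].

Lemma continuous_powR_comp (h : R -> R) (s : R) : 0 < s -> continuous h ->
  (forall t, 0 <= h t) -> continuous (fun t => h t `^ s).
Proof.
move=> s0 ch h0 t; have [ht0|ht0] := eqVneq (h t) 0; last first.
  have hp : 0 < h t by rewrite lt_def ht0 h0.
  apply: (@continuous_comp _ _ _ h (fun x => x `^ s)); first exact: ch.
  have [/derivable1_diffP/differentiable_continuous] := is_derive1_powR s hp.
  by [].
apply/cvgrPdist_le => e e0; rewrite ht0 powR0 ?gt_eqF//.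
have e1 : 0 < e `^ s^-1 by rewrite powR_gt0.
have /cvgrPdist_le/(_ _ e1) := ch t; rewrite ht0 => H.
near=> x; rewrite sub0r normrN ger0_norm ?powR_ge0//.
have : `|0 - h x| <= e `^ s^-1 by near: x; exact: H.
rewrite sub0r normrN ger0_norm// => hx.
rewrite -[leRHS]powRr1 ?(ltW e0)// -(mulVf (lt0r_neq0 s0)) powRrM.
by apply: ge0_ler_powR; rewrite ?nnegrE ?powR_ge0 ?(ltW s0).
Unshelve. all: by end_near.
Qed.

Lemma avg_ge0 (h : R -> R) : continuous h -> (forall t, 0 <= h t) -> 0 <= avg h.
Proof. by move=> ch h0; rewrite -[leLHS]avg_cst; apply: ler_avg => //; exact: cst_continuous. Qed.

Variable f : C -> C.
Hypothesis f_cont : forall z, ccont_at f z.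

Lemma continuous_circle (r : R) : continuous (fun t => N (f ((r%:C)%C * cis t))).
Proof. by apply: ccurve_normc; apply: ccurve_comp => //; exact: ccurve_polar. Qed.

Lemma M_avg (s r : R) : 0 < s ->
  M s%:E f r = ((avg (fun t => N (f ((r%:C)%C * cis t)) `^ s)) `^ s^-1)%:E.
Proof.
move=> s0; have cc : continuous (fun t => N (f ((r%:C)%C * cis t)) `^ s).
  apply: continuous_powR_comp => //; first exact: continuous_circle.
  by move=> t; exact: normc_ge0.
rewrite /M -poweR_EFin /avg; congr (_ `^ _)%E; rewrite EFinM; congr (_ * _)%E.
rewrite /segint /Rintegral fineK; last first.
  by apply: integrable_fin_num => //; exact: cont_integrable.
by apply: eq_integral => t _; rewrite polarE.
Qed.

Lemma M_ge (s r X : R) : 0 < s -> 0 <= X ->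
  X `^ s <= avg (fun t => N (f ((r%:C)%C * cis t)) `^ s) -> (X%:E <= M s%:E f r)%E.
Proof.
move=> s0 X0 H; rewrite M_avg// lee_fin.
rewrite -[leLHS]powRr1// -(mulfV (lt0r_neq0 s0)) powRrM.
apply: ge0_ler_powR; rewrite ?nnegrE ?powR_ge0 ?invr_ge0 ?(ltW s0)//.
exact: le_trans (powR_ge0 _ _) H.
Qed.

Lemma M_le (s r X : R) : 0 < s -> 0 <= X ->
  avg (fun t => N (f ((r%:C)%C * cis t)) `^ s) <= X `^ s -> (M s%:E f r <= X%:E)%E.
Proof.
move=> s0 X0 H; rewrite M_avg// lee_fin.
rewrite -[leRHS]powRr1// -(mulfV (lt0r_neq0 s0)) powRrM.
apply: ge0_ler_powR; rewrite ?nnegrE ?powR_ge0 ?invr_ge0 ?(ltW s0)//.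
apply: avg_ge0; last by move=> t; exact: powR_ge0.
apply: continuous_powR_comp => //; first exact: continuous_circle.
by move=> t; exact: normc_ge0.
Qed.

Lemma M_le_sup (p : \bar R) (r X : R) : (1 <= p)%E -> 0 <= r -> 0 <= X ->
  (forall z, N z = r -> N (f z) <= X) -> (M p f r <= X%:E)%E.
Proof.
move=> p1 r0 X0 fX; case: p p1 => [s|_|//].
  rewrite lee_fin => s1; have s0 : 0 < s by lra.
  apply: M_le => //; apply: avg_le_cst.
    apply: continuous_powR_comp => //; first exact: continuous_circle.
    by move=> t; exact: normc_ge0.
  move=> t; apply: ge0_ler_powR; rewrite ?nnegrE ?normc_ge0 ?(ltW s0)//.
  by apply: fX; rewrite normc_polar.
by apply: ge_ereal_sup => _ [z /= zr <-]; rewrite lee_fin; exact: fX.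
Qed.

Lemma M_ge0 (p : \bar R) (r : R) : (1 <= p)%E -> 0 <= r -> (0 <= M p f r)%E.
Proof.
case: p => [s|_ r0|//].
  by rewrite lee_fin => s1 _; rewrite M_avg ?lee_fin ?powR_ge0//; lra.
apply: ereal_sup_ge; exists (N (f (r%:C)%C))%:E; last by rewrite lee_fin normc_ge0.
by exists (r%:C)%C => //=; rewrite expr0n addr0 sqrtr_sqr ger0_norm.
Qed.

End PowerMeans.

Section Duality.
Context {R : realType}.
Local Notation C := R[i].

Definition trig (u : nat -> C) K (t : R) : C := \sum_(0 <= k < K) u k * cis (k%:R * t).

Lemma ccurve_trig u K : ccurve (trig u K).
Proof.
apply: ccurve_sum => k; apply: ccurveM; first exact: ccurve_cst.
exact: ccurve_cisM.
Qed.

Lemma trig_pair c u K : avg (fun t => Re (trig c K t * (trig u K t)^*%C)) =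
  \sum_(0 <= k < K) Re (c k * (u k)^*%C).
Proof.
rewrite -(trig_orthogonality K c u (ltn0Sn 0)); congr avg; apply/funext => t.
by congr (Re (_ * (_)^*%C)); apply: eq_bigr => k _; rewrite mul1n.
Qed.

Lemma trig_parseval u K : avg (fun t => N (trig u K t) ^+ 2) =
  \sum_(0 <= k < K) N (u k) ^+ 2.
Proof.
rewrite -(parseval K u (ltn0Sn 0)); congr avg; apply/funext => t.
by congr (N _ ^+ 2); apply: eq_bigr => k _; rewrite mul1n.
Qed.

Lemma ccurve_conj (k : R -> C) : ccurve k -> ccurve (fun t => (k t)^*%C).
Proof.
move=> [k1 k2]; split => t.
  by rewrite (_ : (fun s => Re (k s)^*%C) = (fun s => Re (k s)));
    [exact: k1|apply/funext => s; case: (k s)].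
rewrite (_ : (fun s => Im (k s)^*%C) = (fun s => - Im (k s))).
  by apply: (@cvgN _ R); exact: k2.
by apply/funext => s; case: (k s).
Qed.

Variables (f : C -> C) (a : nat -> C).
Hypotheses (ra : rapid a) (fa : expands f a).

Lemma expands_cont z : ccont_at f z.
Proof.
have [g ga] := exists_expands (rapid_shift ra).
exact: cderiv_cont (expands_deriv ra fa ga z).
Qed.

Lemma psum_trig K (r t : R) :
  psum a K ((r%:C)%C * cis t) = trig (fun k => a k * ((pw r k)%:C)%C) K t.
Proof.
apply: eq_bigr => k _; rewrite exprMn cisMn /pw.
rewrite rmorphM fmorphV rmorphXn rmorph_nat; ring.
Qed.

Lemma uniform_psum (r e : R) K0 : 0 <= r -> 0 < e -> exists2 K, (K0 <= K)%N &
  forall z, N z <= r -> N (f z - psum a K z) <= e.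
Proof.
move=> r0 e0; have [B aB] := rapid_bound ra r0.
have [n Hn] := exists_pow2_gt (2 * B / e).
exists (maxn K0 n); first exact: leq_maxl.
move=> z zr; apply: le_trans (expands_tail fa r0 aB _ zr) _.
rewrite ler_pdivrMr ?exprn_gt0// [leRHS]mulrC -ler_pdivrMr//.
apply: le_trans (ltW Hn) _; apply: ler_weXn2l; first by rewrite ler1n.
exact: leq_maxr.
Qed.

(** The pairing only sees finitely many coefficients; by uniform convergence on the
    circle it can be computed on a partial sum. *)
Lemma expands_pair (r : R) (u : nat -> C) K : 0 <= r ->
  (forall k, (K <= k)%N -> u k = 0) ->
  avg (fun t => Re (f ((r%:C)%C * cis t) * (trig u K t)^*%C)) =
  \sum_(0 <= k < K) pw r k * Re (a k * (u k)^*%C).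
Proof.
move=> r0 uK; pose B := \sum_(0 <= k < K) N (u k).
have B0 : 0 <= B by apply: sumr_ge0 => k _; exact: normc_ge0.
have trigB t : N (trig u K t) <= B.
  apply: le_trans (normc_sum _ _ _) _; apply: ler_sum => k _.
  by rewrite Normc.normcM normc_cis mulr1.
apply/eqP; rewrite -subr_eq0 -normr_eq0 eq_le normr_ge0 andbT.
apply/ler_addgt0Pl => e e0; rewrite addr0.
have e1 : 0 < e / (B + 1) by rewrite divr_gt0// ltr_wpDl.
have [K' KK' HK'] := uniform_psum K r0 e1.
have tE t : trig u K t = trig u K' t.
  rewrite /trig [RHS](big_cat_nat (n := K))//= [X in _ = _ + X]big1_seq ?addr0//.
  by move=> k; rewrite mem_index_iota => /andP[_ /andP[/uK -> _]]; rewrite mul0r.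
have sE : \sum_(0 <= k < K) pw r k * Re (a k * (u k)^*%C) =
   avg (fun t => Re (psum a K' ((r%:C)%C * cis t) * (trig u K t)^*%C)).
  have -> : (fun t => Re (psum a K' ((r%:C)%C * cis t) * (trig u K t)^*%C)) =
      (fun t => Re (trig (fun k => a k * ((pw r k)%:C)%C) K' t * (trig u K' t)^*%C)).
    by apply/funext => t; rewrite psum_trig tE.
  rewrite trig_pair [RHS](big_cat_nat (n := K))//= [X in _ = _ + X]big1_seq ?addr0.
    apply: eq_bigr => k _; move: (pw r k) (a k) (u k) => w [x y] [x' y'] /=; ring.
  by move=> k; rewrite mem_index_iota => /andP[_ /andP[/uK -> _]]; rewrite conjc0 mulr0.
have cf : ccurve (fun t => f ((r%:C)%C * cis t)).
  by apply: ccurve_comp; [exact: expands_cont|exact: ccurve_polar].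
have cp : ccurve (fun t => psum a K' ((r%:C)%C * cis t)).
  by under eq_fun do rewrite psum_trig; exact: ccurve_trig.
have ch := ccurve_conj (ccurve_trig u K).
have [c1 _] := ccurveM cf ch; have [c2 _] := ccurveM cp ch.
rewrite sE -avgB//; apply: norm_avg_le.
  by move=> t; apply: (@cvgB _ R); [exact: c1|exact: c2].
move=> t; rewrite -cReB -mulrBl; apply: le_trans (ler_norm_Re _) _.
rewrite Normc.normcM normc_conj.
apply: le_trans (_ : e / (B + 1) * B <= _).
  apply: ler_pM; rewrite ?normc_ge0//.
  by apply: HK'; rewrite normc_polar.
rewrite mulrAC ler_pdivrMr; last by rewrite ltr_wpDl.
by rewrite ler_pM2l// lerDl.
Qed.

(** The number [1 / max (2, q)], [q] being the conjugate exponent of [p]. *)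
Definition theta (p : \bar R) : R :=
  if p is s%:E then if s < 2 then 1 - s^-1 else 2^-1 else 2^-1.

(** Test [f] against the polynomial with unimodular coefficients on the frequencies
    in [P], where the coefficients of [f] have modulus at least [A]. *)
Lemma dual_test (r A : R) (P : pred nat) K : 0 <= r -> 0 < A ->
  (forall k, (k < K)%N -> P k -> A <= N (a k) * pw r k) ->
  exists h : R -> C, [/\ ccurve h,
    forall t, N (h t) <= (\sum_(0 <= k < K) P k)%:R,
    avg (fun t => N (h t) ^+ 2) = (\sum_(0 <= k < K) P k)%:R &
    A * (\sum_(0 <= k < K) P k)%:R <=
      avg (fun t => N (f ((r%:C)%C * cis t)) * N (h t))].
Proof.
move=> r0 A0 HA.
(* unimodular coefficients with the arguments of those of [f] *)
pose u k : C := if (k < K)%N && P k then a k / ((N (a k))%:C)%C else 0.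
have a0 k : (k < K)%N -> P k -> 0 < N (a k).
  move=> kK Pk; have := HA k kK Pk; rewrite lt_def normc_ge0 andbT => h.
  by apply/eqP => a0; move: h; rewrite a0 mul0r leNgt A0.
have Nu k : (k < K)%N -> N (u k) = (P k)%:R.
  move=> kK; rewrite /u kK /=; case: ifP => Pk; last by rewrite Normc.normc0.
  have h := a0 k kK Pk.
  by rewrite Normc.normcM normcV normc_real gtr0_norm// mulfV// gt_eqF.
have nE : (\sum_(0 <= k < K) P k)%:R = \sum_(0 <= k < K) N (u k) :> R.
  by rewrite natr_sum; apply: eq_big_nat => k /andP[_ kK]; rewrite Nu.
have ct := ccurve_trig u K.
exists (trig u K); split => //.
- move=> t; rewrite nE; apply: le_trans (normc_sum _ _ _) _; apply: ler_sum => k _.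
  by rewrite Normc.normcM normc_cis mulr1.
- rewrite trig_parseval natr_sum; apply: eq_big_nat => k /andP[_ kK].
  by rewrite Nu//; case: (P k); rewrite ?expr1n ?expr0n.
have uK k : (K <= k)%N -> u k = 0 by rewrite /u leqNgt => /negbTE ->.
have cf : ccurve (fun t => f ((r%:C)%C * cis t)).
  by apply: ccurve_comp; [exact: expands_cont|exact: ccurve_polar].
apply: le_trans (_ : avg (fun t => Re (f ((r%:C)%C * cis t) * (trig u K t)^*%C)) <= _).
  rewrite (expands_pair r0 uK) natr_sum mulr_sumr; apply: ler_sum_nat => k /andP[_ kK].
  rewrite /u kK /=; case: ifP => Pk; last by rewrite conjc0 mulr0 /= !mulr0.
  have h := a0 k kK Pk.
  rewrite mulr1; apply: le_trans (HA k kK Pk) _; rewrite mulrC.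
  have -> : (a k / ((N (a k))%:C)%C)^*%C = (a k)^*%C * (((N (a k))^-1)%:C)%C.
    rewrite -fmorphV; move: ((N (a k))^-1) (a k) => y [x1 x2].
    by apply/eqP; rewrite eq_complex /=; apply/andP; split; apply/eqP; ring.
  rewrite mulrA cReM mulr0 subr0 -normc_sqr_conj expr2 mulfK//.
  by rewrite gt_eqF.
have [c1 _] := ccurveM cf (ccurve_conj ct).
apply: ler_avg => //.
  by move=> t; apply: cvgM; [exact: (ccurve_normc cf)|exact: (ccurve_normc ct)].
by move=> t; apply: le_trans (ler_Re _) _; rewrite Normc.normcM normc_conj.
Qed.

(** Where [F <= l * h] the first term suffices; elsewhere [F = F ^ (1 - s) * F ^ s] and
    [1 - s <= 0]. This is a pointwise form of Hoelder's inequality, applied to an [h]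
    bounded by [n] and of mean square [n]. *)
Lemma threshold_le2 (F h n l s : R) : 0 <= F -> 0 <= h -> h <= n -> 0 < l ->
  1 <= s -> s <= 2 -> F * h <= l * h ^+ 2 + l `^ (1 - s) * n `^ (2 - s) * F `^ s.
Proof.
move=> F0 h0 hn l0 s1 s2.
have X0 : 0 <= l `^ (1 - s) * n `^ (2 - s) * F `^ s by rewrite !mulr_ge0 ?powR_ge0.
have [Fl|lF] := leP F (l * h).
  rewrite -[leLHS]addr0; apply: lerD => //.
  by rewrite expr2 mulrA; apply: ler_wpM2r.
have [->|hn0] := eqVneq h 0.
  by rewrite mulr0 expr0n mulr0 add0r.
have hp : 0 < h by rewrite lt_def hn0.
have lh : 0 < l * h by rewrite mulr_gt0.
have Fp : 0 < F by apply: lt_trans lF.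
rewrite -[leLHS]add0r; apply: lerD; first by rewrite mulr_ge0 ?sqr_ge0 ?(ltW l0).
have -> : F * h = F `^ (1 - s) * h * F `^ s.
  by rewrite mulrAC -powRDp// subrK powRr1 ?(ltW Fp).
apply: ler_wpM2r; first exact: powR_ge0.
apply: le_trans (_ : (l * h) `^ (1 - s) * h <= _).
  apply: ler_wpM2r => //; rewrite -[1 - s]opprB !powRN lef_pV2 ?posrE ?powR_gt0//.
  by apply: ge0_ler_powR; rewrite ?nnegrE ?subr_ge0 ?(ltW lh) ?(ltW Fp) ?(ltW lF).
rewrite powRM ?(ltW l0)// -mulrA; apply: ler_wpM2l; first exact: powR_ge0.
rewrite -{2}[h]powRr1// -powRDp// (_ : 1 - s + 1 = 2 - s); last by ring.
by apply: ge0_ler_powR; rewrite ?nnegrE ?subr_ge0// (le_trans h0).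
Qed.

(** With the test polynomial of [dual_test]: for [p < 2] by [threshold_le2] with [l = A
    / 2]; for [p >= 2] Cauchy-Schwarz first gives the mean square of [f], and the values
    below half its root can be discarded. *)
Lemma M_lower_bound (p : \bar R) (r A : R) (P : pred nat) K : (1 <= p)%E ->
  0 <= r -> 0 < A ->
  (forall k, (k < K)%N -> P k -> A <= N (a k) * pw r k) ->
  (0 < \sum_(0 <= k < K) P k)%N ->
  ((A / 2 * (\sum_(0 <= k < K) P k)%:R `^ theta p)%:E <= M p f r)%E.
Proof.
move=> p1 r0 A0 HA; have := dual_test r0 A0 HA.
set n := (\sum_(0 <= k < K) P k)%N => -[h [ch hn h2 Ah]] n0.
have n0' : 0 < n%:R :> R by rewrite ltr0n.
have A2 : 0 < A / 2 by rewrite divr_gt0.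
pose F t := N (f ((r%:C)%C * cis t)).
have cF : continuous F by apply: continuous_circle; exact: expands_cont.
have F0 t : 0 <= F t by exact: normc_ge0.
have cN := ccurve_normc ch.
have ch2 : continuous (fun t => N (h t) ^+ 2).
  by move=> t; apply: cvgM; exact: cN.
have cFh : continuous (fun t => F t * N (h t)).
  by move=> t; apply: cvgM; [exact: cF|exact: cN].
have cZ (c : R) (k : R -> R) : continuous k -> continuous (fun t => c * k t).
  by move=> ck t; apply: cvgM; [exact: cvg_cst|exact: ck].
have cD (k l : R -> R) : continuous k -> continuous l -> continuous (fun t => k t + l t).
  by move=> ck cl t; apply: (@cvgD _ R); [exact: ck|exact: cl].
have L2 : A ^+ 2 * n%:R <= avg (fun t => F t ^+ 2).
  have cF2 : continuous (fun t => F t ^+ 2) by move=> t; apply: cvgM; exact: cF.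
  have : avg (fun t => F t * N (h t)) <= A / 2 * n%:R + (2 * A)^-1 * avg (fun t => F t ^+ 2).
    rewrite -h2 -avgZ// -avgZ// -avgD; [|exact: cZ..].
    apply: ler_avg => //; first by apply: cD; exact: cZ.
    move=> t; rewrite -subr_ge0.
    have -> : A / 2 * N (h t) ^+ 2 + (2 * A)^-1 * F t ^+ 2 - F t * N (h t) =
      (F t - A * N (h t)) ^+ 2 / (2 * A) by field; rewrite gt_eqF.
    by rewrite divr_ge0 ?sqr_ge0// mulr_ge0// ltW.
  move=> /(le_trans Ah) le1.
  have -> : avg (fun t => F t ^+ 2) = 2 * A * ((2 * A)^-1 * avg (fun t => F t ^+ 2)).
    by rewrite mulrA mulfV ?mul1r// gt_eqF// mulr_gt0.
  have -> : A ^+ 2 * n%:R = 2 * A * (A / 2 * n%:R) by field.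
  by rewrite ler_pM2l ?mulr_gt0//; lra.
have sn : n%:R = (n%:R `^ 2^-1) ^+ 2 :> R.
  by rewrite powR12_sqrt ?(ltW n0')// sqr_sqrtr// ltW.
have sn0 : 0 < n%:R `^ 2^-1 :> R by rewrite powR_gt0.
case: p p1 => [s|_|//]; rewrite /theta.
  rewrite lee_fin => s1; have s0 : 0 < s by lra.
  have cFs : continuous (fun t => F t `^ s) by exact: continuous_powR_comp.
  case: ltP => s2; (apply: M_ge; [exact: expands_cont|exact: s0| |]).
  - by rewrite mulr_ge0 ?powR_ge0// ltW.
  - have le1 : A * n%:R <= A / 2 * n%:R + (A / 2) `^ (1 - s) * n%:R `^ (2 - s) * avg (fun t => F t `^ s).
      apply: le_trans Ah _; rewrite -[X in A / 2 * X]h2 -avgZ// -avgZ// -avgD; [|exact: cZ..].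
      apply: ler_avg => //; first by apply: cD; exact: cZ.
      by move=> t; apply: threshold_le2; rewrite ?normc_ge0//; lra.
    rewrite powRM ?powR_ge0 ?(ltW A2)// -powRrM mulrBl mulVf ?gt_eqF// mul1r.
    have E : (A / 2) `^ s * n%:R `^ (s - 1) * ((A / 2) `^ (1 - s) * n%:R `^ (2 - s)) = A / 2 * n%:R.
      have -> : (A / 2) `^ s * n%:R `^ (s - 1) * ((A / 2) `^ (1 - s) * n%:R `^ (2 - s)) =
        ((A / 2) `^ s * (A / 2) `^ (1 - s)) * (n%:R `^ (s - 1) * n%:R `^ (2 - s)) by ring.
      rewrite -!powRDp// (_ : s + (1 - s) = 1); last by ring.
      by rewrite (_ : s - 1 + (2 - s) = 1) ?powRr1 ?(ltW A2) ?(ltW n0')//; ring.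
    have c0 : 0 < (A / 2) `^ (1 - s) * n%:R `^ (2 - s) by rewrite mulr_gt0 ?powR_gt0.
    by rewrite -(ler_pM2r c0) E mulrC; move: le1; rewrite -/F; lra.
  - by rewrite mulr_ge0 ?powR_ge0// ltW.
  have X0 : 0 < A / 2 * n%:R `^ 2^-1 by rewrite mulr_gt0.
  set X := A / 2 * n%:R `^ 2^-1 in X0 *.
  have X2 : X ^+ 2 *+ 4 = A ^+ 2 * n%:R by rewrite [in RHS]sn /X; field.
  have : avg (fun t => F t ^+ 2) <= X ^+ 2 + X `^ (2 - s) * avg (fun t => F t `^ s).
    rewrite -[X in X + _]avg_cst -avgZ// -avgD; [|exact: cst_continuous|exact: cZ].
    apply: ler_avg.
    - by move=> t; apply: cvgM; exact: cF.
    - by apply: cD; [exact: cst_continuous|exact: cZ].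
    move=> t; have [FX|XF] := leP (F t) X.
      rewrite -[leLHS]addr0; apply: lerD; last by rewrite mulr_ge0 ?powR_ge0.
      by rewrite lerXn2r ?nnegrE ?(ltW X0).
    rewrite -[leLHS]add0r; apply: lerD; first exact: sqr_ge0.
    have Fp : 0 < F t by apply: lt_trans XF.
    have -> : F t ^+ 2 = F t `^ (2 - s) * F t `^ s.
      by rewrite -powRDp// subrK powR_mulrn ?(ltW Fp).
    apply: ler_wpM2r; first exact: powR_ge0.
    rewrite -[2 - s]opprB !powRN lef_pV2 ?posrE ?powR_gt0//.
    by apply: ge0_ler_powR; rewrite ?nnegrE ?subr_ge0 ?(ltW X0) ?(ltW Fp) ?(ltW XF).
  move=> le1; have c0 : 0 < X `^ (2 - s) by rewrite powR_gt0.
  rewrite -(ler_pM2l c0) -powRDp// subrK powR_mulrn ?(ltW X0)//.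
  have := sqr_ge0 X; move: X2; rewrite -/F -mulr_natl; lra.
apply/lee_addgt0Pr => e e0.
have [->|Mfin] := eqVneq (M +oo%E f r) +oo%E; first by rewrite leey.
have M0 := M_ge0 expands_cont (leey 1%E) r0.
have : M +oo%E f r \is a fin_num by rewrite ge0_fin_numE// lt_neqAle Mfin leey.
move=> /fineK ME; rewrite -ME -EFinD lee_fin.
have FM t : F t <= fine (M +oo%E f r).
  rewrite -lee_fin ME; apply: ereal_sup_ubound; exists ((r%:C)%C * cis t) => //=.
  exact: normc_polar.
set m := fine _ in FM *.
have m0 : 0 <= m by apply: le_trans (FM 0).
have : A ^+ 2 * n%:R <= m ^+ 2.
  apply: le_trans L2 _; apply: avg_le_cst.
    by move=> t; apply: cvgM; exact: cF.
  by move=> t; rewrite lerXn2r ?nnegrE.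
rewrite [in X in X -> _]sn -exprMn ler_sqr ?nnegrE ?mulr_ge0 ?(ltW A0) ?powR_ge0// => Am.
by have := mulr_gt0 A0 sn0; lra.
Qed.

End Duality.

(** * Optimality of the growth rates *)

Section GrowthExponent.
Context {R : realType}.

Definition sigma (g : R) : R := Num.min 2^-1 (1 - g).

Lemma theta_hoelder (p : \bar R) : (1 < p)%E ->
  maxe 2%:E (hoelder_conjugate p) = ((theta p)^-1)%:E.
Proof.
case: p => [s| _ |//]; last first.
  by rewrite hoelder_conjugatey invrK; apply/max_idPl; rewrite lee_fin; lra.
rewrite lte_fin => s1; rewrite /hoelder_conjugate /= eqe gt_eqF; last by lra.
have s10 : s - 1 != 0 by rewrite subr_eq0 gt_eqF.
rewrite inver (negbTE s10) -EFinM /theta.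
have s1' : 0 < s - 1 by lra.
case: ltP => s2.
  have -> : (1 - s^-1)^-1 = s / (s - 1) by field; rewrite s10 gt_eqF//; lra.
  by apply/max_idPr; rewrite lee_fin ler_pdivlMr//; lra.
by rewrite invrK; apply/max_idPl; rewrite lee_fin ler_pdivrMr//; lra.
Qed.

Lemma theta_gt0 (p : \bar R) : (1 < p)%E -> 0 < theta p.
Proof.
case: p => [s| _ |//] /=; last by rewrite invr_gt0.
rewrite lte_fin => s1; case: ifP => _; last by rewrite invr_gt0.
by rewrite subr_gt0 invf_lt1//; lra.
Qed.

Lemma theta_le (p : \bar R) : (1 <= p)%E -> theta p <= 2^-1.
Proof.
case: p => [s| _ |//] /=; last by [].
rewrite lee_fin => s1; case: ltP => // s2.
have : 2^-1 <= s^-1 by rewrite lef_pV2 ?posrE//; lra.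
lra.
Qed.

Lemma alphaE (p : \bar R) (g : R) : (1 < p)%E ->
  alpha p g = 2^-1 - sigma g * theta p.
Proof.
move=> p1; rewrite /alpha theta_hoelder//; congr (_ - _).
have t0 := theta_gt0 p1.
rewrite -EFinM inver mulf_eq0 pnatr_eq0 invr_eq0 (gt_eqF t0) /=.
rewrite invfM invrK mulrA; congr (_ * _); rewrite /sigma.
have -> : Num.min 1 (2 * (1 - g)) = 2 * Num.min 2^-1 (1 - g).
  by rewrite minr_pMr// mulfV// pnatr_eq0.
by rewrite mulrAC mulfV ?mul1r// pnatr_eq0.
Qed.

End GrowthExponent.

Section GrowthLimsup.
Context {R : realType}.
Local Notation C := R[i].

Lemma growth_limsup_small (p : \bar R) (a e : R) (f : C -> C) : 0 < e ->
  ~ (0 < growth_limsup p a f)%E ->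
  exists A, forall r, A < r -> ((r `^ a * expR (- r))%:E * M p f r <= e%:E)%E.
Proof.
move=> e0 /negP; rewrite -leNgt => L0.
have : (growth_limsup p a f < e%:E)%E by apply: le_lt_trans L0 _; rewrite lte_fin.
move=> /ereal_inf_lt [_ [V [A [_ HA]] <-] Ve]; exists A => r Ar.
apply: le_trans (ltW Ve); apply: ereal_sup_ubound; exists r => //; exact: HA.
Qed.

Lemma growth_limsup_ge (p : \bar R) (a X : R) (f : C -> C) :
  (forall A, exists2 r, A < r & (X%:E <= (r `^ a * expR (- r))%:E * M p f r)%E) ->
  (X%:E <= growth_limsup p a f)%E.
Proof.
move=> H; apply: le_ereal_inf_tmp => _ [V [A [_ HA]] <-].
have [r Ar h] := H A; apply: ereal_sup_ge; exists ((r `^ a * expR (- r))%:E * M p f r)%E => //.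
by exists r => //; exact: HA.
Qed.

End GrowthLimsup.

Section LowerBounds.
Context {R : realType}.
Local Notation C := R[i].
Implicit Types (f : C -> C) (p : \bar R).

Definition far_from0 (B : R) : set (C -> C) := [set h | B < N (h 0)].

Lemma far_from0_open B : open (far_from0 B : set {compact-open, C -> C}).
Proof. exact: (open_eval0 (@open_normc_gt R B)). Qed.

Lemma entire_cst (c : C) : entire (fun=> c).
Proof.
move=> z; apply: (@cderiv_derivable R (fun=> c) z 0) => e e0; exists 1; first exact: ltr01.
by move=> h _; rewrite subrr mul0r subrr Normc.normc0 mulr_ge0 ?normc_ge0// ltW.
Qed.

Lemma far_from0_entire B : far_from0 B `&` entire !=set0.
Proof.
exists (fun=> ((`|B| + 1)%:C)%C); split; last exact: entire_cst.
rewrite /far_from0 /mkset normc_real ger0_norm ?addr_ge0//.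
by have := ler_norm B; lra.
Qed.

Lemma Ubeta_recurrent (beta : nat -> R) f (U : set {compact-open, C -> C}) :
  (forall k, 1 <= beta k) -> Ubeta_freq_hypercyclic_D beta f -> open U ->
  U `&` entire !=set0 -> forall n0, exists2 n, (n0 <= n)%N & U (iter n D f).
Proof.
move=> b1 [_ Hf] oU Ue n0.
have [n nn [_ [Un _]]] := upper_density_infinite b1 (Hf U oU Ue) n0.
by exists n.
Qed.

(** A single coefficient [k], tested at [r = k] where its Poisson weight is of order [e
    ^ r / sqrt r], bounds the mean from below. *)
Lemma unbounded_growth p f : (1 <= p)%E -> entire f ->
  (forall B n0, exists2 n, (n0 <= n)%N & B < N (iter n D f 0)) ->
  growth_limsup p 2^-1 f = +oo%E.
Proof.
move=> p1 /entire_expands [a ra fa] H.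
apply/eqP; rewrite eq_le leey /= leNgt; apply/negP => Lfin.
have X_le (X : R) : 0 < X -> (X%:E <= growth_limsup p 2^-1 f)%E.
  move=> X0; apply: growth_limsup_ge => A.
  have [k kA Bk] := H (40 * X) (Num.trunc `|A|).+1.
  have k0 : (0 < k)%N by apply: leq_trans kA.
  have k0' : 0 < k%:R :> R by rewrite ltr0n.
  exists k%:R.
    apply: le_lt_trans (ler_norm A) _; apply: lt_le_trans (truncnS_gt _) _.
    by rewrite ler_nat.
  have s0 : 0 < Num.sqrt k%:R :> R by rewrite sqrtr_gt0.
  have pk : expR k%:R / (20 * Num.sqrt k%:R) <= pw (k%:R : R) k.
    by apply: pw_window_ge => //; rewrite subnn divr_ge0// ltW.
  pose A0 : R := 40 * X * (expR k%:R / (20 * Num.sqrt k%:R)).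
  have A00 : 0 < A0 by rewrite !mulr_gt0 ?invr_gt0 ?mulr_gt0 ?expR_gt0.
  have cnt : (\sum_(0 <= j < k.+1) (j == k))%N = 1%N.
    rewrite big_nat_recr//= eqxx big1_seq// => j; rewrite mem_index_iota => /andP[_ /andP[_ jk]].
    by rewrite (ltn_eqF jk).
  have := @M_lower_bound R f a ra fa p k%:R A0 (pred1 k) k.+1 p1 (ltW k0') A00.
  rewrite cnt powR1 mulr1 => /(_ _ isT) Mge.
  apply: le_trans (_ : (X%:E <= (k%:R `^ 2^-1 * expR (- k%:R))%:E * (A0 / 2)%:E)%E) _.
    rewrite -EFinM lee_fin le_eqVlt; apply/orP; left; apply/eqP.
    rewrite powR12_sqrt ?(ltW k0')// expRN /A0; field.
    by rewrite !gt_eqF ?expR_gt0.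
  apply: lee_wpmul2l; first by rewrite lee_fin mulr_ge0 ?powR_ge0 ?expR_ge0.
  apply: Mge => j _ /eqP ->; rewrite -(iterD_at0 k ra fa).
  have q0 : 0 <= expR k%:R / (20 * Num.sqrt k%:R) :> R.
    by rewrite divr_ge0 ?expR_ge0// mulr_ge0// ltW.
  have x40 : 0 <= 40 * X by rewrite mulr_ge0// ltW.
  exact: ler_pM x40 q0 (ltW Bk) pk.
have L0 : (0 <= growth_limsup p 2^-1 f)%E.
  by apply: le_trans (X_le 1 ltr01); rewrite lee_fin.
have LE : growth_limsup p 2^-1 f \is a fin_num by rewrite ge0_fin_numE.
have f0 := fine_ge0 L0.
have X0 : 0 < fine (growth_limsup p 2^-1 f) + 1 by lra.
have := X_le _ X0; rewrite -{2}(fineK LE) lee_fin; lra.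
Qed.

Lemma Ubeta_unbounded_growth (beta : nat -> R) p f : (forall k, 1 <= beta k) -> (1 <= p)%E ->
  Ubeta_freq_hypercyclic_D beta f -> growth_limsup p 2^-1 f = +oo%E.
Proof.
move=> b1 p1 Hf; apply: unbounded_growth => //; first by case: Hf.
move=> B n0.
exact: (Ubeta_recurrent b1 Hf (far_from0_open B) (far_from0_entire B) n0).
Qed.

Variable g : R.
Hypotheses (g0 : 0 <= g) (g1 : g < 1).

Let s := sigma g.
Let s_gt0 : 0 < s.
Proof. by rewrite lt_min invr_gt0 ltr0n subr_gt0. Qed.

Definition window (m : nat) : nat := Num.trunc (m%:R `^ s / 2).

(** The window is inside the bulk of the Poisson weights of parameter [m], short enough
    for the weights [beta_gamma g] to be comparable on it, and still of order [m ^
    sigma]. *)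
Lemma window_spec : exists2 m0 : nat, (0 < m0)%N & forall m, (m0 <= m)%N ->
  [/\ (0 < window m)%N, (window m)%:R <= Num.sqrt m%:R / 2 :> R,
      (window m)%:R <= 2^-1 * m%:R `^ (1 - g) &
      m%:R `^ s <= 4 * (window m)%:R].
Proof.
pose m0 := (Num.trunc (4 `^ s^-1 : R)).+1; exists m0 => // m mm.
have m1 : 1 <= m%:R :> R by rewrite ler1n (leq_trans _ mm).
have m4 : 4 <= m%:R `^ s.
  have E4 : (4 `^ s^-1) `^ s = 4 by rewrite -powRrM mulVf ?powRr1// lt0r_neq0.
  rewrite -[leLHS]E4.
  apply: ge0_ler_powR; rewrite ?nnegrE ?powR_ge0 ?(ltW s_gt0)//.
  by apply: le_trans (ltW (truncnS_gt _)) _; rewrite ler_nat.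
have x0 : 0 <= m%:R `^ s / 2 by lra.
have w1 : (window m)%:R <= m%:R `^ s / 2 by rewrite /window truncn_le.
have w2 : m%:R `^ s / 2 < (window m)%:R + 1 by rewrite natr1; exact: truncnS_gt.
have ps : m%:R `^ s <= Num.sqrt m%:R.
  by rewrite -powR12_sqrt//; apply: ler_powR => //; rewrite /s /sigma ge_min lexx.
have pg : m%:R `^ s <= m%:R `^ (1 - g).
  by apply: ler_powR => //; rewrite /s /sigma ge_min lexx orbT.
split; [|lra|lra|lra].
by rewrite -(ltr_nat R); lra.
Qed.

Lemma sparse_zero_density (E : set nat) :
  (forall eta : R, 0 < eta -> exists m0, forall m, (m0 <= m)%N ->
    \sum_((m - window m).+1 <= k < m.+1) \1_E k <= eta * (window m)%:R :> R) ->
  (upper_density (beta_gamma g) E <= 0)%E.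
Proof.
move=> HE; apply/lee_addgt0Pr => e e0; rewrite add0e.
have e1 : 0 < e / (2 * expR 1) by rewrite divr_gt0// mulr_gt0 ?expR_gt0.
have [m1 H1] := HE _ e1; have [m0 m00 H0] := window_spec.
have g01 : 0 <= g <= 1 by rewrite g0 ltW.
have := @upper_density_windows R (beta_gamma g) (beta_gamma_ge1 g) E window
   (expR 1) _ (maxn m0 m1) _ _ (expR_gt0 1) e1 _.
have -> : 2 * (expR 1 * (e / (2 * expR 1))) = e by field; rewrite gt_eqF ?expR_gt0.
apply.
- move=> m; rewrite geq_max => /andP[/[dup] mm /H0 [w0 w1 _ _] _]; rewrite w0 /=.
  have m1' : 1 <= m%:R :> R by rewrite ler1n (leq_trans m00 mm).
  rewrite -(ler_nat R); apply: le_trans w1 _.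
  have sq : Num.sqrt m%:R <= m%:R :> R.
    by rewrite -powR12_sqrt// -[leRHS]powRr1//; apply: ler_powR => //; lra.
  by have := sqrtr_ge0 (m%:R : R); lra.
- move=> m k; rewrite geq_max => /andP[/[dup] mm /H0 [w0 w1 w2 _] _] /andP[k1 k2].
  split; first exact: beta_gamma_homo.
  have m1' : 1 <= m%:R :> R by rewrite ler1n (leq_trans m00 mm).
  have sq : Num.sqrt m%:R <= m%:R :> R.
    by rewrite -powR12_sqrt// -[leRHS]powRr1//; apply: ler_powR => //; lra.
  have w2m : (2 * window m <= m)%N.
    by rewrite -(ler_nat R) natrM; lra.
  have := @beta_gamma_comparable R g g01 m k 2^-1.
  rewrite mulfV ?pnatr_eq0//.
  clear HE H0 H1; apply => //; [lia|lia|].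
  apply: le_trans w2; rewrite ler_nat; lia.
by move=> m; rewrite geq_max => /andP[_]; exact: H1.
Qed.

(** If the growth were o(e^r / r^alpha), then by [M_lower_bound] at [r = m] few of
    the derivatives [f^(k)(0)] with [k] in the window below [m] could exceed 1 in
    modulus. *)
Lemma Ubeta_growth_lower p f : (1 < p)%E ->
  Ubeta_freq_hypercyclic_D (beta_gamma g) f ->
  (0 < growth_limsup p (alpha p g) f)%E.
Proof.
move=> p1 [fe Hf]; apply: contrapT => L0.
have [a ra fa] := entire_expands fe.
have t0 := theta_gt0 p1.
have := Hf _ (far_from0_open 1) (far_from0_entire 1).
set E := (X in upper_density _ X); apply/negP; rewrite -leNgt.
apply: sparse_zero_density => eta eta0.
(* 40 is twice the constant of [pw_window_ge], the other factor 2 coming from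
   [M_lower_bound] *)
pose e := (eta / 4) `^ theta p / 40.
have e0 : 0 < e by rewrite divr_gt0 ?powR_gt0 ?divr_gt0.
have [A HA] := growth_limsup_small e0 L0.
have [m0 m00 H0] := window_spec.
exists (maxn m0 (Num.trunc `|A|).+1) => m; rewrite geq_max => /andP[mm mA].
have [w0 w1 w2 w4] := H0 _ mm.
have m0' : 0 < m%:R :> R by rewrite ltr0n (leq_trans m00 mm).
have Am : A < m%:R.
  apply: le_lt_trans (ler_norm A) _; apply: lt_le_trans (truncnS_gt _) _.
  by rewrite ler_nat.
have {HA} HA := HA _ Am.
pose P : pred nat := fun k => (m - window m < k)%N && `[< E k >].
set n := (\sum_(0 <= k < m.+1) P k)%N.
have -> : \sum_((m - window m).+1 <= k < m.+1) \1_E k = n%:R :> R.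
  have wm : ((m - window m).+1 <= m.+1)%N by rewrite ltnS leq_subr.
  rewrite /n natr_sum [RHS](big_cat_nat (leq0n _) wm) /=.
  rewrite [X in _ = X + _]big1_seq ?add0r; last first.
    by move=> k; rewrite mem_index_iota => /andP[_ /andP[_ km]]; rewrite /P ltnNge -ltnS km.
  apply: eq_big_nat => k /andP[k1 _]; rewrite /P k1 /= indicE.
  by congr ((nat_of_bool _)%:R); apply/idP/asboolP; rewrite inE.
have [->|n0] := posnP n; first by rewrite mulr_ge0// ltW.
have s0 : 0 < Num.sqrt m%:R :> R by rewrite sqrtr_gt0.
pose A0 : R := expR m%:R / (20 * Num.sqrt m%:R).
have A00 : 0 < A0 by rewrite divr_gt0 ?mulr_gt0 ?expR_gt0.
have AP k : (k < m.+1)%N -> P k -> A0 <= N (a k) * pw m%:R k.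
  rewrite ltnS => km /andP[k1 /asboolP [_ [Ek _]]].
  have ak : 1 < N (a k) by rewrite -(iterD_at0 k ra fa).
  apply: le_trans (pw_window_ge _ km _) _; first by apply: leq_trans mm.
    by apply: le_trans w1; rewrite ler_nat leq_subLR addnC -leq_subLR ltnW.
  by rewrite ler_peMl ?pw_ge0// ltW.
have := M_lower_bound ra fa (ltW p1) (ltW m0') A00 AP n0; rewrite -/n => Mge.
have : ((m%:R `^ alpha p g * expR (- m%:R))%:E * (A0 / 2 * n%:R `^ theta p)%:E <= e%:E)%E.
  apply: le_trans HA; apply: lee_wpmul2l; last exact: Mge.
  by rewrite lee_fin mulr_ge0 ?powR_ge0 ?expR_ge0.
rewrite -EFinM lee_fin alphaE// powRDp// powR12_sqrt ?(ltW m0')// powRN -/s.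
have ms : 0 < m%:R `^ (s * theta p) by rewrite powR_gt0.
have -> : Num.sqrt m%:R * (m%:R `^ (s * theta p))^-1 * expR (- m%:R) * (A0 / 2 * n%:R `^ theta p) =
   n%:R `^ theta p / m%:R `^ (s * theta p) / 40.
  by rewrite expRN /A0; field; rewrite !gt_eqF ?expR_gt0.
rewrite /e ler_pM2r ?invr_gt0// ler_pdivrMr// [m%:R `^ _]powRrM -powRM ?powR_ge0 ?divr_ge0 ?(ltW eta0)// => nle.
have nle' : n%:R <= eta / 4 * m%:R `^ s.
  rewrite leNgt; apply/negP => lt_n; move: nle; rewrite leNgt => /negP; apply.
  by apply: gt0_ltr_powR; rewrite ?nnegrE ?mulr_ge0 ?powR_ge0 ?divr_ge0 ?(ltW eta0).
by apply: le_trans nle' _; have := ler_wpM2l (ltW eta0) w4; lra.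
Qed.

End LowerBounds.

(** * Hypercyclicity as frequent hypercyclicity for exponential weights *)

Section HypercyclicEquivalence.
Context {R : realType}.
Local Notation C := R[i].

Lemma Ubeta_hypercyclic (beta : nat -> R) (f : C -> C) : (forall k, 1 <= beta k) ->
  Ubeta_freq_hypercyclic_D beta f -> hypercyclic_D f.
Proof.
move=> b1 Hf; split; first by case: Hf.
move=> g ge B; rewrite nbhsE => -[U [oU Ug] UB].
have [n n0 Un] := Ubeta_recurrent b1 Hf oU (ex_intro _ g (conj Ug ge)) 1.
by exists (iter n D f); split; [exists n|exact: UB].
Qed.

Lemma punctured_disc_avoids (c : C) (e : R) (l : seq C) : 0 < e ->
  exists2 d : R, 0 < d <= e & forall w, 0 < N (w - c) <= d -> w \notin l.
Proof.
move=> e0; elim: l => [|v l [d /andP[d0 de] Hd]]; first by exists e; rewrite ?e0 ?lexx.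
have [vc|vc] := eqVneq v c.
  exists d; first by rewrite d0.
  move=> w wd; rewrite inE negb_or (Hd w wd) andbT; apply/eqP => wv.
  by move: wd; rewrite wv vc subrr Normc.normc0 ltxx.
have v0 : 0 < N (v - c) by rewrite normc_gt0 subr_eq0.
exists (Num.min d (N (v - c) / 2)).
  by rewrite lt_min d0 divr_gt0//= ge_min de.
move=> w /andP[w0]; rewrite le_min => /andP[wd wv].
rewrite inE negb_or Hd ?w0// andbT; apply/eqP => E.
by move: wv; rewrite E; lra.
Qed.

Lemma open_disc (c : C) (d : R) : open [set w : C | N (w - c) < d].
Proof.
rewrite openE => w /= wd; apply/(@nbhs_complexP _ w).
exists (d - N (w - c)); first by rewrite subr_gt0.
move=> v vw; rewrite /mkset; have := normcD (v - w) (w - c); rewrite addrA subrK; lra.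
Qed.

(** The space of entire functions has no isolated point, even when only the
    values at 0 are looked at: translating a function by a small constant avoids
    the finitely many values taken so far by the orbit. *)
Lemma hypercyclic_recurrent (f : C -> C) (U : set {compact-open, C -> C}) :
  hypercyclic_D f -> open U -> U `&` entire !=set0 ->
  forall n0, exists2 n, (n0 <= n)%N & U (iter n D f).
Proof.
move=> [fe fh] oU [g [Ug ge]] n0.
have [a ra ga] := entire_expands ge.
have [rho [e e0 Hg]] := open_contains_uniform_disc (expands_cont ra ga) oU Ug.
pose l := [seq iter n D f 0 | n <- iota 0 n0].
have [d /andP[d0 de] Hd] := punctured_disc_avoids (g 0) l e0.
(* moving [g] by less than [d] makes its value at 0 differ from those of the first [n0]
   iterates of [f] *)
pose h : C -> C := fun z => g z + ((d / 2)%:C)%C.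
have Uh : U h.
  apply: Hg => z _; rewrite /h addrC addKr normc_real ger0_norm; lra.
have he : entire h.
  move=> z; apply: (@cderiv_derivable R h z (derive1 g z)).
  have := derivable_cderiv (ge z).
  move=> H x x0; have [dl dl0 K] := H x x0; exists dl => // w /K.
  by rewrite /h opprD addrACA subrr addr0.
pose O := [set w : C | N (w - (g 0 + ((d / 2)%:C)%C)) < d / 2].
pose V : set {compact-open, C -> C} := U `&` [set k | O (k 0)].
have oV : open V by apply: openI => //; exact: (open_eval0 (@open_disc _ _)).
have Vh : V h.
  by split=> //; rewrite /O /= /h subrr Normc.normc0; lra.
have nV : nbhs (h : {compact-open, C -> C}) V by apply: open_nbhs_nbhs; split.
have [_ [[n /= n1 <-] [Un On]]] := fh h he V nV.
exists n => //; rewrite leqNgt; apply/negP => nn0.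
have : iter n D f 0 \in l by apply: map_f; rewrite mem_iota.
apply/negP; apply: Hd; move: On; rewrite /O /=.
set w := iter n D f 0; set c := ((d / 2)%:C)%C => wd.
have Nc : N c = d / 2 by rewrite normc_real ger0_norm; lra.
move: wd; rewrite opprD addrA => wd.
have h1 := normcD (w - g 0 - c) c; rewrite subrK in h1.
have h2 := normcD (w - g 0) (- (w - g 0 - c)).
rewrite normcN opprB addrC subrK in h2.
by apply/andP; split; lra.
Qed.

(** At a visit [n], the last term of [\sum_(k <= n) e ^ k] is already a fixed proportion
    of the sum. *)
Lemma hypercyclic_Ubeta1 (f : C -> C) :
  hypercyclic_D f -> Ubeta_freq_hypercyclic_D (beta_gamma 1) f.
Proof.
move=> Hf; split; first by case: Hf.
move=> U oU Ue.
have g01 : 0 <= (1 : R) <= 1 by rewrite ler01 lexx.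
have [K K0 HK] := mass_beta_gamma_le g01.
have [a ra fa] := entire_expands Hf.1.
apply: lt_le_trans (_ : ((K^-1)%:E <= _)%E); first by rewrite lte_fin invr_gt0.
apply: upper_density_ge => n0.
have [n nn Un] := hypercyclic_recurrent Hf oU Ue (maxn n0 1).
move: nn; rewrite geq_max => /andP[nn n1]; exists n => //.
have bn : 0 < beta_gamma (1 : R) n by exact: expR_gt0.
have := HK n n1; rewrite subrr powRr0 mulr1 => HKn.
have m0 : 0 < mass (beta_gamma (1 : R)) n.
  by apply: lt_le_trans (mass_ge (beta_gamma_ge1 1) n); rewrite ltr0n.
rewrite ler_pdivlMr//; apply: le_trans (_ : beta_gamma (1 : R) n <= _).
  by rewrite mulrC ler_pdivrMr// mulrC.
case: n n1 Un {nn bn HKn m0} => // n n1 Un.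
rewrite mass_inS [X in _ + _ * X](_ : _ = 1).
  rewrite mulr1 lerDr; exact: mass_in_ge0 (beta_gamma_ge1 1) _ _.
rewrite indicE mem_set//; split => //; split => //.
exact: entire_iterD ra fa.
Qed.

End HypercyclicEquivalence.

(** * The Rudin-Shapiro sequence *)

Section RudinShapiro.

Fixpoint rs_fuel fuel n : bool :=
  if fuel is f.+1 then rs_fuel f n./2 (+) (odd n && odd n./2) else false.

(** The parity of the number of pairs of consecutive digits 1 in binary. *)
Definition rs n : bool := rs_fuel n n.

Lemma rs_fuelE f n : (n <= f)%N -> rs_fuel f n = rs n.
Proof.
rewrite /rs; elim: f {-2}f (leqnn f) n => [|b IH] f fb n nf.
  by move: fb nf; rewrite leqn0 => /eqP ->; rewrite leqn0 => /eqP ->.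
case: n nf => [|n] nf.
  by elim: (f) => //= m ->.
case: f fb nf => [//|f] fb nf; rewrite /=.
have h : (uphalf n <= n)%N by lia.
by rewrite !IH//; lia.
Qed.

Lemma rsE n : (0 < n)%N -> rs n = rs n./2 (+) (odd n && odd n./2).
Proof.
case: n => // n _; rewrite -(@rs_fuelE n n.+1./2)//; lia.
Qed.

Lemma rs_double n : rs n.*2 = rs n.
Proof.
have [->//|n0] := posnP n.
by rewrite rsE ?double_gt0// doubleK odd_double addbF.
Qed.

Lemma rs_doubleS n : rs n.*2.+1 = rs n (+) odd n.
Proof. by rewrite rsE// (_ : (n.*2.+1)./2 = n) /= ?odd_double//; lia. Qed.

(** Among [4 j + 2] and [4 j + 3] exactly one has sign +1. *)
Lemma rs_count M : (0 < M)%N ->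
  (M <= 8 * \sum_(0 <= m < M) ~~ rs m)%N.
Proof.
have quarter c : (c <= \sum_(0 <= m < 4 * c) ~~ rs m)%N.
  elim: c => [//|c IH]; rewrite mulnS addnC !addnS addn0 !big_nat_recr//=.
  have r2 : rs (4 * c).+2 = rs (2 * c).+1.
    by rewrite -[RHS]rs_double; congr rs; lia.
  have r3 : rs (4 * c).+3 = ~~ rs (2 * c).+1.
    have -> : (4 * c).+3 = ((2 * c).+1).*2.+1 by lia.
    by rewrite rs_doubleS /= mul2n odd_double addbT.
  by rewrite r2 r3; case: (rs (2 * c).+1) => /=; lia.
move=> M0; have h := quarter (M %/ 4)%N.
have h1 : (\sum_(0 <= m < 4 * (M %/ 4)) ~~ rs m <= \sum_(0 <= m < M) ~~ rs m)%N.
  by rewrite [leqRHS](big_cat_nat (n := (4 * (M %/ 4))%N))//= ?leq_addr//; lia.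
have h2 : (1 <= \sum_(0 <= m < M) ~~ rs m)%N.
  by case: M M0 {h h1} => // M _; rewrite big_nat_recl.
lia.
Qed.

End RudinShapiro.

Section RudinShapiroSums.
Context {R : realType}.
Local Notation C := R[i].

Definition rsgn m : C := (-1) ^+ rs m.
Definition rs_sum k1 k2 (y : C) : C := \sum_(k1 <= k < k2) rsgn k * y ^+ k.

Lemma normc_rsgn m : N (rsgn m) = 1.
Proof. by rewrite /rsgn normcX normcN Normc.normc1 expr1n. Qed.

Lemma rs_sum_double a b y : (a <= b)%N ->
  rs_sum a.*2 b.*2 y = rs_sum a b (y ^+ 2) + y * rs_sum a b (- y ^+ 2).
Proof.
move=> ab; rewrite -(subnKC ab); elim: (b - a)%N => [|m IH].
  by rewrite addn0 /rs_sum !big_geq// mulr0 addr0.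
rewrite addnS doubleS /rs_sum !big_nat_recr ?leq_addr//=; last 2 first.
  - by rewrite leq_double leq_addr.
  - by rewrite leqW// leq_double leq_addr.
move: IH; rewrite /rs_sum => ->; rewrite /rsgn rs_double rs_doubleS.
rewrite signr_addb signr_odd.
have e1 : y ^+ (a + m).*2 = (y ^+ 2) ^+ (a + m) by rewrite -muln2 mulnC exprM.
rewrite [y ^+ (a + m).*2.+1]exprS e1; set Y := y ^+ 2.
rewrite [(- Y) ^+ (a + m)]exprNn; ring.
Qed.

Lemma parallelogram (a b : C) :
  N (a + b) ^+ 2 + N (a - b) ^+ 2 = 2 * (N a ^+ 2 + N b ^+ 2).
Proof. by case: a b => a1 a2 [b1 b2]; rewrite !normc_sqr /=; ring. Qed.

(** Minkowski's inequality for the two pairs [(a, b)] and [(c, d)] of vectors. *)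
Lemma pair_minkowski (a b c d : C) (X Z : R) : 0 <= X -> 0 <= Z ->
  N a ^+ 2 + N b ^+ 2 <= X ^+ 2 -> N c ^+ 2 + N d ^+ 2 <= Z ^+ 2 ->
  N (a + c) ^+ 2 + N (b + d) ^+ 2 <= (X + Z) ^+ 2.
Proof.
move=> X0 Z0 ab cd; have := normcD a c; have := normcD b d.
set x1 := N (a + c); set x2 := N (b + d).
have := normc_ge0 a; have := normc_ge0 b; have := normc_ge0 c; have := normc_ge0 d.
have x10 : 0 <= x1 by exact: normc_ge0.
have x20 : 0 <= x2 by exact: normc_ge0.
clearbody x1 x2; move: ab cd; set A := N a; set B := N b; set E := N c; set F := N d.
clearbody A B E F => ab cd F0 E0 B0 A0 h2 h1.
have cs : A * E + B * F <= X * Z.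
  rewrite -ler_sqr ?nnegrE ?addr_ge0 ?mulr_ge0//.
  apply: le_trans (_ : (A ^+ 2 + B ^+ 2) * (E ^+ 2 + F ^+ 2) <= _).
    rewrite -subr_ge0.
    have -> : (A ^+ 2 + B ^+ 2) * (E ^+ 2 + F ^+ 2) - (A * E + B * F) ^+ 2 =
      (A * F - B * E) ^+ 2 by ring.
    exact: sqr_ge0.
  by rewrite exprMn; apply: ler_pM; rewrite ?addr_ge0 ?sqr_ge0.
have s1 : x1 ^+ 2 <= (A + E) ^+ 2 by rewrite lerXn2r ?nnegrE ?addr_ge0.
have s2 : x2 ^+ 2 <= (B + F) ^+ 2 by rewrite lerXn2r ?nnegrE ?addr_ge0.
have -> : (X + Z) ^+ 2 = X ^+ 2 + Z ^+ 2 + 2 * (X * Z) by ring.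
have e1 : (A + E) ^+ 2 = A ^+ 2 + E ^+ 2 + 2 * (A * E) by ring.
have e2 : (B + F) ^+ 2 = B ^+ 2 + F ^+ 2 + 2 * (B * F) by ring.
by lra.
Qed.

Lemma double_uphalf k : (uphalf k).*2 = (odd k + k)%N.
Proof. lia. Qed.

Lemma double_half k : (k./2.*2 = k - odd k)%N.
Proof. lia. Qed.

Lemma half_interval k1 k2 : (k1 < k2)%N ->
  (uphalf k1 <= k2./2)%N /\ (2 * (k2./2 - uphalf k1) <= k2 - k1)%N.
Proof. by move=> ?; split; lia. Qed.

(** Splitting a sum over an interval into even and odd indices, the parallelogram
    law gains a factor sqrt 2 for a halving of the length, up to at most two
    boundary terms; the constant 10 absorbs those. *)
Lemma rs_sum_pair k1 k2 (y : C) : N y = 1 -> (k1 < k2)%N ->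
  N (rs_sum k1 k2 y) ^+ 2 + N (rs_sum k1 k2 (- y)) ^+ 2 <=
    (12 * Num.sqrt (k2 - k1)%:R - 10) ^+ 2.
Proof.
have r22 : Num.sqrt 2 ^+ 2 = 2 :> R by rewrite sqr_sqrtr.
have r2l : 7/5 <= Num.sqrt 2 :> R.
  by rewrite -(@ler_pXn2r _ 2)// ?nnegrE ?sqrtr_ge0 ?divr_ge0// r22; lra.
have r2u : Num.sqrt 2 <= 3/2 :> R.
  by rewrite -(@ler_pXn2r _ 2)// ?nnegrE ?sqrtr_ge0 ?divr_ge0// r22; lra.
move: {2}(k2 - k1)%N (leqnn (k2 - k1)) => n.
elim: n k1 k2 y => [|n IH] k1 k2 y kn Ny lt12; first by lia.
have Ny' : N (- y) = 1 by rewrite normcN.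
pose a := uphalf k1; pose b := k2./2.
have [ab ml] := half_interval lt12.
(* [e1] and [e2] are the terms of odd index left over at the two ends *)
pose e1 (x : C) := if odd k1 then rsgn k1 * x ^+ k1 else 0.
pose e2 (x : C) := if odd k2 then rsgn k2.-1 * x ^+ k2.-1 else 0.
have splitE x : rs_sum k1 k2 x = rs_sum a.*2 b.*2 x + (e1 x + e2 x).
  have h1 : rs_sum k1 k2 x = e1 x + rs_sum a.*2 k2 x.
    rewrite /e1 /a /rs_sum double_uphalf; case: ifP => k1o; last by rewrite add0r.
    by rewrite big_ltn.
  have h2 : rs_sum a.*2 k2 x = rs_sum a.*2 b.*2 x + e2 x.
    have ab2 : (a.*2 <= b.*2)%N by rewrite leq_double.
    rewrite /e2 /rs_sum; move: ab2; rewrite double_half; case: ifP => k2o; last by rewrite subn0 addr0.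
    have k20 : (0 < k2)%N by apply: leq_ltn_trans lt12.
    rewrite subn1 => ab2; rewrite -[X in \sum_(_ <= _ < X) _](prednK k20).
    by rewrite big_nat_recr.
  by rewrite h1 h2; ring.
have ex x : N x = 1 -> N (e1 x + e2 x) <= 2.
  move=> Nx; apply: le_trans (normcD _ _) _.
  have t (c : bool) m : N (if c then rsgn m * x ^+ m else 0) <= 1.
    by case: c; rewrite ?Normc.normc0// Normc.normcM normc_rsgn normcX Nx expr1n mulr1.
  by have := t (odd k1) k1; have := t (odd k2) k2.-1; rewrite -/(e1 x) -/(e2 x); lra.
have exx : N (e1 y + e2 y) ^+ 2 + N (e1 (- y) + e2 (- y)) ^+ 2 <= (2 * Num.sqrt 2) ^+ 2.
  have h x : N x = 1 -> N (e1 x + e2 x) ^+ 2 <= 2 ^+ 2.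
    by move=> Nx; rewrite lerXn2r ?nnegrE ?normc_ge0// ex.
  by have := h _ Ny; have := h _ Ny'; rewrite exprMn r22; lra.
set len := (k2 - k1)%N.
have len0 : (0 < len)%N by rewrite subn_gt0.
have sl : 1 <= Num.sqrt len%:R :> R.
  by rewrite -[leLHS]sqrtr1 ler_wsqrtr// ler1n.
have [E|ltab] := leqP b a.
  have {E} E : a = b by apply/eqP; rewrite eqn_leq ab.
  have z x : rs_sum a.*2 b.*2 x = 0 by rewrite E /rs_sum big_geq.
  rewrite !splitE !z !add0r.
  have [len1|len2] := leqP len 1.
    have l1 : len = 1%N by apply/eqP; rewrite eqn_leq len1.
    rewrite l1 sqrtr1.
    have one x : N x = 1 -> N (e1 x + e2 x) ^+ 2 <= 1.
      move=> Nx; have : rs_sum k1 k2 x = e1 x + e2 x by rewrite splitE z add0r.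
      move=> <-; have -> : k2 = k1.+1 by rewrite -(subnKC (ltnW lt12)) -/len l1 addn1.
      by rewrite /rs_sum big_nat1 Normc.normcM normc_rsgn normcX Nx expr1n mulr1 expr1n.
    by have := one _ Ny; have := one _ Ny'; lra.
  apply: le_trans exx _.
  have : Num.sqrt 2 <= Num.sqrt len%:R :> R by rewrite ler_wsqrtr// (ler_nat R 2).
  by move=> h; rewrite lerXn2r ?nnegrE; lra.
pose m := (b - a)%N.
have m0 : (0 < m)%N by rewrite subn_gt0.
have mn : (b - a <= n)%N.
  have mm : (m < 2 * m)%N by rewrite ltn_Pmull.
  by rewrite -ltnS; apply: leq_trans mm (leq_trans ml kn).
have Ny2 : N (y ^+ 2) = 1 by rewrite normcX Ny expr1n.
have := IH a b (y ^+ 2) mn Ny2 ltab; rewrite -/m.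
set s := Num.sqrt m%:R => IHm.
have s1 : 1 <= s by rewrite -[leLHS]sqrtr1 ler_wsqrtr// ler1n.
have in2 : N (rs_sum a.*2 b.*2 y) ^+ 2 + N (rs_sum a.*2 b.*2 (- y)) ^+ 2 <=
     (Num.sqrt 2 * (12 * s - 10)) ^+ 2.
  rewrite !rs_sum_double// sqrrN mulNr parallelogram Normc.normcM Ny mul1r.
  by rewrite exprMn r22 ler_pM2l.
rewrite !splitE; apply: le_trans (pair_minkowski _ _ in2 exx) _.
- by rewrite mulr_ge0 ?sqrtr_ge0//; lra.
- by rewrite mulr_ge0 ?sqrtr_ge0.
have sq : Num.sqrt 2 * s <= Num.sqrt len%:R.
  by rewrite -sqrtrM// ler_wsqrtr// -natrM ler_nat.
have X0 : 0 <= Num.sqrt 2 * (12 * s - 10) + 2 * Num.sqrt 2.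
  by rewrite addr_ge0 ?mulr_ge0 ?sqrtr_ge0//; lra.
have XY : Num.sqrt 2 * (12 * s - 10) + 2 * Num.sqrt 2 <= 12 * Num.sqrt len%:R - 10.
  have -> : Num.sqrt 2 * (12 * s - 10) = 12 * (Num.sqrt 2 * s) - 10 * Num.sqrt 2 by ring.
  lra.
by rewrite lerXn2r ?nnegrE// (le_trans X0).
Qed.

Lemma rs_sum_le k1 k2 (y : C) : N y = 1 -> (k1 <= k2)%N ->
  N (rs_sum k1 k2 y) <= 12 * Num.sqrt (k2 - k1)%:R.
Proof.
move=> Ny; rewrite leq_eqVlt => /predU1P[->|lt12].
  by rewrite /rs_sum big_geq// Normc.normc0 mulr_ge0 ?sqrtr_ge0.
have sl : 1 <= Num.sqrt (k2 - k1)%:R :> R.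
  by rewrite -[leLHS]sqrtr1 ler_wsqrtr// ler1n subn_gt0.
have h := rs_sum_pair Ny lt12.
have h1 : N (rs_sum k1 k2 y) ^+ 2 <= (12 * Num.sqrt (k2 - k1)%:R - 10) ^+ 2.
  by apply: le_trans h; rewrite lerDl sqr_ge0.
have h2 : 0 <= 12 * Num.sqrt (k2 - k1)%:R - 10 :> R by lra.
by move: h1; rewrite ler_sqr ?nnegrE ?normc_ge0//; lra.
Qed.

End RudinShapiroSums.

(** * Assembling a function from blocks *)

Section PerturbedMeans.
Context {R : realType}.
Local Notation C := R[i].

(** As [(x + y) ^ s <= (2 x) ^ s + (2 y) ^ s]. *)
Lemma M_perturb (p : \bar R) (r Y : R) (f g : C -> C) : (1 <= p)%E -> 0 <= r -> 0 <= Y ->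
  (forall z, ccont_at f z) -> (forall z, ccont_at g z) ->
  (M p g r <= Y%:E)%E -> (forall z, N z = r -> N (f z - g z) <= Y) ->
  (M p f r <= (4 * Y)%:E)%E.
Proof.
move=> p1 r0 Y0 cf cg gY fg.
have fg' z : N z = r -> N (f z) <= N (g z) + Y.
  move=> zr; have := normcD (f z - g z) (g z); rewrite subrK => h.
  by apply: le_trans h _; rewrite addrC lerD2l; exact: fg.
case: p p1 gY => [s|p1|//].
  rewrite lee_fin => s1; have s0 : 0 < s by lra.
  pose G t := N (g ((r%:C)%C * cis t)).
  have cG : continuous (fun t => G t `^ s).
    by apply: continuous_powR_comp => //; [exact: continuous_circle|move=> t; exact: normc_ge0].
  rewrite M_avg// lee_fin -/(G _) => gY.
  have gYs : avg (fun t => G t `^ s) <= Y `^ s.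
    have a0 : 0 <= avg (fun t => G t `^ s) by apply: avg_ge0 => // t; exact: powR_ge0.
    have E : (avg (fun t => G t `^ s) `^ s^-1) `^ s = avg (fun t => G t `^ s).
      by rewrite -powRrM mulVf ?powRr1// lt0r_neq0.
    by rewrite -E; apply: ge0_ler_powR; rewrite ?nnegrE ?powR_ge0 ?(ltW s0).
  apply: (@M_le R f cf s r _ s0); first by rewrite mulr_ge0.
  apply: le_trans (_ : avg (fun t => 2 `^ s * (G t `^ s + Y `^ s)) <= _).
    apply: ler_avg.
    - by apply: continuous_powR_comp => //; [exact: continuous_circle|move=> t; exact: normc_ge0].
    - move=> t; apply: cvgM; first exact: cvg_cst.
      by apply: (@cvgD _ R); [exact: cG|exact: cvg_cst].
    move=> t; have zr : N ((r%:C)%C * cis t) = r by rewrite normc_polar.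
    have G0 : 0 <= G t by exact: normc_ge0.
    have F0 := normc_ge0 (f ((r%:C)%C * cis t)).
    have Fb := fg' _ zr; rewrite -/(G t) in Fb.
    have [GY|YG] := leP (G t) Y.
      apply: le_trans (_ : (2 * Y) `^ s <= _).
        by apply: ge0_ler_powR; rewrite ?nnegrE ?(ltW s0) ?mulr_ge0//; lra.
      by rewrite powRM// ler_wpM2l ?powR_ge0// lerDr powR_ge0.
    apply: le_trans (_ : (2 * G t) `^ s <= _).
      by apply: ge0_ler_powR; rewrite ?nnegrE ?(ltW s0) ?mulr_ge0//; lra.
    by rewrite powRM// ler_wpM2l ?powR_ge0// lerDl powR_ge0.
  have cGY : continuous (fun t => G t `^ s + Y `^ s).
    by move=> t; apply: (@cvgD _ R); [exact: cG|exact: cvg_cst].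
  rewrite avgZ// avgD//; last exact: cst_continuous.
  rewrite avg_cst powRM// (_ : 4 = 2 * 2 :> R) ?powRM//; last by ring.
  rewrite -mulrA ler_wpM2l ?powR_ge0//.
  apply: le_trans (_ : 2 * Y `^ s <= _); first lra.
  by rewrite ler_wpM2r ?powR_ge0// -[leLHS]powRr1// ler_powR// ler1n.
move=> gY; have Y40 : 0 <= 4 * Y by rewrite mulr_ge0.
apply: M_le_sup => // z zr; apply: le_trans (fg' z zr) _.
have : N (g z) <= Y.
  by rewrite -lee_fin; apply: le_trans gY; apply: ereal_sup_ubound; exists z.
lra.
Qed.

Lemma psum_cont (a : nat -> C) n z : ccont_at (psum a n) z.
Proof.
pose a' k := if (k < n)%N then a k else 0.
have ra : rapid a'.
  move=> rho; exists (\sum_(0 <= k < n) N (a k) * `|rho| ^+ k / k`!%:R) => k.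
  have pos j : 0 <= N (a j) * `|rho| ^+ j / j`!%:R.
    by rewrite divr_ge0 ?mulr_ge0 ?normc_ge0 ?exprn_ge0.
  rewrite /a'; case: ltnP => kn; last by rewrite Normc.normc0 !mul0r; exact: sumr_ge0.
  by rewrite (bigD1_seq k) ?mem_index_iota ?iota_uniq//= lerDl; exact: sumr_ge0.
have ea : expands (psum a n) a'.
  move=> w e e0; exists n => m nm.
  rewrite [X in _ - X](_ : _ = psum a n w) ?subrr ?Normc.normc0 ?(ltW e0)//.
  rewrite /psum (big_cat_nat (leq0n _) nm) /= [X in _ + X]big1_seq ?addr0.
    by apply: eq_big_nat => k /andP[_ kn]; rewrite /a' kn.
  move=> k; rewrite mem_index_iota => /andP[_ /andP[k1 _]].
  by rewrite /a' ltnNge k1 !mul0r.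
exact: (expands_cont ra ea).
Qed.

End PerturbedMeans.

Section Assembly.
Context {R : realType}.
Local Notation C := R[i].

(** A pair [(q, nu)]: coefficients of a polynomial with respect to the basis [z ^ k /
    k!], and a radius [nu], to which belongs the tolerance [1 / (nu + 1)]. *)
Definition target : countType := (seq (rat * rat) * nat)%type.

Definition tcoef (t : target) k : C :=
  let q := nth (0, 0) t.1 k in (ratr q.1 +i* ratr q.2)%C.

Definition tpoly (t : target) (z : C) : C := psum (tcoef t) (size t.1) z.

(** Reading off the 2-adic valuation makes every target recur infinitely often. *)
Definition stage_target (j : nat) : target :=
  odflt ([::], 0%N) (unpickle (logn 2 j)).

Lemma stage_target_recurs (t : target) n0 :
  exists2 j, (n0 <= j)%N & stage_target j = t.
Proof.
exists (2 ^ (pickle t) * n0.*2.+1)%N.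
  apply: leq_trans (leq_pmull _ _); last by rewrite expn_gt0.
  by rewrite leqW// -addnn leq_addr.
rewrite /stage_target lognM ?expn_gt0// pfactorK// logn_coprime ?addn0 ?pickleK//.
by rewrite coprime2n /= odd_double.
Qed.

Variables (beta : nat -> R) (p : \bar R) (a c0 r0 : R) (Psi : R -> R).
Hypothesis p1 : (1 <= p)%E.
Hypotheses (a_ge0 : 0 <= a) (a_le : a <= 2^-1) (c0_gt0 : 0 < c0).
Hypothesis Psi_ge : forall r, 0 < r -> r0 <= r -> c0 <= Psi r.

(** The share of one block in the growth at [r]; the factor 4 is that of [M_perturb]. *)
Definition allowed (r : R) : R := Psi r / 4 * (expR r / r `^ a).

(** A finite piece at scale [n] that obeys the growth condition on its own and brings
    its shifts close to the target [t] along a set of proportion [delta]. The constants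
    [K] and [delta] may depend on [t] but not on [n]. *)
Record block (t : target) (K delta : R) (n : nat) (b : nat -> C) : Prop := Block {
  block_supp : forall k, b k != 0 -> (n <= k < 4 * n)%N;
  block_bound : forall k, N (b k) <= K;
  block_growth : forall r, r0 <= r -> n%:R / 2 <= r -> r <= 8 * n%:R ->
    (M p (psum b (4 * n)) r <= (allowed r)%:E)%E;
  block_dense : exists (G : set nat) (n' : nat),
    [/\ (n <= n')%N, forall k, G k -> (n <= k < 4 * n)%N,
        delta * mass beta n' <= mass_in beta G n' &
        forall k, G k -> forall z, N z <= t.2%:R ->
          N (psum (fun i => b (k + i)%N) (4 * n) z - tpoly t z) <= t.2.+1%:R^-1] }.

Definition eventually_nat (P : nat -> Prop) := exists m0, forall m, (m0 <= m)%N -> P m.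

Lemma eventually_ge (x : R) : eventually_nat (fun m => x <= m%:R).
Proof.
exists (Num.trunc `|x|).+1 => m mm; apply: le_trans (ler_norm x) _.
by apply: le_trans (ltW (truncnS_gt _)) _; rewrite ler_nat.
Qed.

Lemma eventually_small_power (K e : R) : 0 <= K -> 0 < e ->
  eventually_nat (fun m => K * m%:R `^ (a - 1) <= e).
Proof.
move=> K0 e0; have [m1 H1] := eventually_ge ((K / e) `^ (1 - a)^-1).
exists (maxn 1 m1) => m; rewrite geq_max => /andP[m0 /H1 mm].
have m0' : 0 < m%:R :> R by rewrite ltr0n.
have a1 : 0 < 1 - a by have := a_le; lra.
have h : K / e <= m%:R `^ (1 - a).
  have E : ((K / e) `^ (1 - a)^-1) `^ (1 - a) = K / e.
    by rewrite -powRrM mulVf ?powRr1 ?divr_ge0 ?(ltW e0)// gt_eqF.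
  by rewrite -E; apply: ge0_ler_powR; rewrite ?nnegrE ?powR_ge0 ?(ltW a1).
rewrite -opprB powRN ler_pdivrMr ?powR_gt0// mulrC.
by move: h; rewrite ler_pdivrMr.
Qed.

Lemma exp_tail (x e : R) : 0 <= x -> 0 < e ->
  eventually_nat (fun l => forall l', (l <= l')%N -> \sum_(l <= k < l') pw x k <= e).
Proof.
move=> x0 e0; move/cvgrPdist_le : (@sum_pw_cvg R x) => /(_ _ e0) [l0 _ H].
exists l0 => l ll l' ll'; have := H l ll; rewrite /= => /(le_trans (ler_norm _)).
have := sum_pw_le l' x0; rewrite (big_cat_nat (n := l) (leq0n _) ll') /=.
set u := \sum_(0 <= _ < _) _; set v := \sum_(_ <= _ < _) _; lra.
Qed.

(** What the scale [m] of stage [j] must satisfy when the previous scale is [n]: the new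
    block is negligible outside its range of radii (fourth clause) and at the visits of
    the previous block to its target (last clause). *)
Definition stage_req (K : target -> R) (n0 : target -> nat) (j n m : nat) : Prop :=
  [/\ (n0 (stage_target j) <= m)%N, (17 * n < m)%N,
      K (stage_target j) <= m%:R,
      4 * K (stage_target j) * m%:R `^ (a - 1) <= c0 / 8 / 2 ^+ j &
      forall l', (m - 4 * n <= l')%N ->
        (4 * n%:R + 1) ^+ 2 * \sum_(m - 4 * n <= k < l') pw (4 * (stage_target j.-1).2%:R : R) k
          <= (stage_target j.-1).2.+1%:R^-1 :> R].

Lemma sub_room n l m : (17 * n + 1 + l <= m)%N -> (l <= m - 4 * n)%N.
Proof. lia. Qed.

Lemma stage_req_ex K n0 j n : (forall t, 0 <= K t) -> exists m, stage_req K n0 j n m.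
Proof.
move=> K0; set nu : R := (stage_target j.-1).2%:R.
have d0 : 0 < (4 * n%:R + 1) ^+ 2 :> R by rewrite exprn_gt0// ltr_wpDl// mulr_ge0.
have e0 : 0 < (stage_target j.-1).2.+1%:R^-1 / (4 * n%:R + 1) ^+ 2 :> R.
  by rewrite divr_gt0// invr_gt0 ltr0Sn.
have nu0 : 0 <= 4 * nu by rewrite mulr_ge0.
have [l0 Hl] := exp_tail nu0 e0.
have [m1 H1] := eventually_ge (K (stage_target j)).
have e1 : 0 < c0 / 8 / 2 ^+ j by rewrite !divr_gt0// exprn_gt0.
have K4 : 0 <= 4 * K (stage_target j) by rewrite mulr_ge0.
have [m2 H2] := eventually_small_power K4 e1.
exists (maxn (n0 (stage_target j)) (maxn (17 * n + 1 + l0) (maxn m1 m2)))%N.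
set m := maxn _ _.
have hm : [/\ (n0 (stage_target j) <= m)%N, (17 * n + 1 + l0 <= m)%N, (m1 <= m)%N & (m2 <= m)%N].
  by rewrite /m; split; rewrite !leq_max leqnn ?orbT.
case: hm => h1 h2 h3 h4; split => //.
- apply: leq_trans h2; rewrite addn1 ltnS; exact: leq_addr.
- exact: H1.
- exact: H2.
move=> l' ll'; rewrite mulrC -ler_pdivlMr//; apply: Hl => //.
exact: sub_room h2.
Qed.

Lemma far_index x y k i : (17 * x < y)%N -> (x <= k)%N -> (y - 4 * x <= i)%N ->
  (4 * x <= k + i)%N.
Proof. lia. Qed.

Section Construction.
Variables (K delta : target -> R) (n0 : target -> nat).
Hypothesis K_ge0 : forall t, 0 <= K t.
Variable ns : nat -> nat.
Hypothesis ns0 : stage_req K n0 0 0 (ns 0).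
Hypothesis nsS : forall j, stage_req K n0 j.+1 (ns j) (ns j.+1).
Variable b : nat -> nat -> C.
Hypothesis b_block : forall j, block (stage_target j) (K (stage_target j))
  (delta (stage_target j)) (ns j) (b j).

Let ns_req j : exists n, stage_req K n0 j n (ns j).
Proof. by case: j => [|j]; [exists 0%N|exists (ns j)]. Qed.

Let ns_lt j : (17 * ns j < ns j.+1)%N.
Proof. by have [] := nsS j. Qed.

Let ns_gt j : (j < ns j)%N.
Proof.
elim: j => [|j IH]; first by have [_ ] := ns0; rewrite muln0.
apply: leq_ltn_trans (ns_lt j); apply: leq_trans IH _.
by rewrite leq_pmull.
Qed.

Let ns_homo i j : (i < j)%N -> (17 * ns i < ns j)%N.
Proof.
elim: j => [//|j IH]; rewrite ltnS leq_eqVlt => /predU1P[->|/IH h]; first exact: ns_lt.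
apply: ltn_trans h _; apply: leq_ltn_trans (ns_lt j); by rewrite leq_pmull.
Qed.

Let b_zero j k : ~~ (ns j <= k < 4 * ns j)%N -> b j k = 0.
Proof.
move=> H; apply/eqP; apply: contraNT H; exact: (block_supp (b_block j)).
Qed.

Let b_le j k : N (b j k) <= k%:R.
Proof.
have [/andP[jk _]|/b_zero ->] := boolP (ns j <= k < 4 * ns j)%N; last by rewrite Normc.normc0.
apply: le_trans (block_bound (b_block j) k) _.
have [n [_ _ h _ _]] := ns_req j; apply: le_trans h _; by rewrite ler_nat.
Qed.

(** The sum of the blocks selected by [P]; it is finite at each index, as block [j]
    begins after [j]. *)
Definition part (P : pred nat) k : C := \sum_(0 <= j < k.+1 | P j) b j k.

Let coefs := part predT.

Lemma part_le P k : N (part P k) <= (k%:R + 1) ^+ 2.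
Proof.
apply: le_trans (normc_sum _ _ _) _.
apply: le_trans (_ : \sum_(0 <= j < k.+1) (k%:R + 1 : R) <= _).
  rewrite big_mkcond; apply: ler_sum => j _; case: ifP => _.
    by apply: le_trans (b_le j k) _; rewrite lerDl.
  by rewrite addr_ge0.
by rewrite sumr_const_nat subn0 -[leLHS]mulr_natl -natr1 expr2.
Qed.

Let pow4 k : (k%:R + 1) ^+ 2 <= 4 ^+ k :> R.
Proof.
have -> : 4 ^+ k = (2 ^+ k) ^+ 2 :> R by rewrite exprAC; congr (_ ^+ k); ring.
rewrite lerXn2r ?nnegrE ?exprn_ge0 ?addr_ge0//.
by rewrite natr1 -natrX ler_nat ltn_expl.
Qed.

Lemma part_rapid P : rapid (part P).
Proof.
move=> rho; exists (expR (4 * `|rho|)) => k.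
apply: le_trans (_ : pw (4 * `|rho|) k <= _).
  rewrite /pw exprMn; apply: ler_wpM2r; first by rewrite invr_ge0.
  apply: ler_wpM2r; first by rewrite exprn_ge0.
  exact: le_trans (part_le P k) (pow4 k).
apply: le_trans (sum_pw_le k.+1 _); last by rewrite mulr_ge0.
rewrite big_nat_recr//= lerDr; apply: sumr_ge0 => j _.
by rewrite pw_ge0// mulr_ge0.
Qed.

Let inside j (r : R) := (ns j)%:R / 2 <= r /\ r <= 8 * (ns j)%:R.

(** Away from the range of radii of a block, the Poisson weights of its indices lie in
    the tail that Chebyshev's inequality bounds. *)
Lemma block_outside j (r : R) n : 0 < r -> ~ inside j r ->
  \sum_(0 <= k < n) N (b j k) * pw r k <= c0 / 8 / 2 ^+ j * (expR r / r `^ a).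
Proof.
move=> r_gt0 out; set Kj := K (stage_target j); set m := ns j.
have m0 : 0 < m%:R :> R by rewrite ltr0n; apply: leq_ltn_trans (ns_gt j).
have [n' [_ _ _ Ksmall _]] := ns_req j; rewrite -/Kj -/m in Ksmall.
have E0 := expR_gt0 r.
have ra0 : 0 < r `^ a by rewrite powR_gt0.
have Kj0 : 0 <= Kj by exact: K_ge0.
suff H : \sum_(0 <= k < n) N (b j k) * pw r k <= 4 * Kj * m%:R `^ (a - 1) * (expR r / r `^ a).
  by apply: le_trans H _; apply: ler_wpM2r => //; rewrite divr_ge0// ltW.
have red (P : pred nat) d : 0 < d -> (forall k, P k -> d <= `|k%:R - r|) ->
    (forall k, (m <= k < 4 * m)%N -> P k) ->
    \sum_(0 <= k < n) N (b j k) * pw r k <= Kj * (r * expR r / d ^+ 2).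
  move=> d0 Pd mP.
  apply: le_trans (_ : Kj * \sum_(0 <= k < n | P k) pw r k <= _); last first.
    by apply: ler_wpM2l => //; apply: poisson_chebyshev => //; exact: ltW.
  rewrite mulr_sumr [leRHS]big_mkcond; apply: ler_sum => k _.
  have [/mP ->|/b_zero ->] := boolP (m <= k < 4 * m)%N.
    apply: ler_wpM2r; first by rewrite pw_ge0// ltW.
    exact: (block_bound (b_block j)).
  rewrite Normc.normc0 mul0r; case: ifP => // _.
  by rewrite mulr_ge0// pw_ge0// ltW.
have rE : r = r `^ (1 + a) / r `^ a.
  by rewrite -powRN -powRDp// addrK powRr1// ltW.
have [rm|mr] := ltP r (m%:R / 2).
  apply: le_trans (red (fun k => m <= k)%N (m%:R / 2) _ _ _) _.
  - by rewrite divr_gt0.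
  - move=> k mk; have mkR : m%:R <= k%:R :> R by rewrite ler_nat.
    by rewrite ger0_norm; [lra|rewrite subr_ge0; lra].
  - by move=> k /andP[].
  have h : r `^ (1 + a) <= m%:R `^ (1 + a).
    by apply: ge0_ler_powR; rewrite ?nnegrE ?addr_ge0 ?(ltW r_gt0) ?(ltW m0)//; lra.
  have mE : m%:R `^ (a - 1) = m%:R `^ (1 + a) / m%:R ^+ 2.
    rewrite -powR_mulrn ?(ltW m0)// -powRN -powRDp//; congr (_ `^ _); ring.
  rewrite mE [X in X * expR r]rE.
  have -> : Kj * (r `^ (1 + a) / r `^ a * expR r / (m%:R / 2) ^+ 2) =
    (4 * Kj / m%:R ^+ 2 * (expR r / r `^ a)) * r `^ (1 + a).
    by field; rewrite !gt_eqF.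
  have -> : 4 * Kj * (m%:R `^ (1 + a) / m%:R ^+ 2) * (expR r / r `^ a) =
    (4 * Kj / m%:R ^+ 2 * (expR r / r `^ a)) * m%:R `^ (1 + a) by ring.
  apply: ler_wpM2l => //.
  by rewrite mulr_ge0 ?divr_ge0 ?mulr_ge0 ?exprn_ge0 ?(ltW E0) ?(ltW ra0).
have r8 : 8 * m%:R < r by rewrite ltNge; apply/negP => h; exact: out.
apply: le_trans (red (fun k => k < 4 * m)%N (r / 2) _ _ _) _.
- by rewrite divr_gt0.
- move=> k km; have : k%:R <= 4 * m%:R :> R by rewrite -natrM ler_nat ltnW.
  by move=> h; rewrite ler0_norm; lra.
- by move=> k /andP[].
have h : r `^ (a - 1) <= m%:R `^ (a - 1).
  rewrite -[a - 1]opprB !powRN lef_pV2 ?posrE ?powR_gt0//.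
  have al := a_le; by apply: ge0_ler_powR; rewrite ?nnegrE ?(ltW r_gt0) ?(ltW m0)//; lra.
have -> : Kj * (r * expR r / (r / 2) ^+ 2) = (4 * Kj * (expR r / r `^ a)) * r `^ (a - 1).
  have -> : r `^ (a - 1) = r `^ a / r.
    by rewrite powRDp// powRN powRr1// ltW.
  by field; rewrite !gt_eqF.
rewrite [leRHS]mulrAC; apply: ler_wpM2l => //.
by rewrite mulr_ge0 ?divr_ge0 ?mulr_ge0 ?(ltW E0) ?(ltW ra0).
Qed.

(** The [block_outside] bounds are summable over [j]. *)
Lemma part_outside (P : pred nat) (r : R) n z : 0 < r -> N z = r -> (forall j, P j -> ~ inside j r) ->
  N (psum (part P) n z) <= c0 / 4 * (expR r / r `^ a).
Proof.
move=> r_gt0 zr out.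
have X0 : 0 <= expR r / r `^ a by rewrite divr_ge0 ?expR_ge0 ?powR_ge0.
apply: le_trans (normc_sum _ _ _) _.
apply: le_trans (_ : \sum_(0 <= k < n) \sum_(0 <= j < n | P j) N (b j k) * pw r k <= _).
  apply: ler_sum_nat => k /andP[_ kn]; rewrite normc_term zr -mulrA -/(pw r k).
  rewrite -mulr_suml; apply: ler_wpM2r; first by rewrite pw_ge0// ltW.
  apply: le_trans (normc_sum _ _ _) _.
  rewrite big_mkcond [leRHS]big_mkcond [leRHS](big_cat_nat (leq0n _) kn) /= lerDl.
  by apply: sumr_ge0 => j _; case: ifP => // _; exact: normc_ge0.
rewrite exchange_big /=.
apply: le_trans (_ : \sum_(0 <= j < n) (c0 / 8) / 2 ^+ j * (expR r / r `^ a) <= _).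
  rewrite big_mkcond; apply: ler_sum => j _; case: ifP => Pj.
    by apply: block_outside => //; exact: out.
  by rewrite mulr_ge0// !divr_ge0 ?exprn_ge0// ltW.
rewrite -mulr_suml; apply: ler_wpM2r => //.
apply: le_trans (geometric_tail_le _ _ _) _; first by rewrite divr_ge0// ltW.
by rewrite expr0; lra.
Qed.

Lemma psum_block j n z : (4 * ns j <= n)%N -> psum (b j) n z = psum (b j) (4 * ns j) z.
Proof.
move=> nn; rewrite /psum (big_cat_nat (leq0n _) nn) /= [X in _ + X]big1_seq ?addr0//.
move=> k; rewrite mem_index_iota => /andP[_ /andP[k1 _]].
by rewrite b_zero ?mul0r// negb_and -!ltnNge ltnS k1 orbT.
Qed.

Variable f : C -> C.
Hypothesis fa : expands f coefs.

Lemma coefs_split j n z : psum coefs n z = psum (part (predC1 j)) n z + psum (b j) n z.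
Proof.
rewrite /psum -big_split /=; apply: eq_bigr => k _; rewrite -!mulrDl; congr (_ / _ * _).
rewrite /coefs /part; have [jk|kj] := leqP j k.
  rewrite (bigD1_seq j) ?mem_index_iota ?ltnS ?jk ?iota_uniq//= addrC; congr (_ + _).
rewrite b_zero; last by rewrite negb_and -ltnNge (ltn_trans kj (ns_gt j)).
rewrite addr0 [RHS]big_mkcond /=; apply: eq_big_nat => i /andP[_ ik].
by rewrite ifT// neq_ltn (leq_trans ik kj).
Qed.

(** At most one block has [r] in its range of radii; it takes its share of the allowed
    growth and the others together not more. *)
Lemma assembled_growth (r : R) : 0 < r -> r0 <= r ->
  (M p f r <= (Psi r * (expR r / r `^ a))%:E)%E.
Proof.
move=> r_gt0 rr; have cP := Psi_ge r_gt0 rr.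
have X0 : 0 <= expR r / r `^ a by rewrite divr_ge0 ?expR_ge0 ?powR_ge0.
have al : c0 / 4 * (expR r / r `^ a) <= allowed r.
  by rewrite /allowed ler_wpM2r//; lra.
have al0 : 0 <= allowed r by apply: le_trans al; have h0 := c0_gt0; apply: mulr_ge0 => //; lra.
have fc z : ccont_at f z by have H := expands_cont (part_rapid predT) fa z; exact: H.
have al4 : 4 * allowed r = Psi r * (expR r / r `^ a) by rewrite /allowed mulrA; congr (_ * _); field.
have [[j inj]|none] := pselect (exists j, inside j r).
  rewrite -al4; apply: (@M_perturb _ _ _ _ f (psum (b j) (4 * ns j))) => //; first exact: ltW.
  - exact: psum_cont.
  - by case: inj => i1 i2; exact: (block_growth (b_block j)).
  move=> z zr; apply: le_trans al; apply/ler_addgt0Pl => e e0.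
  have [m Hm] := fa z e0; have := Hm (maxn m (4 * ns j)) (leq_maxl _ _).
  rewrite (coefs_split j) (psum_block _ (leq_maxr _ _)).
  set u := psum (part _) _ _; set v := psum (b j) _ _ => h.
  have hu : N u <= c0 / 4 * (expR r / r `^ a).
    apply: part_outside => // i /= ij [i1 i2]; case: inj => j1 j2.
    have [lt|gt|eq] := ltngtP i j; last by rewrite eq eqxx in ij.
      have : 17 * (ns i)%:R < (ns j)%:R :> R by rewrite -natrM ltr_nat; exact: ns_homo.
      lra.
    have : 17 * (ns j)%:R < (ns i)%:R :> R by rewrite -natrM ltr_nat; exact: ns_homo.
    lra.
  have -> : f z - v = (f z - (u + v)) + u by ring.
  by apply: le_trans (normcD _ _) _; exact: lerD.
apply: M_le_sup => //; [exact: ltW|by rewrite -al4 mulr_ge0|].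
move=> z zr; apply: le_trans (_ : allowed r <= _); last by rewrite -al4; lra.
apply: le_trans al; apply/ler_addgt0Pl => e e0.
have [m Hm] := fa z e0; have := Hm m (leqnn _).
have hu : N (psum coefs m z) <= c0 / 4 * (expR r / r `^ a).
  by apply: part_outside => // j _ inj; apply: none; exists j.
move=> h; have -> : f z = (f z - psum coefs m z) + psum coefs m z by rewrite subrK.
by apply: le_trans (normcD _ _) _; exact: lerD.
Qed.

Lemma coefs_in_block j k : (ns j <= k)%N -> (k < ns j.+1)%N -> coefs k = b j k.
Proof.
move=> jk kj; rewrite /coefs /part (bigD1_seq j) ?mem_index_iota ?iota_uniq//=; last first.
  by rewrite ltnS; apply: leq_trans (ltnW (ns_gt j)) jk.
rewrite big1_seq ?addr0// => i /andP[ij _]; apply: b_zero; rewrite negb_and -!ltnNge ltnS.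
have [lt|gt|eq] := ltngtP i j; last by rewrite eq eqxx in ij.
  apply/orP; right; apply: leq_trans jk; apply: leq_trans (ltnW (ns_homo lt)).
  by rewrite leq_mul2r orbT.
apply/orP; left; apply: leq_trans kj _; move: gt; rewrite leq_eqVlt => /predU1P[<-//|gt].
by apply: leq_trans (ltnW (ns_homo gt)); rewrite leq_pmull.
Qed.

(** Close to the target the later blocks contribute little, since they begin far beyond
    index [k] and [psum] divides by factorials; the earlier blocks have been shifted
    away. *)
Lemma assembled_close j k z : let t := stage_target j in
  (ns j <= k < 4 * ns j)%N -> N z <= t.2%:R ->
  N (psum (fun i => b j (k + i)%N) (4 * ns j) z - tpoly t z) <= t.2.+1%:R^-1 ->
  N (iter k D f z - tpoly t z) <= 2 * t.2.+1%:R^-1.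
Proof.
move=> t /andP[jk kj] zt close; have ra := part_rapid predT.
apply/ler_addgt0Pl => e e0.
have [m Hm] := expands_iterD k ra fa z e0.
pose l := (ns j.+1 - 4 * ns j)%N.
pose n := maxn m (maxn (4 * ns j) l).
have mn : (m <= n)%N by exact: leq_maxl.
have jn : (4 * ns j <= n)%N by rewrite /n maxnCA leq_maxl.
have ln : (l <= n)%N by rewrite /n maxnA leq_maxr.
have {}Hm := Hm n mn.
have pE : psum (fun i => b j (k + i)%N) n z = psum (fun i => b j (k + i)%N) (4 * ns j) z.
  rewrite /psum (big_cat_nat (leq0n _) jn) /= [X in _ + X]big1_seq ?addr0//.
  move=> i; rewrite mem_index_iota => /andP[_ /andP[i1 _]].
  by rewrite b_zero ?mul0r// negb_and -!ltnNge !ltnS (leq_trans i1 (leq_addl _ _)) orbT.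
have k4 : (k <= 4 * ns j)%N by exact: ltnW.
have lk : (4 * ns j <= ns j.+1)%N.
  by apply: leq_trans (ltnW (ns_lt j)); rewrite leq_mul2r orbT.
have tail : N (psum (fun i => coefs (k + i)%N) n z - psum (fun i => b j (k + i)%N) n z) <= t.2.+1%:R^-1.
  rewrite /psum -sumrB; apply: le_trans (normc_sum _ _ _) _.
  rewrite (big_cat_nat (leq0n _) ln) /= [X in X + _]big1_seq ?add0r; last first.
    move=> i; rewrite mem_index_iota => /andP[_ /andP[_ il]].
    rewrite (@coefs_in_block j) ?subrr ?Normc.normc0//; first by rewrite (leq_trans jk (leq_addr _ _)).
    apply: leq_ltn_trans (leq_add k4 (leqnn i)) _.
    by rewrite -ltn_subRL.
  have [_ _ _ _ small] := nsS j; apply: le_trans (small n ln).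
  rewrite mulr_sumr big_nat_cond [leRHS]big_nat_cond; apply: ler_sum => i /andP[/andP[li _] _].
  rewrite [b j (k + i)%N]b_zero; last first.
    rewrite negb_and -!ltnNge !ltnS; apply/orP; right.
    exact: far_index (ns_lt j) jk li.
  rewrite mul0r mul0r subr0 (normc_term (fun i => coefs (k + i)%N)) /= -/t /pw exprMn.
  have -> : (4 * (ns j)%:R + 1) ^+ 2 * (4 ^+ i * t.2%:R ^+ i / i`!%:R) =
    (4 * (ns j)%:R + 1) ^+ 2 * 4 ^+ i * t.2%:R ^+ i / i`!%:R :> R by ring.
  apply: ler_wpM2r; first by rewrite invr_ge0.
  apply: ler_pM; rewrite ?normc_ge0 ?exprn_ge0 ?normc_ge0//; last first.
    by rewrite lerXn2r ?nnegrE ?normc_ge0.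
  apply: le_trans (part_le _ _) _.
  apply: le_trans (_ : (4 * (ns j)%:R + 1) ^+ 2 * (i%:R + 1) ^+ 2 <= _); last first.
    by apply: ler_wpM2l; [rewrite exprn_ge0// addr_ge0// mulr_ge0|exact: pow4].
  rewrite -exprMn lerXn2r ?nnegrE ?mulr_ge0 ?addr_ge0 ?mulr_ge0//.
  have k4R : k%:R <= 4 * (ns j)%:R :> R by rewrite -natrM ler_nat.
  have i0 : 0 <= i%:R :> R by [].
  have -> : (k + i)%:R = k%:R + i%:R :> R by rewrite natrD.
  by move: (k%:R : R) (i%:R : R) ((ns j)%:R : R) (ler0n R (ns j)) k4R i0 => x y w w0 xw y0; nra.
rewrite -pE in close.
set u := psum _ n z in Hm tail; set v := psum _ n z in close tail.
have -> : iter k D f z - tpoly t z = (iter k D f z - u) + ((u - v) + (v - tpoly t z)) by ring.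
apply: le_trans (normcD _ _) _; apply: lerD => //.
apply: le_trans (normcD _ _) _; rewrite mulrDl mul1r; exact: lerD.
Qed.

End Construction.

Lemma approx_target (g : C -> C) c (rho e : R) : rapid c -> expands g c -> 0 < e ->
  exists t : target, [/\ rho <= t.2%:R, t.2.+1%:R^-1 <= e &
    forall z, N z <= t.2%:R -> N (g z - tpoly t z) <= e].
Proof.
move=> rc gc e0.
have [m1 H1] := eventually_ge rho; have [m2 H2] := eventually_ge e^-1.
pose nu := maxn m1 m2.
have nu0 : 0 <= nu%:R :> R by [].
have e2 : 0 < e / 2 by rewrite divr_gt0.
have [n _ Hn] := uniform_psum rc gc 0%N nu0 e2.
pose d := e / 2 / expR nu%:R.
have d0 : 0 < d by rewrite divr_gt0// expR_gt0.
have /choice[q Hq] : forall k, exists q : rat * rat, N (c k - (ratr q.1 +i* ratr q.2)%C) <= d.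
  move=> k.
  have near x : exists y : rat, `|x - ratr y| <= d / 2.
    have [|y] := @rat_in_itvoo R (x - d / 2) (x + d / 2); first lra.
    by rewrite in_itv /= => /andP[y1 y2]; exists y; rewrite ler_norml; apply/andP; split; lra.
  have [x hx] := near (Re (c k)); have [y hy] := near (Im (c k)).
  exists (x, y); apply: le_trans (normc_le_ReIm _) _; rewrite cReB cImB /=; lra.
exists ((mkseq q n, nu) : target); split => /=.
- by apply: H1; exact: leq_maxl.
- rewrite -[leRHS]invrK lef_pV2 ?posrE ?invr_gt0 ?ltr0Sn//.
  by apply: H2; rewrite leqW// leq_maxr.
move=> z zn; set t : target := (mkseq q n, nu).
have -> : g z - tpoly t z = (g z - psum c n z) + (psum c n z - tpoly t z) by ring.
apply: le_trans (normcD _ _) _; rewrite [leRHS](splitr e); apply: lerD; first exact: Hn.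
rewrite /tpoly /= size_mkseq /psum -sumrB; apply: le_trans (normc_sum _ _ _) _.
apply: le_trans (_ : \sum_(0 <= k < n) d * pw nu%:R k <= _).
  apply: ler_sum_nat => k /andP[_ kn].
  rewrite -!mulrBl (normc_term (fun k => c k - tcoef t k)) -mulrA.
  apply: ler_pM; rewrite ?normc_ge0 ?divr_ge0 ?exprn_ge0 ?normc_ge0//.
    by rewrite /tcoef /= nth_mkseq//; exact: Hq.
  by rewrite /pw ler_wpM2r ?invr_ge0// lerXn2r ?nnegrE ?normc_ge0.
rewrite -mulr_sumr; apply: le_trans (_ : d * expR nu%:R <= _).
  by apply: ler_wpM2l; [exact: ltW|exact: sum_pw_le].
by rewrite /d divfK// lt0r_neq0// expR_gt0.
Qed.

Hypothesis beta_ge1 : forall n, 1 <= beta n.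

Hypothesis blocks : forall t, exists K delta n0, [/\ 0 <= K, 0 < delta &
  forall n, (n0 <= n)%N -> exists b, block t K delta n b].

Lemma mass_in_sub (E G : set nat) n : (forall k, (0 < k)%N -> G k -> E k) ->
  mass_in beta G n <= mass_in beta E n.
Proof.
move=> GE; apply: ler_sum_nat => k /andP[k0 _].
apply: ler_wpM2l; first exact: le_trans (beta_ge1 k).
rewrite !indicE ler_nat; case: (asboolP (G k)) => Gk.
  by rewrite !mem_set//; exact: GE.
by rewrite memNset.
Qed.

(** Let stage [j] place a block for [stage_target j] at a scale so large that
    [stage_req] holds. A nonempty open set contains a neighbourhood of a target, and
    each block of the infinitely many stages devoted to it has a proportion [delta] of
    visits. *)
Theorem assembly : exists2 f : C -> C, Ubeta_freq_hypercyclic_D beta f &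
  forall r, 0 < r -> r0 <= r -> (M p f r <= (Psi r * (expR r / r `^ a))%:E)%E.
Proof.
have [K /choice[delta /choice[n0 H]]] := choice blocks.
have K_ge0 t : 0 <= K t by have [] := H t.
have delta_gt0 t : 0 < delta t by have [] := H t.
have /choice[F HF] : forall jn : nat * nat, exists m, stage_req K n0 jn.1 jn.2 m.
  by move=> jn; exact: stage_req_ex.
pose ns := fix ns j := if j is j'.+1 then F (j, ns j') else F (0%N, 0%N).
have ns0 : stage_req K n0 0 0 (ns 0%N) by exact: HF (0%N, 0%N).
have nsS j : stage_req K n0 j.+1 (ns j) (ns j.+1) by exact: HF (j.+1, ns j).
have /choice[b b_block] : forall j, exists b, block (stage_target j) (K (stage_target j))
    (delta (stage_target j)) (ns j) b.
  move=> j; have [_ _ h] := H (stage_target j); apply: h.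
  by case: j => [|j]; [case: ns0|case: (nsS j)].
have rf : rapid (part b predT) by exact: (part_rapid ns0 nsS b_block).
have [f fa] := exists_expands rf.
have ns_gt j : (j < ns j)%N.
  elim: j => [|j IH]; first by have [_ h _ _ _] := ns0; rewrite muln0 in h.
  have [_ h _ _ _] := nsS j; apply: leq_ltn_trans h; apply: leq_trans IH _.
  by rewrite leq_pmull.
exists f; last by move=> r r_gt0 rr; exact: (assembled_growth K_ge0 ns0 nsS b_block fa).
split; first exact: expands_entire rf fa.
move=> U oU [g [Ug eg]].
have [c rc gc] := entire_expands eg.
have [rho [e e0 He]] := open_contains_uniform_disc (expands_cont rc gc) oU Ug.
have e3 : 0 < e / 3 by rewrite divr_gt0.
have [t [rt te tg]] := approx_target rho rc gc e3.
apply: lt_le_trans (_ : (delta t)%:E <= _)%E; first by rewrite lte_fin.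
apply: upper_density_ge => m.
have [j mj jt] := stage_target_recurs t m.
have [G [n' [n1 Gj Gd Gc]]] := block_dense (b_block j); rewrite jt in Gd Gc.
exists n'; first by apply: leq_trans mj (leq_trans (ltnW (ns_gt j)) n1).
have mass_gt0 : 0 < mass beta n'.
  apply: lt_le_trans (mass_ge beta_ge1 n'); rewrite ltr0n.
  by apply: leq_trans n1; apply: leq_ltn_trans (ns_gt j).
rewrite (ler_pdivlMr _ _ mass_gt0); apply: le_trans Gd _; apply: mass_in_sub => k k0 Gk.
split; first exact: k0.
split; last exact: entire_iterD rf fa.
apply: He => z zr; have zt : N z <= t.2%:R by exact: le_trans zr rt.
have close : N (iter k D f z - tpoly t z) <= 2 * t.2.+1%:R^-1.
  have h := assembled_close ns0 nsS b_block fa (Gj k Gk); rewrite jt in h.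
  exact: h zt (Gc k Gk z zt).
have -> : iter k D f z - g z = (iter k D f z - tpoly t z) - (g z - tpoly t z).
  by rewrite opprB addrA subrK.
apply: le_trans (normcD _ _) _; rewrite normcN; move: close (tg z zt) te => h1 h2 h3.
apply: le_trans (lerD h1 h2) _; move: (t.2.+1%:R^-1 : R) h3 => x h3; lra.
Qed.

End Assembly.

(** * Periodic patterns *)

Section Patterns.
Context {R : realType}.
Local Notation C := R[i].

Lemma sum_blocks (V : nmodType) (F : nat -> V) s M :
  \sum_(0 <= k < s * M) F k = \sum_(0 <= m < M) \sum_(0 <= i < s) F (s * m + i)%N.
Proof.
elim: M => [|M IH]; first by rewrite muln0 !big_geq.
rewrite (big_cat_nat (leq0n _) (_ : s * M <= s * M.+1)%N) /=; last by rewrite leq_mul2l leqnSn orbT.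
rewrite IH [RHS]big_nat_recr//; congr (_ + _).
rewrite -{1}[(s * M)%N]add0n big_addn mulnS addnK; apply: eq_bigr => i _.
by rewrite addnC.
Qed.

(** The coefficients [q 0, ..., q (s - 1)], weighted by [e m], on the [m]-th of [M]
    consecutive stretches of length [s] starting at [n]. *)
Definition pattern (q e : nat -> C) s M n k : C :=
  if (n <= k < n + s * M)%N then e ((k - n) %/ s)%N * q ((k - n) %% s)%N else 0.

Lemma block_index_lt s m i M : (i < s)%N -> (m < M)%N -> (s * m + i < s * M)%N.
Proof.
move=> si mM; apply: (@leq_trans (s * m.+1)); last by rewrite leq_mul2l mM orbT.
by rewrite mulnS addnC ltn_add2r.
Qed.

Lemma pattern_at q e s M n m i : (m < M)%N -> (i < s)%N ->
  pattern q e s M n (n + (s * m + i)) = e m * q i.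
Proof.
move=> mM si; have s0 : (0 < s)%N by exact: leq_ltn_trans si.
rewrite /pattern leq_addr ltn_add2l block_index_lt// addKn mulnC.
by rewrite divnMDl// modnMDl divn_small// addn0 modn_small.
Qed.

Variables (q e : nat -> C) (s M n : nat) (Kq : R).
Hypotheses (s0 : (0 < s)%N) (sMn : (s * M <= n)%N) (n0 : (0 < n)%N).
Hypotheses (qK : forall i, N (q i) <= Kq) (e1 : forall m, N (e m) <= 1).

Let b := pattern q e s M n.

Let sM4 : (n + s * M <= 4 * n)%N.
Proof.
apply: (@leq_trans (2 * n)); last by rewrite leq_mul2r orbT.
by rewrite mul2n -addnn leq_add2l.
Qed.

Lemma pattern_supp k : b k != 0 -> (n <= k < 4 * n)%N.
Proof.
rewrite /b /pattern; case: ifP => [/andP[nk kM] _|_]; last by rewrite eqxx.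
by rewrite nk (leq_trans kM sM4).
Qed.

Lemma pattern_bound k : N (b k) <= Kq.
Proof.
rewrite /b /pattern; case: ifP => _; last first.
  by rewrite Normc.normc0; exact: le_trans (normc_ge0 _) (qK 0).
by rewrite Normc.normcM -[leRHS]mul1r ler_pM ?normc_ge0.
Qed.

Lemma psum_pattern z : psum b (4 * n) z = \sum_(0 <= i < s) q i *
  \sum_(0 <= m < M) e m * (z ^+ (n + (s * m + i)) / (n + (s * m + i))`!%:R).
Proof.
pose G k := b k / k`!%:R * z ^+ k.
have nM : (n <= n + s * M)%N by exact: leq_addr.
rewrite /psum -/G (big_cat_nat (leq0n _) sM4) /= (big_cat_nat (leq0n _) nM) /=.
rewrite [X in X + _ + _]big1_seq ?add0r; last first.
  by move=> k; rewrite mem_index_iota => /andP[_ /andP[_ kn]]; rewrite /b /pattern leqNgt kn !mul0r.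
rewrite [X in _ + X]big1_seq ?addr0; last first.
  move=> k; rewrite mem_index_iota => /andP[_ /andP[nk _]].
  by rewrite /b /pattern [(k < _)%N]ltnNge nk andbF !mul0r.
rewrite -{1}[n]add0n big_addn addKn.
rewrite (sum_blocks (fun k => G (k + n)%N)).
under [RHS]eq_bigr do rewrite mulr_sumr.
rewrite [RHS]exchange_big /=; apply: eq_big_nat => m /andP[_ mM]; apply: eq_big_nat => i /andP[_ si].
rewrite /G addnC /b pattern_at//.
by rewrite mulrCA -!mulrA; congr (_ * (_ * _)); rewrite mulrC.
Qed.

(** A shift to the beginning of a stretch with weight 1 begins with [q]; what comes
    later is divided by large factorials. *)
Lemma pattern_close nu eps m z : (s <= 4 * n)%N -> (m < M)%N -> e m = 1 -> N z <= nu ->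
  (forall l, (s <= l)%N -> Kq * \sum_(s <= i < l) pw nu i <= eps) ->
  N (psum (fun i => b (n + s * m + i)%N) (4 * n) z - psum q s z) <= eps.
Proof.
move=> s4 mM em zn tail; have nu0 : 0 <= nu by exact: le_trans (normc_ge0 z) zn.
rewrite /psum (big_cat_nat (leq0n _) s4) /=.
rewrite [X in X + _ - _](_ : _ = \sum_(0 <= k < s) q k / k`!%:R * z ^+ k); last first.
  apply: eq_big_nat => i /andP[_ si].
  by rewrite -addnA /b pattern_at// em mul1r.
rewrite addrAC subrr add0r; apply: le_trans (normc_sum _ _ _) _.
apply: le_trans (tail _ s4); rewrite mulr_sumr; apply: ler_sum => i _.
rewrite (normc_term (fun i => b (n + s * m + i)%N)) -mulrA.
apply: ler_pM; rewrite ?normc_ge0 ?divr_ge0 ?exprn_ge0 ?normc_ge0 ?pattern_bound//.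
by rewrite /pw ler_wpM2r ?invr_ge0// lerXn2r ?nnegrE ?normc_ge0.
Qed.

End Patterns.

Section PatternDensity.
Context {R : realType}.
Local Notation C := R[i].

(** Over a window of length comparable to [n `^ (1 - g)] the weights [beta_gamma g] are
    comparable to each other, and their sum over the window to the total mass: a set
    with that many elements in the window has positive density. *)
Lemma window_density (g W c : R) : 0 <= g <= 1 -> 0 < c -> exists2 delta : R, 0 < delta &
  forall s M n (G : set nat) (good : pred nat), (0 < n)%N -> (0 < s)%N -> (s * M <= n)%N ->
    (s * M)%:R <= W * n%:R `^ (1 - g) ->
    (forall m, (m < M)%N -> good m -> G (n + s * m)%N) ->
    c * n%:R `^ (1 - g) <= \sum_(0 <= m < M) (good m)%:R ->
    delta * mass (beta_gamma g) (n + s * M) <= mass_in (beta_gamma g) G (n + s * M).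
Proof.
move=> g01 c0; have [K K0 HK] := mass_beta_gamma_le g01.
exists (c / (2 * K * expR (2 * W))); first by rewrite divr_gt0// !mulr_gt0// expR_gt0.
move=> s M n G good n0 s0 sMn sMW GG cnt.
set B := beta_gamma g (n + s * M).
have B1 : 1 <= B by exact: beta_gamma_ge1.
have P0 : 0 < n%:R `^ (1 - g) :> R by rewrite powR_gt0 ?ltr0n.
have W0 : 0 <= W by rewrite -(pmulr_lge0 _ P0); apply: le_trans sMW.
have g10 : 0 <= 1 - g by rewrite subr_ge0; case/andP: g01.
have n'2 : (n + s * M <= 2 * n)%N by rewrite mul2n -addnn leq_add2l.
have mono (x y : nat) : (x <= y)%N -> x%:R `^ (1 - g) <= y%:R `^ (1 - g) :> R.
  by move=> xy; apply: ge0_ler_powR; rewrite ?nnegrE ?ler_nat.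
have E0 : 0 < expR (2 * W) by exact: expR_gt0.
have near m : (m < M)%N -> B / expR (2 * W) <= beta_gamma g (n + s * m).
  move=> mM; rewrite ler_pdivrMr// mulrC; apply: beta_gamma_comparable => //.
  - by rewrite addn_gt0 n0.
  - by rewrite leq_add2l leq_mul2l (ltnW mM) orbT.
  - by apply: leq_trans n'2 _; rewrite leq_mul2l leq_addr orbT.
  apply: le_trans (_ : (s * M)%:R <= _); first by rewrite ler_nat subnDl leq_subr.
  by apply: le_trans sMW _; apply: ler_wpM2l => //; apply: mono; exact: leq_addr.
have total : mass (beta_gamma g) (n + s * M) <= 2 * K * n%:R `^ (1 - g) * B.
  apply: le_trans (HK _ _) _; first by rewrite addn_gt0 n0.
  apply: ler_wpM2r; first exact: le_trans ler01 B1.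
  rewrite [2 * K]mulrC -mulrA; apply: ler_wpM2l; first exact: ltW.
  apply: le_trans (mono _ _ n'2) _; rewrite natrM powRM// ler_wpM2r ?powR_ge0//.
  by rewrite -[leRHS]powRr1// ler_powR ?ler1n// gerBl; case/andP: g01.
have inside : \sum_(0 <= m < M) (good m)%:R * (B / expR (2 * W)) <= mass_in (beta_gamma g) G (n + s * M).
  pose F k := beta_gamma g k * \1_G k.
  have F0 k : 0 <= F k.
    apply: mulr_ge0; first exact: le_trans ler01 (beta_gamma_ge1 g k).
    by rewrite indicE.
  have nM : (n <= (n + s * M).+1)%N by rewrite leqW// leq_addr.
  rewrite /mass_in -/F (big_cat_nat n0 nM) /=.
  apply: le_trans (_ : \sum_(n <= i < (n + s * M).+1) F i <= _); last first.
    by rewrite lerDr; apply: sumr_ge0 => k _; exact: F0.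
  rewrite big_nat_recr ?leq_addr//=; apply: le_trans (_ : \sum_(n <= i < n + s * M) F i <= _); last first.
    by rewrite lerDl; exact: F0.
  rewrite -{1}[n]add0n big_addn addKn (sum_blocks (fun k => F (k + n)%N)).
  apply: ler_sum_nat => m /andP[_ mM].
  rewrite (big_cat_nat (leq0n _) s0) /= big_nat1 addn0 addnC.
  apply: le_trans (_ : F (n + s * m)%N <= _); last by rewrite lerDl; apply: sumr_ge0 => i _; exact: F0.
  case gm: (good m); last by rewrite mul0r; exact: F0.
  rewrite mul1r /F indicE (mem_set (GG m mM gm)).
  apply: le_trans (near m mM) _; by rewrite [leRHS]mulr1.
apply: le_trans inside; rewrite -mulr_suml.
apply: le_trans (ler_wpM2l _ total) _; first by rewrite divr_ge0 ?mulr_ge0 ?(ltW c0) ?(ltW K0) ?(ltW E0).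
have -> : c / (2 * K * expR (2 * W)) * (2 * K * n%:R `^ (1 - g) * B) =
  c * n%:R `^ (1 - g) * (B / expR (2 * W)).
  by field; rewrite !lt0r_neq0.
by apply: ler_wpM2r => //; rewrite divr_ge0 ?(ltW E0)// (le_trans ler01 B1).
Qed.

End PatternDensity.

(** * Blocks with Rudin-Shapiro signs *)

Section PoissonSums.
Context {R : realType}.
Local Notation C := R[i].

Lemma sum_by_parts (S w : nat -> C) n :
  \sum_(0 <= k < n) (S k.+1 - S k) * w k =
  S n * w n - S 0%N * w 0%N - \sum_(0 <= k < n) S k.+1 * (w k.+1 - w k).
Proof.
elim: n => [|n IH]; first by rewrite !big_geq// subrr subr0.
by rewrite !big_nat_recr//= IH; ring.
Qed.

Lemma pw_deviation_small (r : R) L : 0 < r ->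
  exists2 n, (L <= n)%N & pw r n * (2 + `|n%:R - r|) <= 1.
Proof.
move=> r0; have e0 : 0 < (2 + 2 * r)^-1 by rewrite invr_gt0; lra.
have [l Hl] := exp_tail (ltW r0) e0.
have small k : (l <= k)%N -> pw r k <= (2 + 2 * r)^-1.
  by move=> lk; apply: le_trans _ (Hl l (leqnn l) k.+1 (leqW lk)); rewrite big_nat_recr//= lerDr; apply: sumr_ge0 => i _; exact: pw_ge0 (ltW r0).
exists (maxn L l).+1; first by rewrite leqW// leq_maxl.
set n := maxn L l; have ln : (l <= n)%N by exact: leq_maxr.
have E : pw r n.+1 * `|n.+1%:R - r| = r * `|pw r n.+1 - pw r n|.
  rewrite pw_step// normrM normrM [`|pw _ _|]ger0_norm ?pw_ge0 ?(ltW r0)//.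
  rewrite [`|r^-1|]ger0_norm ?invr_ge0 ?(ltW r0)// [`|r - _|]distrC.
  by field; rewrite lt0r_neq0.
have h1 := small n.+1 (leqW ln); have h2 := small n ln.
have p1 := pw_ge0 n.+1 (ltW r0); have p2 := pw_ge0 n (ltW r0).
have d : `|pw r n.+1 - pw r n| <= 2 * (2 + 2 * r)^-1 by rewrite ler_norml; apply/andP; split; lra.
rewrite mulrDr E; have := ler_wpM2l (ltW r0) d.
have : (2 + 2 * r) * (2 + 2 * r)^-1 = 1 by rewrite mulfV// lt0r_neq0//; lra.
move: (2 + 2 * r)^-1 h1 h2 {Hl small d e0 E} => v h1 h2 vE.
by move=> h; lra.
Qed.

(** Summation by parts: the increments of the Poisson weights have total variation of
    order [e ^ r / sqrt r], most of it within [sqrt r] of [r]. The constant is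
    [1 + 2 + 3], for the two boundary terms and the remaining sum. *)
Lemma poisson_abel (A : nat -> C) L (r Lam : R) : 1 <= r -> 0 <= Lam ->
  (forall k1 k2, (k1 <= k2)%N -> N (A k2 - A k1) <= Lam * (1 + (k2 - k1)%:R / Num.sqrt r)) ->
  (forall k, (L <= k)%N -> A k = A L) ->
  N (\sum_(0 <= k < L) (A k.+1 - A k) * ((pw r k)%:C)%C) <= 6 * Lam * (expR r / Num.sqrt r).
Proof.
move=> r1 L0 HA AL; have r0 : 0 < r by lra.
have q1 : 1 <= Num.sqrt r by rewrite -sqrtr1 ler_wsqrtr.
have q0 : 0 < Num.sqrt r by lra.
have qq : Num.sqrt r * Num.sqrt r = r by rewrite -expr2 sqr_sqrtr// ltW.
(* the partial sums are counted from the centre of the Poisson weights, where their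
   bound is best *)
pose K0 := Num.trunc r.
have /andP[K1 K2] : K0%:R <= r < K0.+1%:R by apply: truncn_itv; exact: ltW.
rewrite -natr1 in K2.
pose S k := A k - A K0.
have SB k : N (S k) <= Lam * (2 + `|k%:R - r| / Num.sqrt r).
  have dist m1 m2 : (m1 <= m2)%N -> `|m2%:R - m1%:R| <= `|k%:R - r| + 1 ->
      Lam * (1 + (m2 - m1)%:R / Num.sqrt r) <= Lam * (2 + `|k%:R - r| / Num.sqrt r).
    move=> mm; rewrite -natrB// normr_nat => h; apply: ler_wpM2l => //.
    have -> : 2 + `|k%:R - r| / Num.sqrt r = 1 + (`|k%:R - r| + Num.sqrt r) / Num.sqrt r.
      by field; rewrite lt0r_neq0.
    rewrite lerD2l ler_wpM2r ?invr_ge0 ?(ltW q0)//; lra.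
  have close : `|k%:R - K0%:R| <= `|k%:R - r| + 1.
    have -> : k%:R - K0%:R = (k%:R - r) + (r - K0%:R) :> R by ring.
    by apply: le_trans (ler_normD _ _) _; rewrite lerD2l ger0_norm; lra.
  have [kK|Kk] := leqP k K0.
    by rewrite -normcN opprB; apply: le_trans (HA _ _ kK) _; apply: dist => //; rewrite distrC.
  by apply: le_trans (HA _ _ (ltnW Kk)) _; apply: dist => //; exact: ltnW.
(* the sum may be continued up to an index [n] where the boundary term of the summation
   by parts is negligible *)
have [n Ln small] := pw_deviation_small L r0.
have -> : \sum_(0 <= k < L) (A k.+1 - A k) * ((pw r k)%:C)%C = \sum_(0 <= k < n) (S k.+1 - S k) * ((pw r k)%:C)%C.
  rewrite [RHS](big_cat_nat (leq0n _) Ln) /= [X in _ = _ + X]big1_seq ?addr0.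
    by apply: eq_bigr => k _; rewrite /S opprB addrA subrK.
  move=> k; rewrite mem_index_iota => /andP[_ /andP[Lk _]].
  by rewrite /S (AL k.+1 (leqW Lk)) (AL k Lk) subrr mul0r.
rewrite (sum_by_parts S (fun k => ((pw r k)%:C)%C)).
set E := expR r / Num.sqrt r.
have E1 : 1 + r <= expR r by exact: expR_ge1Dx.
have T1 : N (S n * ((pw r n)%:C)%C) <= Lam * E.
  rewrite Normc.normcM normc_real ger0_norm ?pw_ge0 ?(ltW r0)//.
  apply: le_trans (ler_wpM2r (pw_ge0 n (ltW r0)) (SB n)) _; rewrite -mulrA; apply: ler_wpM2l => //.
  apply: le_trans (_ : 1 <= _); last first.
    by rewrite /E ler_pdivlMr// mul1r; nra.
  apply: le_trans small; rewrite mulrC; apply: ler_wpM2l; first exact: pw_ge0 (ltW r0).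
  by rewrite lerD2l ler_piMr// invf_le1.
have T2 : N (S 0%N * ((pw r 0)%:C)%C) <= 2 * Lam * E.
  rewrite Normc.normcM normc_real /pw expr0 fact0 divr1 normr1 mulr1.
  apply: le_trans (SB 0%N) _; rewrite [2 * Lam]mulrC -mulrA; apply: ler_wpM2l => //.
  rewrite sub0r normrN ger0_norm ?(ltW r0)// /E mulrA ler_pdivlMr// mulrDl divfK ?lt0r_neq0//.
  nra.
have T3 : N (\sum_(0 <= k < n) S k.+1 * (((pw r k.+1)%:C)%C - ((pw r k)%:C)%C)) <= 3 * Lam * E.
  apply: le_trans (normc_sum _ _ _) _.
  apply: le_trans (_ : \sum_(0 <= k < n) (Lam * (2 / r) * (pw r k.+1 * `|k.+1%:R - r|) +
     Lam / (r * Num.sqrt r) * (pw r k.+1 * (k.+1%:R - r) ^+ 2)) <= _).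
    apply: ler_sum => k _; rewrite Normc.normcM -rmorphB normc_real.
    rewrite pw_step// normrM normrM [`|pw _ _|]ger0_norm ?pw_ge0 ?(ltW r0)//.
    rewrite [`|r^-1|]ger0_norm ?invr_ge0 ?(ltW r0)// [`|r - _|]distrC.
    have w0 : 0 <= pw r k.+1 * `|k.+1%:R - r| / r.
      by apply: divr_ge0; [apply: mulr_ge0 => //; exact: pw_ge0 (ltW r0)|exact: ltW].
    apply: le_trans (ler_wpM2r w0 (SB k.+1)) _.
    rewrite -[(_ - r) ^+ 2]real_normK ?num_real// le_eqVlt; apply/orP; left; apply/eqP.
    by field; rewrite !lt0r_neq0.
  rewrite big_split /= -!mulr_sumr.
  have shift (F : nat -> R) : (forall k, 0 <= F k) -> \sum_(0 <= k < n) F k.+1 <= \sum_(0 <= k < n.+1) F k.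
    by move=> F0; rewrite [leRHS]big_nat_recl//= lerDr.
  have d1 : \sum_(0 <= k < n) pw r k.+1 * `|k.+1%:R - r| <= Num.sqrt r * expR r.
    apply: le_trans (shift (fun k => pw r k * `|k%:R - r|) _) _; last exact: poisson_deviation.
    by move=> k; rewrite mulr_ge0// pw_ge0// ltW.
  have d2 : \sum_(0 <= k < n) pw r k.+1 * (k.+1%:R - r) ^+ 2 <= r * expR r.
    apply: le_trans (shift (fun k => pw r k * (k%:R - r) ^+ 2) _) _; last exact: poisson_variance (ltW r0).
    by move=> k; rewrite mulr_ge0 ?sqr_ge0// pw_ge0// ltW.
  have c1 : 0 <= Lam * (2 / r) by rewrite !mulr_ge0 ?invr_ge0 ?(ltW r0).
  have c2 : 0 <= Lam / (r * Num.sqrt r) by rewrite mulr_ge0 ?invr_ge0 ?mulr_ge0 ?(ltW r0) ?(ltW q0).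
  apply: le_trans (lerD (ler_wpM2l c1 d1) (ler_wpM2l c2 d2)) _.
  rewrite le_eqVlt; apply/orP; left; apply/eqP.
  rewrite /E -[in 2 / r]qq; field; by rewrite !lt0r_neq0.
apply: le_trans (normcD _ _) _; rewrite normcN; apply: le_trans (lerD (normcD _ _) T3) _.
rewrite normcN; lra.
Qed.

End PoissonSums.

Section Progressions.
Context {R : realType}.
Local Notation C := R[i].

Lemma progression_cut c s M k : exists2 mu, (mu <= M)%N &
  forall m, (m < M)%N -> (c + s * m < k)%N = (m < mu)%N.
Proof.
have ex : exists m, (M <= m)%N || (k <= c + s * m)%N by exists M; rewrite leqnn.
have [mu P mumin] := ex_minnP ex; exists mu; first by apply: mumin; rewrite leqnn.
move=> m mM; apply/idP/idP => [ck|mmu].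
  rewrite ltnNge; apply/negP => mum; case/orP: P => [Mmu|kmu].
    by move: (leq_trans Mmu mum); rewrite leqNgt mM.
  have : (c + s * mu <= c + s * m)%N by rewrite leq_add2l leq_mul2l mum orbT.
  by move/(leq_trans kmu); rewrite leqNgt ck.
rewrite ltnNge; apply/negP => km.
by have := mumin m; rewrite km orbT => /(_ isT); rewrite leqNgt mmu.
Qed.

Lemma leq_sub2l_cut c a b k1 k2 : (k1 <= c + a)%N -> (c + b < k2)%N -> (b - a <= k2 - k1)%N.
Proof. lia. Qed.

Lemma cut_gap c s m1 m2 k1 k2 : (m1 < m2)%N -> (k1 <= c + s * m1)%N -> (c + s * m2.-1 < k2)%N ->
  (s * (m2 - m1) <= (k2 - k1) + s)%N.
Proof.
case: m2 => // m2; rewrite ltnS /= => m12 k1m k2m.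
rewrite subSn// mulnS addnC leq_add2r mulnBr.
by apply: leq_sub2l_cut k1m k2m.
Qed.

Variables (E : nat -> C) (c s M : nat).

(** Summing by [k] instead of [m] turns a progression into increments, the form that
    [poisson_abel] takes. *)
Definition progression_sum k := \sum_(0 <= m < M | (c + s * m < k)%N) E m.

Lemma progression_sum_cut k1 k2 : (k1 <= k2)%N -> exists m1 m2,
  [/\ (m1 <= m2 <= M)%N, (s * (m2 - m1) <= (k2 - k1) + s)%N &
    progression_sum k2 - progression_sum k1 = \sum_(m1 <= m < m2) E m].
Proof.
move=> k12; have [m1 m1M H1] := progression_cut c s M k1.
have [m2 m2M H2] := progression_cut c s M k2.
have sumE k mu : (mu <= M)%N -> (forall m, (m < M)%N -> (c + s * m < k)%N = (m < mu)%N) ->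
    progression_sum k = \sum_(0 <= m < mu) E m.
  move=> muM H; rewrite /progression_sum big_mkcond (big_cat_nat (leq0n _) muM) /=.
  rewrite [X in _ + X]big1_seq ?addr0.
    by apply: eq_big_nat => m /andP[_ mmu]; rewrite H ?mmu//; exact: leq_trans muM.
  by move=> m; rewrite mem_index_iota => /andP[_ /andP[m0 m3]]; rewrite H// ltnNge m0.
have m12 : (m1 <= m2)%N.
  rewrite leqNgt; apply/negP => m21; have m2M' := leq_trans m21 m1M.
  have h : (c + s * m2 < k2)%N by apply: leq_trans k12; rewrite H1.
  by move: h; rewrite H2// ltnn.
exists m1, m2; split; first by rewrite m12 m2M.
  move: m12; rewrite leq_eqVlt => /predU1P[->|m12]; first by rewrite subnn muln0.
  have m1M' := leq_trans m12 m2M.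
  have m2p : (m2.-1 < m2)%N by rewrite prednK// (leq_ltn_trans _ m12).
  apply: (@cut_gap c s m1 m2 k1 k2 m12); last by rewrite H2// (leq_trans m2p).
  by rewrite leqNgt H1// ltnn.
by rewrite (sumE _ _ m2M H2) (sumE _ _ m1M H1) (big_cat_nat (leq0n _) m12) /= addrAC subrr add0r.
Qed.

Lemma progression_sum_weighted (w : nat -> C) L : (c + s * M <= L)%N -> (0 < s)%N ->
  \sum_(0 <= k < L) (progression_sum k.+1 - progression_sum k) * w k =
  \sum_(0 <= m < M) E m * w (c + s * m)%N.
Proof.
move=> ML s0.
transitivity (\sum_(0 <= k < L) \sum_(0 <= m < M | (c + s * m)%N == k) E m * w k).
  apply: eq_bigr => k _; rewrite -mulr_suml; congr (_ * _).
  rewrite /progression_sum [X in X - _]big_mkcond [X in _ - X]big_mkcond -sumrB [RHS]big_mkcond.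
  apply: eq_bigr => m _; rewrite ltnS leq_eqVlt.
  case: eqP => [->|_] /=; first by rewrite ltnn subr0.
  by case: ifP; rewrite subrr.
rewrite (exchange_big_dep predT)//=; apply: eq_big_nat => m /andP[_ mM].
under eq_bigl do rewrite eq_sym.
rewrite big_nat1_eq /= (leq_trans _ ML)// ltn_add2l ltn_mul2l s0; exact: mM.
Qed.

Lemma progression_sum_const k : (c + s * M <= k)%N -> (0 < s)%N ->
  progression_sum k = progression_sum (c + s * M).
Proof.
move=> Mk s0; have full j : (c + s * M <= j)%N -> progression_sum j = \sum_(0 <= m < M) E m.
  move=> Mj; rewrite /progression_sum big_mkcond; apply: eq_big_nat => m /andP[_ mM].
  by rewrite ifT// (leq_trans _ Mj)// ltn_add2l ltn_mul2l s0.
by rewrite !full.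
Qed.

End Progressions.

Section PatternGrowth.
Context {R : realType}.
Local Notation C := R[i].

Lemma psum_pattern_le (q e : nat -> C) s M n (r : R) (u : C) : (s * M <= n)%N ->
  N (psum (pattern q e s M n) (4 * n) ((r%:C)%C * u)) <= \sum_(0 <= i < s) N (q i) *
    N (\sum_(0 <= m < M) e m * (u ^+ (n + i + s * m) * ((pw r (n + i + s * m))%:C)%C)).
Proof.
move=> sMn; rewrite psum_pattern//; apply: le_trans (normc_sum _ _ _) _.
apply: ler_sum => i _; rewrite Normc.normcM le_eqVlt; apply/orP; left; apply/eqP.
congr (_ * N _); apply: eq_bigr => m _; congr (_ * _); rewrite addnA [(n + s * m + i)%N]addnAC.
rewrite exprMn /pw mulrAC mulrC; congr (_ * _).
by rewrite rmorphM /= rmorphXn /= fmorphV /= rmorph_nat.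
Qed.

Lemma pattern_growth (q e : nat -> C) s M n (r B : R) (p : \bar R) :
  (1 <= p)%E -> 0 < r -> 0 <= B -> (s * M <= n)%N ->
  (forall u i, N u = 1 -> (i < s)%N ->
    N (\sum_(0 <= m < M) e m * (u ^+ (n + i + s * m) * ((pw r (n + i + s * m))%:C)%C)) <= B) ->
  (Defs.M p (psum (pattern q e s M n) (4 * n)) r <= (\sum_(0 <= i < s) N (q i) * B)%:E)%E.
Proof.
move=> p1 r0 B0 sMn H; apply: M_le_sup => //; [exact: psum_cont|exact: ltW| |].
  by apply: sumr_ge0 => i _; apply: mulr_ge0 => //; exact: normc_ge0.
move=> z zr; pose u := z * ((r^-1)%:C)%C.
have u1 : N u = 1 by rewrite Normc.normcM zr normc_real ger0_norm ?invr_ge0 ?(ltW r0)// mulfV ?lt0r_neq0.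
have -> : z = ((r%:C)%C * u) :> C.
  by rewrite /u mulrCA -rmorphM mulfV ?lt0r_neq0// mulr1.
apply: le_trans (psum_pattern_le q e r u sMn) _.
by apply: ler_sum_nat => i /andP[_ si]; apply: ler_wpM2l; [exact: normc_ge0|exact: H].
Qed.

(** An interval of [x] integers meets at most [1 + x / s] terms of the progression; the
    hypothesis compares this number with [T], the effective number of terms under the
    Poisson weights, and [sqrt j <= sqrt T * O(1 + x / sqrt r)] then follows. The
    constant is [6 * 12 * 9/2], with factors from [poisson_abel], from [rs_sum_le] and
    from this estimate. *)
Lemma rs_progression c s M (u : C) (r T : R) : N u = 1 -> 1 <= r -> (0 < s)%N -> 1 <= T ->
  (forall j x : nat, (j <= M)%N -> (s * j <= x + s)%N ->
     j%:R <= 2 * T * (1 + 3 * (x%:R / Num.sqrt r))) ->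
  N (\sum_(0 <= m < M) rsgn m * (u ^+ (c + s * m) * ((pw r (c + s * m))%:C)%C)) <=
    324 * Num.sqrt T * (expR r / Num.sqrt r).
Proof.
move=> u1 r1 s0 T1 H; pose E m : C := rsgn m * u ^+ (c + s * m).
have q0 : 0 < Num.sqrt r by rewrite sqrtr_gt0; lra.
have -> : \sum_(0 <= m < M) rsgn m * (u ^+ (c + s * m) * ((pw r (c + s * m))%:C)%C) =
    \sum_(0 <= m < M) E m * ((pw r (c + s * m))%:C)%C.
  by apply: eq_bigr => m _; rewrite /E mulrA.
rewrite -(progression_sum_weighted E (fun k => ((pw r k)%:C)%C) (leqnn _) s0).
have -> : 324 * Num.sqrt T = 6 * (54 * Num.sqrt T) :> R by rewrite mulrA; congr (_ * _); ring.
apply: poisson_abel => //.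
  move=> k1 k2 k12; have [m1 [m2 [/andP[m12 m2M] gap ->]]] := progression_sum_cut E c s M k12.
  have -> : \sum_(m1 <= m < m2) E m = u ^+ c * rs_sum m1 m2 (u ^+ s).
    by rewrite /rs_sum mulr_sumr; apply: eq_bigr => m _; rewrite /E exprD exprM; ring.
  rewrite Normc.normcM normcX u1 expr1n mul1r.
  apply: le_trans (rs_sum_le _ m12) _; first by rewrite normcX u1 expr1n.
  have X0 : 0 <= (k2 - k1)%:R / Num.sqrt r by rewrite divr_ge0// ltW.
  have h := H _ _ (leq_trans (leq_subr m1 m2) m2M) gap.
  have T0 : 0 <= T by lra.
  apply: le_trans (_ : 12 * (Num.sqrt T * (9 / 2 * (1 + (k2 - k1)%:R / Num.sqrt r))) <= _); last first.
    by rewrite le_eqVlt; apply/orP; left; apply/eqP; field; rewrite lt0r_neq0.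
  apply: ler_wpM2l => //; move: ((k2 - k1)%:R / Num.sqrt r) X0 h => X X0 h.
  rewrite -[9 / 2 * _]ger0_norm; last by lra.
  rewrite -sqrtr_sqr -sqrtrM//; apply: ler_wsqrtr; apply: le_trans h _.
  have : 2 * (1 + 3 * X) <= (9 / 2 * (1 + X)) ^+ 2 by nra.
  by move/(ler_wpM2l T0); rewrite [T * (2 * _)]mulrCA mulrA.
by move=> k Lk; exact: progression_sum_const.
Qed.

(** With [T = max (1, n ^ sigma / s)]: for [g <= 1/2] the Poisson weights limit the
    number of terms, for [g > 1/2] the length of the window does. *)
Lemma rs_window (g r : R) n s j x : 0 <= g <= 1 -> (0 < n)%N -> (0 < s)%N -> 0 < r -> r <= 8 * n%:R ->
  (j <= (Num.trunc (n%:R `^ (1 - g) / (2 * s%:R) : R)).+1)%N -> (s * j <= x + s)%N ->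
  j%:R <= 2 * Num.max 1 (n%:R `^ sigma g / s%:R) * (1 + 3 * (x%:R / Num.sqrt r)).
Proof.
move=> /andP[g0 g1] n0 s0 r0 r8 jM sj.
have q0 : 0 < Num.sqrt r by rewrite sqrtr_gt0.
have X0 : 0 <= x%:R / Num.sqrt r by rewrite divr_ge0// ltW.
have sR : 0 < s%:R :> R by rewrite ltr0n.
set Y := n%:R `^ sigma g / s%:R; set T := Num.max 1 Y.
have T1 : 1 <= T by rewrite le_max lexx.
have TY : Y <= T by rewrite le_max lexx orbT.
have T0 : 0 <= T by lra.
have [gh|gh] := leP g 2^-1; last first.
  have sE : sigma g = 1 - g.
    by rewrite /sigma; apply/min_idPr; lra.
  have jR : j%:R <= Y / 2 + 1.
    apply: (@le_trans _ _ (Num.trunc (n%:R `^ (1 - g) / (2 * s%:R) : R)).+1%:R); first by rewrite ler_nat.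
    rewrite -natr1 lerD2r /Y sE.
    have -> : n%:R `^ (1 - g) / s%:R / 2 = n%:R `^ (1 - g) / (2 * s%:R) :> R.
      by field; rewrite lt0r_neq0.
    by rewrite truncn_le divr_ge0 ?powR_ge0 ?mulr_ge0.
  nra.
have sE : sigma g = 2^-1 by rewrite /sigma; apply/min_idPl; lra.
have jR : s%:R * j%:R <= x%:R + s%:R :> R by rewrite -natrM -natrD ler_nat.
have nq : Num.sqrt r <= 3 * n%:R `^ 2^-1.
  rewrite powR12_sqrt//; apply: le_trans (ler_wsqrtr r8) _.
  have -> : 3 * Num.sqrt n%:R = Num.sqrt (3 ^+ 2 * n%:R) :> R.
    by rewrite sqrtrM// sqrtr_sqr ger0_norm.
  by apply: ler_wsqrtr; have : 0 <= n%:R :> R by []; lra.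
have YE : n%:R `^ 2^-1 = s%:R * Y by rewrite /Y sE mulrCA mulfV ?mulr1// lt0r_neq0.
have xle : x%:R <= s%:R * T * (3 * (x%:R / Num.sqrt r)).
  have E : x%:R = x%:R / Num.sqrt r * Num.sqrt r by rewrite divfK// lt0r_neq0.
  rewrite {1}E; have -> : s%:R * T * (3 * (x%:R / Num.sqrt r)) = x%:R / Num.sqrt r * (3 * (s%:R * T)) by ring.
  apply: ler_wpM2l => //; rewrite YE in nq; apply: le_trans nq _.
  by apply: ler_wpM2l => //; apply: ler_wpM2l => //; exact: ltW.
have : s%:R * j%:R <= s%:R * (2 * T * (1 + 3 * (x%:R / Num.sqrt r))).
  apply: le_trans jR _; move: (x%:R / Num.sqrt r) X0 xle => X X0 xle.
  have : s%:R <= s%:R * T by rewrite ler_peMr// ltW.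
  have : 0 <= s%:R * T * X by rewrite !mulr_ge0// ltW.
  nra.
by rewrite ler_pM2l.
Qed.

End PatternGrowth.

Section PatternBlocks.
Context {R : realType}.
Local Notation C := R[i].

Definition tnorm (t : target) : R := \sum_(0 <= i < size t.1) N (tcoef t i : C).

Lemma tcoef_out t i : (size t.1 <= i)%N -> tcoef t i = 0 :> C.
Proof. by move=> h; rewrite /tcoef nth_default// !rmorph0. Qed.

Local Opaque tcoef.

Lemma tnorm_ge0 t : 0 <= tnorm t.
Proof. by apply: sumr_ge0 => i _; exact: normc_ge0. Qed.

Lemma tcoef_le t i : N (tcoef t i : C) <= tnorm t.
Proof.
have [it|ti] := ltnP i (size t.1); last by rewrite tcoef_out// Normc.normc0 tnorm_ge0.
rewrite /tnorm (bigD1_seq i) ?mem_index_iota ?iota_uniq// lerDl.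
by apply: sumr_ge0 => j _; exact: normc_ge0.
Qed.

Lemma tnorm_sum t s : (size t.1 <= s)%N -> \sum_(0 <= i < s) N (tcoef t i : C) = tnorm t.
Proof.
move=> ts; rewrite (big_cat_nat (leq0n _) ts) /= [X in _ + X]big1_seq ?addr0//.
by move=> i; rewrite mem_index_iota => /andP[_ /andP[ti _]]; rewrite tcoef_out// Normc.normc0.
Qed.

Lemma tpoly_psum t s z : (size t.1 <= s)%N -> psum (tcoef t) s z = tpoly t z :> C.
Proof.
move=> ts; rewrite /tpoly /psum (big_cat_nat (leq0n _) ts) /= [X in _ + X]big1_seq ?addr0//.
by move=> i; rewrite mem_index_iota => /andP[_ /andP[ti _]]; rewrite tcoef_out// !mul0r.
Qed.

(** A long period makes the later stretches negligible near the beginning of a given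
    one. *)
Lemma period_exists (t : target) s1 : exists s, [/\ (0 < s)%N, (s1 <= s)%N, (size t.1 <= s)%N &
  forall l, (s <= l)%N -> tnorm t * \sum_(s <= i < l) pw (t.2%:R : R) i <= t.2.+1%:R^-1].
Proof.
have K0 : 0 < tnorm t + 1 by rewrite ltr_wpDl// tnorm_ge0.
have e0 : 0 < t.2.+1%:R^-1 / (tnorm t + 1) by rewrite divr_gt0// invr_gt0 ltr0Sn.
have [l0 Hl] := exp_tail (ler0n R t.2) e0.
exists (maxn l0 (maxn s1 (maxn (size t.1) 1))); set s := maxn _ _.
have hs : [/\ (l0 <= s)%N, (s1 <= s)%N, (size t.1 <= s)%N & (1 <= s)%N].
  by rewrite /s; split; rewrite !leq_max leqnn ?orbT.
case: hs => h1 h2 h3 h4; split => // l sl.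
apply: le_trans (ler_wpM2l (tnorm_ge0 t) (Hl s h1 l sl)) _.
rewrite mulrA ler_pdivrMr// mulrC ler_wpM2l ?invr_ge0//.
by rewrite lerDl.
Qed.

Variables (g a r0 : R) (p : \bar R) (Psi : R -> R).
Hypothesis g01 : 0 <= g <= 1.

(** Everything a block needs, except the growth condition, follows from having a fixed
    proportion of weights equal to 1. *)
Lemma pattern_block t s W c : 0 < c -> (0 < s)%N -> (size t.1 <= s)%N ->
  (forall l, (s <= l)%N -> tnorm t * \sum_(s <= i < l) pw (t.2%:R : R) i <= t.2.+1%:R^-1) ->
  exists2 delta, 0 < delta & forall n M e (good : pred nat),
    (0 < n)%N -> (s <= n)%N -> (s * M <= n)%N -> (s * M)%:R <= W * n%:R `^ (1 - g) ->
    (forall m, N (e m) <= 1) -> (forall m, good m -> e m = 1) ->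
    c * n%:R `^ (1 - g) <= \sum_(0 <= m < M) (good m)%:R ->
    (forall r, r0 <= r -> n%:R / 2 <= r -> r <= 8 * n%:R ->
      (Defs.M p (psum (pattern (tcoef t) e s M n) (4 * n)) r <= (allowed a Psi r)%:E)%E) ->
    block (beta_gamma g) p a r0 Psi t (tnorm t) delta n (pattern (tcoef t) e s M n).
Proof.
move=> c0 s0 ts tail; have [delta d0 Hd] := window_density W g01 c0.
exists delta => // n M e good n0 sn sMn sMW e1 ge cnt growth.
split=> //.
- by move=> k; exact: pattern_supp.
- by move=> k; exact: pattern_bound (tcoef_le t) e1 k.
exists [set k | exists m, [/\ (m < M)%N, good m & k = (n + s * m)%N]], (n + s * M)%N; split.
- exact: leq_addr.
- move=> k [m [mM _ ->]]; rewrite leq_addr /=; apply: (@leq_trans (n + s * M)).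
    by rewrite ltn_add2l ltn_mul2l s0.
  by apply: (@leq_trans (2 * n)); rewrite ?leq_mul2r ?orbT// mul2n -addnn leq_add2l.
- apply: (Hd s M n _ good) => // m mM gm; by exists m.
move=> k [m [mM gm ->]] z zt; rewrite -(tpoly_psum _ ts).
apply: (pattern_close (tcoef_le t) e1 _ mM (ge m gm) zt tail).
by apply: leq_trans sn _; rewrite leq_pmull.
Qed.

(** A block of period [s] costs the constant [B], depending on the target, times the
    [th]-th power of the effective number [n ^ sigma / s] of copies; this says that the
    allowed growth leaves room for it once [s] and then [n] are large. *)
Definition room (th : R) := forall B, 0 <= B -> exists s1, forall s, (s1 <= s)%N -> (0 < s)%N ->
  exists n1, forall n r, (n1 <= n)%N -> r0 <= r -> n%:R / 2 <= r -> r <= 8 * n%:R ->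
    B * Num.max 1 (n%:R `^ sigma g / s%:R) `^ th * (expR r / Num.sqrt r) <= allowed a Psi r.

Lemma rs_blocks : (1 <= p)%E -> room 2^-1 ->
  forall t, exists K delta n0, [/\ 0 <= K, 0 < delta &
    forall n, (n0 <= n)%N -> exists b, block (beta_gamma g) p a r0 Psi t K delta n b].
Proof.
move=> p1 Hgrow t; have [s1 Hs] := Hgrow (tnorm t * 324) (mulr_ge0 (tnorm_ge0 t) (ler0n _ 324)).
have [s [s0 ss ts tail]] := period_exists t s1.
have [n1 Hn] := Hs s ss s0.
have sR : 0 < s%:R :> R by rewrite ltr0n.
have c0 : 0 < (16 * s%:R)^-1 :> R by rewrite invr_gt0 mulr_gt0.
have [delta d0 Hd] := pattern_block (2^-1 + s%:R) c0 s0 ts tail.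
exists (tnorm t), delta, (maxn n1 (maxn (2 * s) 2)); split; [exact: tnorm_ge0|exact: d0|].
move=> n; rewrite !geq_max => /andP[nn1 /andP[n2s n2]].
have n0 : (0 < n)%N by exact: leq_trans n2.
pose x := n%:R `^ (1 - g) / (2 * s%:R) : R.
pose M := (Num.trunc x).+1.
have [g0 g1] := andP g01.
have P1 : 1 <= n%:R `^ (1 - g) :> R by rewrite -[leLHS](powRr0 n%:R) ler_powR ?ler1n// subr_ge0.
have Pn : n%:R `^ (1 - g) <= n%:R :> R by rewrite -[leRHS]powRr1// ler_powR ?ler1n// gerBl.
have x0 : 0 <= x by rewrite divr_ge0 ?powR_ge0 ?mulr_ge0.
have sx : s%:R * x = n%:R `^ (1 - g) / 2 by rewrite /x; field; rewrite lt0r_neq0.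
have Mx : M%:R <= x + 1 by rewrite /M -natr1 lerD2r truncn_le.
have xM : x <= M%:R by exact: ltW (truncnS_gt _).
have sM : (s * M)%:R <= n%:R `^ (1 - g) / 2 + s%:R by rewrite natrM -sx; nra.
have sMn : (s * M <= n)%N.
  rewrite -(ler_nat R); apply: le_trans sM _.
  have : 2 * s%:R <= n%:R :> R by rewrite -natrM ler_nat.
  lra.
exists (pattern (tcoef t) (@rsgn R) s M n); apply: (Hd n M _ (fun m => ~~ rs m)) => //.
- by apply: leq_trans n2s; rewrite leq_pmull.
- apply: le_trans sM _; rewrite mulrDl mulrC lerD2l ler_peMr//; exact: ltW.
- by move=> m; rewrite normc_rsgn.
- by move=> m nm; rewrite /rsgn (negbTE nm) expr0.
- have := rs_count (ltn0Sn (Num.trunc x)); rewrite -(ler_nat R) natrM natr_sum.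
  rewrite -/M; set G := \sum_(0 <= m < M) _ => h.
  have -> : (16 * s%:R)^-1 * n%:R `^ (1 - g) = x / 8 by rewrite /x; field; rewrite lt0r_neq0.
  lra.
have n2R : 2 <= n%:R :> R by rewrite ler_nat.
move=> r rr rn nr; have r1 : 1 <= r by lra.
have r_gt0 : 0 < r by lra.
pose T := Num.max 1 (n%:R `^ sigma g / s%:R).
have T1 : 1 <= T by rewrite le_max lexx.
pose B := 324 * Num.sqrt T * (expR r / Num.sqrt r).
have B0 : 0 <= B.
  by apply: mulr_ge0; [exact: mulr_ge0|apply: divr_ge0; [exact: expR_ge0|exact: sqrtr_ge0]].
have each u i : N u = 1 -> (i < s)%N ->
    N (\sum_(0 <= m < M) rsgn m * (u ^+ (n + i + s * m) * ((pw r (n + i + s * m))%:C)%C)) <= B.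
  move=> u1 si; apply: rs_progression => // j y jM sj.
  exact: rs_window jM sj.
apply: (le_trans (pattern_growth (tcoef t) p1 r_gt0 B0 sMn each)).
rewrite lee_fin -mulr_suml tnorm_sum// /B !mulrA -[_ * expR r / _]mulrA.
have := Hn n r nn1 rr rn nr; rewrite powR12_sqrt//; exact: le_trans T1.
Qed.

End PatternBlocks.

(** * Blocks with a trapezoidal profile *)

Section PoissonRegularity.
Context {R : realType}.
Variable r : R.
Hypothesis r0 : 0 < r.

Let Om := expR r / Num.sqrt r.
Let q0 : 0 < Num.sqrt r. Proof. by rewrite sqrtr_gt0. Qed.
Let qq : Num.sqrt r * Num.sqrt r = r. Proof. by rewrite -expr2 sqr_sqrtr// ltW. Qed.
Let Om0 : 0 <= Om. Proof. by rewrite divr_ge0 ?expR_ge0 ?sqrtr_ge0. Qed.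

Lemma weighted_cauchy (a x : nat -> R) n : (forall k, 0 <= a k) ->
  (\sum_(0 <= k < n) a k * x k) ^+ 2 <=
  (\sum_(0 <= k < n) a k) * \sum_(0 <= k < n) a k * x k ^+ 2.
Proof.
move=> a0; elim: n => [|n IH]; first by rewrite !big_geq// expr0n mul0r.
have cross y : 2 * y * (\sum_(0 <= k < n) a k * x k) <=
    \sum_(0 <= k < n) a k * x k ^+ 2 + y ^+ 2 * \sum_(0 <= k < n) a k.
  rewrite -subr_ge0 !mulr_sumr -big_split -sumrB /=; apply: sumr_ge0 => k _.
  have -> : a k * x k ^+ 2 + y ^+ 2 * a k - 2 * y * (a k * x k) = a k * (x k - y) ^+ 2 by ring.
  by rewrite mulr_ge0 ?sqr_ge0.
rewrite !big_nat_recr//=; move: (a0 n) (cross (x n)) IH.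
set S := \sum_(0 <= k < n) a k * x k; set Q := \sum_(0 <= k < n) a k * x k ^+ 2.
set A := \sum_(0 <= k < n) a k; move: (a n) (x n) => b y b0 h IH.
have := ler_wpM2l b0 h; nra.
Qed.

Lemma sum_shift_le (F : nat -> R) c n : (forall k, 0 <= F k) ->
  \sum_(0 <= k < n) F (c + k)%N <= \sum_(0 <= k < c + n) F k.
Proof.
move=> F0; rewrite [leRHS](big_cat_nat (leq0n _) (leq_addr n c)) /=.
rewrite [X in _ <= _ + X](_ : _ = \sum_(0 <= k < n) F (c + k)%N).
  by rewrite lerDr; apply: sumr_ge0.
rewrite -{1}[c]add0n big_addn addKn; apply: eq_bigr => k _; by rewrite addnC.
Qed.

(** From [pw_step] and [poisson_deviation]. As the weights are unimodal with maximum of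
    order [Om], there is no loss. *)
Lemma pw_variation n : \sum_(0 <= k < n) `|pw r k.+1 - pw r k| <= Om.
Proof.
apply: le_trans (_ : \sum_(0 <= k < n) r^-1 * (pw r k.+1 * `|k.+1%:R - r|) <= _).
  apply: ler_sum => k _; rewrite pw_step// normrM normrM [`|pw _ _|]ger0_norm ?pw_ge0 ?(ltW r0)//.
  by rewrite [`|r^-1|]ger0_norm ?invr_ge0 ?(ltW r0)// distrC mulrC.
rewrite -mulr_sumr; have F0 k : 0 <= pw r k * `|k%:R - r| by rewrite mulr_ge0// pw_ge0// ltW.
have ri : 0 <= r^-1 by rewrite invr_ge0 ltW.
apply: le_trans (ler_wpM2l ri (sum_shift_le 1 n F0)) _.
apply: le_trans (ler_wpM2l ri (poisson_deviation (1 + n) r0)) _.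
by rewrite -{1}qq /Om le_eqVlt; apply/orP; left; apply/eqP; field; rewrite lt0r_neq0.
Qed.

Lemma pw_energy_variation n : \sum_(0 <= k < n) (pw r k.+1 - pw r k) ^+ 2 <= Om ^+ 2 / Num.sqrt r.
Proof.
apply: le_trans (_ : \sum_(0 <= k < n) Om / r ^+ 2 * (pw r k.+1 * (k.+1%:R - r) ^+ 2) <= _).
  apply: ler_sum => k _; rewrite pw_step//.
  have -> : (pw r k.+1 * (r - k.+1%:R) / r) ^+ 2 =
      pw r k.+1 * (pw r k.+1 * (k.+1%:R - r) ^+ 2 / r ^+ 2) by field; rewrite lt0r_neq0.
  have -> : Om / r ^+ 2 * (pw r k.+1 * (k.+1%:R - r) ^+ 2) =
      Om * (pw r k.+1 * (k.+1%:R - r) ^+ 2 / r ^+ 2) by field; rewrite lt0r_neq0.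
  apply: ler_wpM2r; last exact: pw_max.
  apply: divr_ge0; last exact: sqr_ge0.
  by apply: mulr_ge0; [exact: pw_ge0 (ltW r0)|exact: sqr_ge0].
rewrite -mulr_sumr.
have F0 k : 0 <= pw r k * (k%:R - r) ^+ 2 by rewrite mulr_ge0 ?sqr_ge0// pw_ge0// ltW.
have ri : 0 <= Om / r ^+ 2 by apply: divr_ge0 => //; exact: sqr_ge0.
apply: le_trans (ler_wpM2l ri (sum_shift_le 1 n F0)) _.
apply: le_trans (ler_wpM2l ri (poisson_variance (1 + n) (ltW r0))) _.
have -> : Om ^+ 2 / Num.sqrt r = Om / r * expR r.
  transitivity (Om * expR r / (Num.sqrt r * Num.sqrt r)); last by rewrite qq mulrAC.
  by rewrite expr2 {2}/Om; field; rewrite lt0r_neq0.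
by rewrite le_eqVlt; apply/orP; left; apply/eqP; field; rewrite lt0r_neq0.
Qed.

(** Comparing each term with the [s] weights that follow costs the variation of the
    weights between them. *)
Lemma pw_progression_sum c s M : (0 < s)%N ->
  s%:R * (\sum_(0 <= m < M) pw r (c + s * m)) <= expR r + s%:R * Om.
Proof.
move=> s0; pose d k := `|pw r k.+1 - pw r k|.
have d0 k : 0 <= d k by exact: normr_ge0.
have step k j : pw r k <= pw r (k + j) + \sum_(0 <= i < j) d (k + i)%N.
  elim: j => [|j IH]; first by rewrite addn0 big_geq// addr0.
  rewrite big_nat_recr//= addrA; apply: le_trans IH _.
  have := ler_norm (pw r (k + j) - pw r (k + j).+1); rewrite distrC -/(d _) addnS.
  move: (\sum_(0 <= i < j) _) => X; lra.
apply: le_trans (_ : \sum_(0 <= k < s * M) pw r (c + k) + s%:R * \sum_(0 <= k < s * M) d (c + k)%N <= _).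
  rewrite (sum_blocks (fun k => pw r (c + k))) (sum_blocks (fun k => d (c + k)%N)).
  rewrite !mulr_sumr -big_split /=; apply: ler_sum => m _.
  have -> : s%:R * pw r (c + s * m) = \sum_(0 <= j < s) pw r (c + s * m).
    by rewrite sumr_const_nat subn0 mulr_natl.
  have -> : s%:R * (\sum_(0 <= i < s) d (c + (s * m + i))%N) =
      \sum_(0 <= j < s) \sum_(0 <= i < s) d (c + s * m + i)%N.
    rewrite sumr_const_nat subn0 mulr_natl; congr (_ *+ _).
    by apply: eq_bigr => i _; rewrite addnA.
  rewrite -big_split /=; apply: ler_sum_nat => j /andP[_ js].
  apply: le_trans (step _ j) _; rewrite addnA lerD2l.
  by rewrite [leRHS](big_cat_nat (leq0n _) (ltnW js)) /= lerDl; apply: sumr_ge0.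
apply: lerD.
  apply: le_trans (sum_shift_le c _ (fun k => pw_ge0 k (ltW r0))) _.
  exact: sum_pw_le (ltW r0).
apply: ler_wpM2l => //; apply: le_trans (sum_shift_le c _ d0) _; exact: pw_variation.
Qed.

(** Cauchy-Schwarz over each step of the progression, then [pw_energy_variation]. *)
Lemma pw_progression_diff c s M :
  \sum_(0 <= m < M) (pw r (c + s * m.+1) - pw r (c + s * m)) ^+ 2 <=
  s%:R * (Om ^+ 2 / Num.sqrt r).
Proof.
pose d k := pw r k.+1 - pw r k.
have tel k j : pw r (k + j) - pw r k = \sum_(0 <= i < j) d (k + i)%N.
  elim: j => [|j IH]; first by rewrite addn0 subrr big_geq.
  by rewrite big_nat_recr//= -IH /d addnS; ring.
apply: le_trans (_ : s%:R * \sum_(0 <= k < s * M) d (c + k)%N ^+ 2 <= _).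
  rewrite (sum_blocks (fun k => d (c + k)%N ^+ 2)) mulr_sumr; apply: ler_sum => m _.
  rewrite mulnS [(s + _)%N]addnC addnA tel.
  have := @weighted_cauchy (fun=> 1) (fun i => d (c + s * m + i)%N) s (fun=> ler01).
  rewrite sumr_const_nat subn0; under eq_bigr do rewrite mul1r.
  under [X in _ <= _ * X -> _]eq_bigr do rewrite mul1r.
  move/le_trans; apply; rewrite le_eqVlt; apply/orP; left; apply/eqP; congr (_ * _).
  by apply: eq_bigr => i _; rewrite addnA.
apply: ler_wpM2l => //.
apply: le_trans (sum_shift_le c _ (fun k => sqr_ge0 (d k))) _; exact: pw_energy_variation.
Qed.

End PoissonRegularity.

Section TrigMeans.
Context {R : realType}.
Local Notation C := R[i].

Lemma powB1_half L : (0 < L)%N -> (1 - L%:R^-1) ^+ L <= 2^-1 :> R.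
Proof.
move=> L0; have LR : 0 < L%:R :> R by rewrite ltr0n.
have h0 : 0 <= 1 - L%:R^-1 :> R by rewrite subr_ge0 invf_le1// ler1n.
have h1 : 1 - L%:R^-1 <= expR (- L%:R^-1) :> R by exact: expR_ge1Dx.
apply: le_trans (_ : expR (- L%:R^-1) ^+ L <= _).
  by rewrite lerXn2r ?nnegrE ?expR_ge0.
rewrite -expRM_natl mulrN mulfV ?lt0r_neq0// expRN lef_pV2 ?posrE ?expR_gt0//.
exact: (expR_ge1Dx 1).
Qed.

Lemma geometric_prod (x : C) L : (1 - x) * (\sum_(0 <= k < L) x ^+ k) = 1 - x ^+ L.
Proof.
elim: L => [|L IH]; first by rewrite big_geq// mulr0 expr0 subrr.
by rewrite big_nat_recr//= mulrDr IH exprS; ring.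
Qed.

(** Multiplying by a truncated inverse of [1 - rho y] splits a polynomial with slowly
    varying coefficients into a small factor and a geometric sum, whose mean squares
    Parseval's identity gives. *)
Lemma trig_mean_le (c : nat -> C) M s L (mu : R) : (0 < s)%N -> (0 < L)%N -> 0 < mu ->
  c 0%N = 0 -> c M = 0 ->
  avg (fun t => N (\sum_(0 <= m < M) c m * cis ((s * m)%:R * t))) <=
  mu * (\sum_(0 <= m < M) N (c m.+1 - (1 - (L%:R^-1)%:C)%C * c m) ^+ 2) + L%:R / mu.
Proof.
move=> s0 L0 mu0 c0 cM.
pose rho : R := 1 - L%:R^-1; have rho0 : 0 <= rho by rewrite subr_ge0 invf_le1 ?ler1n// ltr0n.
have rho1 : rho <= 1 by rewrite gerBl invr_ge0.
have rhoE : (1 - (L%:R^-1)%:C)%C = (rho%:C)%C by rewrite /rho rmorphB rmorph1.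
pose g t := \sum_(0 <= m < M) c m * cis ((s * m)%:R * t).
pose G t := \sum_(0 <= m < M) (c m.+1 - (rho%:C)%C * c m) * cis ((s * m)%:R * t).
pose K t := \sum_(0 <= k < L) (rho%:C)%C ^+ k * cis ((s * k)%:R * t).
have curve n (a : nat -> C) : ccurve (fun t => \sum_(0 <= m < n) a m * cis ((s * m)%:R * t)).
  by apply: ccurve_sum => k; apply: ccurveM; [exact: ccurve_cst|exact: ccurve_cisM].
have cg : continuous (fun t => N (g t)) by apply: ccurve_normc; exact: curve.
have cG : continuous (fun t => N (G t) ^+ 2).
  have h : continuous (fun t => N (G t)) by apply: ccurve_normc; exact: curve.
  by move=> t; under eq_fun do rewrite expr2; apply: cvgM; exact: h.
have cK : continuous (fun t => N (K t) ^+ 2).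
  have h : continuous (fun t => N (K t)) by apply: ccurve_normc; exact: curve.
  by move=> t; under eq_fun do rewrite expr2; apply: cvgM; exact: h.
have pE m t : cis ((s * m)%:R * t) = cis (s%:R * t) ^+ m by rewrite cisMn natrM mulrA [m%:R * _]mulrC.
have GE t : (1 - (rho%:C)%C * cis (s%:R * t)) * g t = cis (s%:R * t) * G t.
  have aux n : (1 - (rho%:C)%C * cis (s%:R * t)) * (\sum_(0 <= m < n) c m * cis ((s * m)%:R * t)) =
      cis (s%:R * t) * (\sum_(0 <= m < n) (c m.+1 - (rho%:C)%C * c m) * cis ((s * m)%:R * t))
      - c n * cis (s%:R * t) ^+ n.
    elim: n => [|n IH]; first by rewrite !big_geq// c0 mul0r !mulr0 subrr.
    by rewrite !big_nat_recr//= mulrDr IH pE exprS; ring.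
  by rewrite /g aux cM mul0r subr0.
have KE t : (1 - (rho%:C)%C * cis (s%:R * t)) * K t = 1 - ((rho%:C)%C * cis (s%:R * t)) ^+ L.
  by rewrite -geometric_prod; congr (_ * _); apply: eq_bigr => k _; rewrite pE exprMn.
have pt t : N (g t) <= mu * N (G t) ^+ 2 + mu^-1 * N (K t) ^+ 2.
  (* as [rho ^ L <= 1 / e], the geometric sum [K] inverts [1 - rho y] up to a factor 2 *)
  have low : 2^-1 <= N (1 - ((rho%:C)%C * cis (s%:R * t)) ^+ L).
    apply: le_trans (normc_subl _ _); rewrite Normc.normc1 normcX Normc.normcM normc_cis mulr1.
    by rewrite normc_real ger0_norm//; have := powB1_half L0; rewrite -/rho; lra.
  have E : N (g t) * N (1 - ((rho%:C)%C * cis (s%:R * t)) ^+ L) = N (G t) * N (K t).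
    by rewrite -Normc.normcM -KE mulrCA mulrA GE !Normc.normcM normc_cis; ring.
  have := ler_wpM2l (normc_ge0 (g t)) low; rewrite E.
  have : 2 * (N (G t) * N (K t)) <= mu * N (G t) ^+ 2 + mu^-1 * N (K t) ^+ 2.
    rewrite -subr_ge0 (_ : _ - _ = mu * (N (G t) - mu^-1 * N (K t)) ^+ 2).
      by rewrite mulr_ge0 ?sqr_ge0// ltW.
    by field; rewrite lt0r_neq0.
  lra.
rewrite rhoE; apply: le_trans (ler_avg cg _ pt) _.
  by move=> t; apply: (@cvgD _ R); apply: cvgM; [exact: cvg_cst|exact: cG|exact: cvg_cst|exact: cK].
have cZ (h : R -> R) b : continuous h -> continuous (fun t => b * h t).
  by move=> ch t; apply: cvgM; [exact: cvg_cst|exact: ch].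
rewrite avgD; [|exact: cZ|exact: cZ]; rewrite !avgZ// !parseval//.
rewrite lerD2l [leRHS]mulrC ler_wpM2l ?invr_ge0 ?(ltW mu0)//.
apply: le_trans (_ : \sum_(0 <= k < L) (1 : R) <= _); last by rewrite sumr_const_nat subn0.
apply: ler_sum => k _; rewrite normcX normc_real ger0_norm// exprn_ile1 ?exprn_ge0//.
exact: exprn_ile1.
Qed.

(** Below [L] compare [x ^ v] with [x], above [L] with [x ^ 2]. *)
Lemma powR_interpolation (v x L : R) : 1 <= v <= 2 -> 1 <= L -> 0 <= x ->
  x `^ v <= L `^ (v - 1) * (x + x ^+ 2 / L).
Proof.
move=> /andP[v1 v2] L1 x0; have L0 : 0 < L by lra.
have P0 : 0 <= L `^ (v - 1) by exact: powR_ge0.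
have [->|xn] := eqVneq x 0; first by rewrite powR0 ?mulr_ge0 ?addr_ge0// ?mul0r ?expr0n ?divr_ge0 ?gt_eqF//; lra.
have xp : 0 < x by rewrite lt_def xn.
have [xL|Lx] := leP x L.
  have -> : x `^ v = x `^ (v - 1) * x by rewrite -{3}[x]powRr1// -powRDp// subrK.
  apply: (@le_trans _ _ (L `^ (v - 1) * x)).
    apply: ler_wpM2r => //; apply: ge0_ler_powR; rewrite ?nnegrE ?(ltW L0)//; lra.
  by apply: ler_wpM2l => //; rewrite lerDl divr_ge0 ?sqr_ge0// ltW.
have -> : x `^ v = x ^+ 2 / x `^ (2 - v).
  by rewrite -powRN -powR_mulrn// -powRDp//; congr (_ `^ _); ring.
have LE : L `^ (v - 1) = L / L `^ (2 - v).
  by rewrite -powRN -{2}[L]powRr1 ?(ltW L0)// -powRDp//; congr (_ `^ _); ring.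
apply: (@le_trans _ _ (L `^ (v - 1) * (x ^+ 2 / L))); last by apply: ler_wpM2l => //; rewrite lerDr.
have -> : L `^ (v - 1) * (x ^+ 2 / L) = x ^+ 2 / L `^ (2 - v).
  by rewrite LE; field; rewrite !lt0r_neq0// powR_gt0.
apply: ler_wpM2l; first exact: sqr_ge0.
rewrite lef_pV2 ?posrE ?powR_gt0//; apply: ge0_ler_powR; rewrite ?nnegrE ?(ltW L0) ?(ltW Lx)//; lra.
Qed.

End TrigMeans.

Section MeansOfSums.
Context {R : realType}.
Local Notation C := R[i].

(** By [powR_interpolation] the mean of the [v]-th power is controlled by the mean and
    the mean square of the [h i], which is where Parseval's identity is available. *)
Lemma M_weighted_sum (f : C -> C) (h : nat -> R -> R) (w : nat -> R) d (v r K Om L B : R) :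
  (forall z, ccont_at f z) -> 1 <= v <= 2 -> 1 <= L -> 0 < K -> 0 < Om -> 1 <= B ->
  (forall i, 0 <= w i) -> \sum_(0 <= i < d) w i <= K ->
  (forall i, continuous (h i)) -> (forall i t, 0 <= h i t) ->
  (forall t, N (f ((r%:C)%C * cis t)) <= \sum_(0 <= i < d) w i * h i t) ->
  (forall i, avg (h i) / Om + avg (fun t => h i t ^+ 2) / (Om ^+ 2 * L) <= B) ->
  (M v%:E f r <= (B * K * Om * L `^ (1 - v^-1))%:E)%E.
Proof.
move=> fc v12 L1 K0 Om0 B1 w0 wK ch h0 fh hB; have /andP[v1 v2] := v12.
have v0 : 0 < v by lra.
have L0 : 0 < L by lra.
have B0 : 0 < B by lra.
have KO : 0 < K * Om by rewrite mulr_gt0.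
have E2 : (L `^ (1 - v^-1)) `^ v = L `^ (v - 1).
  by rewrite -powRrM mulrBl mul1r mulVf// lt0r_neq0.
apply: M_le => //; first by rewrite !mulr_ge0 ?powR_ge0// ltW.
pose c0 := (K * Om) `^ v * L `^ (v - 1).
have c00 : 0 <= c0 by rewrite mulr_ge0 ?powR_ge0.
pose S t := \sum_(0 <= i < d) w i / K * (h i t / Om + h i t ^+ 2 / (Om ^+ 2 * L)).
have cS2 i : continuous (fun t => h i t ^+ 2).
  by move=> t; under eq_fun do rewrite expr2; apply: cvgM; exact: ch.
have cMr (k : R -> R) b : continuous k -> continuous (fun t => k t * b).
  by move=> ck t; apply: cvgM; [exact: ck|exact: cvg_cst].
have cMl (k : R -> R) b : continuous k -> continuous (fun t => b * k t).
  by move=> ck t; apply: cvgM; [exact: cvg_cst|exact: ck].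
have cTi i : continuous (fun t => h i t / Om + h i t ^+ 2 / (Om ^+ 2 * L)).
  move=> t; apply: (@cvgD _ R); [exact: (cMr _ _ (ch i) t)|exact: (cMr _ _ (cS2 i) t)].
have cS : continuous S by apply: continuous_finite_sum => i; exact: cMl.
have pt t : N (f ((r%:C)%C * cis t)) `^ v <= c0 * S t.
  set F := \sum_(0 <= i < d) w i * h i t.
  have F0 : 0 <= F by apply: sumr_ge0 => i _; rewrite mulr_ge0.
  apply: (@le_trans _ _ (F `^ v)).
    by apply: ge0_ler_powR; rewrite ?nnegrE ?normc_ge0 ?(ltW v0)//; exact: fh.
  have -> : F = K * Om * (F / (K * Om)) by rewrite mulrC divfK// lt0r_neq0.
  have x0 : 0 <= F / (K * Om) by rewrite divr_ge0// ltW.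
  rewrite powRM//; last exact: ltW.
  rewrite /c0 -mulrA; apply: ler_wpM2l; first exact: powR_ge0.
  apply: le_trans (powR_interpolation v12 L1 x0) _.
  apply: ler_wpM2l; first exact: powR_ge0.
  have F2 : F ^+ 2 <= K * \sum_(0 <= i < d) w i * h i t ^+ 2.
    apply: le_trans (weighted_cauchy (fun i => h i t) d w0) _.
    by apply: ler_wpM2r => //; apply: sumr_ge0 => i _; rewrite mulr_ge0 ?sqr_ge0.
  have -> : S t = F / (K * Om) + (K * \sum_(0 <= i < d) w i * h i t ^+ 2) / (K ^+ 2 * Om ^+ 2 * L).
    rewrite /F mulr_suml mulr_sumr mulr_suml -big_split; apply: eq_bigr => i _ /=.
    by field; rewrite !lt0r_neq0.
  rewrite lerD2l; have -> : (F / (K * Om)) ^+ 2 / L = F ^+ 2 / (K ^+ 2 * Om ^+ 2 * L).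
    by field; rewrite !lt0r_neq0.
  by apply: ler_wpM2r => //; rewrite invr_ge0 !mulr_ge0 ?exprn_ge0 ?(ltW K0) ?(ltW Om0) ?(ltW L0).
apply: le_trans (ler_avg _ _ pt) _.
- apply: continuous_powR_comp => //; first exact: continuous_circle.
  by move=> t; exact: normc_ge0.
- exact: cMl.
rewrite avgZ// /S avg_sum; last by move=> i; exact: cMl.
rewrite [leRHS]powRM ?mulr_ge0 ?powR_ge0 ?(ltW B0) ?(ltW K0) ?(ltW Om0)//.
rewrite E2 -[B * K * Om]mulrA powRM ?(ltW B0) ?(ltW KO)// -mulrA -/c0 [leRHS]mulrC.
apply: ler_wpM2l => //; apply: (@le_trans _ _ B); last first.
  by rewrite -[leLHS]powRr1 ?(ltW B0)// ler_powR.
apply: (@le_trans _ _ (\sum_(0 <= i < d) w i / K * B)).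
  apply: ler_sum => i _; rewrite avgZ//; apply: ler_wpM2l; first by rewrite divr_ge0// ltW.
  apply: le_trans (hB i); rewrite avgD; [|exact: cMr|exact: cMr].
  rewrite le_eqVlt; apply/orP; left; apply/eqP; congr (_ + _).
    by rewrite [RHS]mulrC -(avgZ Om^-1 (ch i)); congr avg; apply/funext => t; rewrite mulrC.
  by rewrite [RHS]mulrC -(avgZ _ (cS2 i)); congr avg; apply/funext => t; rewrite mulrC.
rewrite -!mulr_suml ler_piMl ?(ltW B0)// ler_pdivrMr// mul1r; exact: wK.
Qed.

End MeansOfSums.

Section Trapezoid.
Context {R : realType}.
Local Notation C := R[i].

(** The trapezoid with feet 0 and [3 H], equal to 1 between [H] and [2 H]. *)
Definition tau H m : R := (minn H (minn m (3 * H - m)))%:R / H%:R.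

Lemma tau_ge0 H m : 0 <= tau H m.
Proof. by rewrite divr_ge0. Qed.

Lemma tau_le1 H m : tau H m <= 1.
Proof.
case: H => [|H]; first by rewrite /tau invr0 mulr0.
by rewrite ler_pdivrMr ?ltr0Sn// mul1r ler_nat geq_minl.
Qed.

Lemma trapezoid_top H m : (H <= m <= 2 * H)%N -> minn H (minn m (3 * H - m)) = H.
Proof. lia. Qed.

Lemma trapezoid_end H : minn H (minn (3 * H) (3 * H - 3 * H)) = 0%N.
Proof. lia. Qed.

Lemma trapezoid_step H m :
  (minn H (minn m.+1 (3 * H - m.+1)) <= (minn H (minn m (3 * H - m))).+1)%N /\
  (minn H (minn m (3 * H - m)) <= (minn H (minn m.+1 (3 * H - m.+1))).+1)%N.
Proof. lia. Qed.

Lemma tau_plateau H m : (0 < H)%N -> (H <= m <= 2 * H)%N -> tau H m = 1.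
Proof. by move=> H0 h; rewrite /tau trapezoid_top// mulfV// pnatr_eq0 -lt0n. Qed.

Lemma tau0 H : tau H 0 = 0.
Proof. by rewrite /tau min0n minn0 mul0r. Qed.

Lemma tau_end H : tau H (3 * H) = 0.
Proof. by rewrite /tau trapezoid_end mul0r. Qed.

Lemma tau_step H m : (0 < H)%N -> `|tau H m.+1 - tau H m| <= H%:R^-1.
Proof.
move=> H0; have HR : 0 < H%:R :> R by rewrite ltr0n.
rewrite /tau -mulrBl normrM [`|_^-1|]ger0_norm ?invr_ge0//.
rewrite -[leRHS]mul1r ler_wpM2r ?invr_ge0//.
have [h1 h2] := trapezoid_step H m.
move: h1 h2; rewrite -2!(ler_nat R) -2!natr1 => h1 h2.
by rewrite ler_norml; apply/andP; split; lra.
Qed.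

Variables (r : R) (c s H L : nat).
Hypotheses (r0 : 0 < r) (s0 : (0 < s)%N) (H0 : (0 < H)%N) (L0 : (0 < L)%N).
Hypotheses (LH : (L <= 6 * H)%N) (sLr : s%:R * L%:R <= 2 * Num.sqrt r).
Hypothesis narrow : (3 * H <= 7 * L)%N \/ Num.sqrt r / s%:R + 1 <= 7 * L%:R.

Let Om := expR r / Num.sqrt r.
Let q0 : 0 < Num.sqrt r. Proof. by rewrite sqrtr_gt0. Qed.
Let Om0 : 0 < Om. Proof. by rewrite divr_gt0// expR_gt0. Qed.
Let sR : 0 < s%:R :> R. Proof. by rewrite ltr0n. Qed.
Let HR : 0 < H%:R :> R. Proof. by rewrite ltr0n. Qed.
Let LR : 0 < L%:R :> R. Proof. by rewrite ltr0n. Qed.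

Definition trapezoid m := tau H m * pw r (c + s * m).

(** The number of effective terms is limited by the length of the window, or by the
    Poisson weights through [pw_progression_sum]. *)
Lemma trapezoid_energy : \sum_(0 <= m < 3 * H) trapezoid m ^+ 2 <= 7 * Om ^+ 2 * L%:R.
Proof.
have p0 k : 0 <= pw r k by exact: pw_ge0 (ltW r0).
have pM k : pw r k <= Om by exact: pw_max.
have cp m : trapezoid m ^+ 2 <= Om * pw r (c + s * m).
  have h : trapezoid m <= pw r (c + s * m) by rewrite /trapezoid ler_piMl// tau_le1.
  have h0 : 0 <= trapezoid m by rewrite mulr_ge0// tau_ge0.
  rewrite expr2; apply: ler_pM => //; exact: le_trans h (pM _).
have [H7|r7] := narrow.
  apply: (@le_trans _ _ (\sum_(0 <= m < 3 * H) Om ^+ 2)).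
    apply: ler_sum => m _; apply: le_trans (cp m) _; rewrite expr2.
    by apply: ler_wpM2l; [exact: ltW|exact: pM].
  rewrite sumr_const_nat subn0 -[leLHS]mulr_natl [7 * _]mulrC -mulrA mulrC.
  by apply: ler_wpM2l; [exact: sqr_ge0|rewrite -natrM ler_nat].
apply: (@le_trans _ _ (\sum_(0 <= m < 3 * H) Om * pw r (c + s * m))).
  by apply: ler_sum => m _; exact: cp.
rewrite -mulr_sumr.
have h := pw_progression_sum r0 c (3 * H) s0; rewrite -/Om in h.
have h' : \sum_(0 <= m < 3 * H) pw r (c + s * m) <= Om * (Num.sqrt r / s%:R + 1).
  rewrite -(ler_pM2l sR); apply: le_trans h _.
  rewrite le_eqVlt; apply/orP; left; apply/eqP.
  have -> : expR r = Om * Num.sqrt r by rewrite /Om divfK// lt0r_neq0.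
  by field; rewrite lt0r_neq0.
apply: le_trans (ler_wpM2l (ltW Om0) h') _; rewrite [leLHS]mulrA -[Om * Om]expr2.
apply: le_trans (ler_wpM2l (sqr_ge0 Om) r7) _.
by rewrite mulrCA mulrA.
Qed.

(** The three terms come from the factor [1 - 1 / L], from the variation of the Poisson
    weights, and from the slopes of the trapezoid. *)
Lemma trapezoid_variation : \sum_(0 <= m < 3 * H)
  (trapezoid m.+1 - (1 - L%:R^-1) * trapezoid m) ^+ 2 <= 81 * Om ^+ 2 / L%:R.
Proof.
have p0 k : 0 <= pw r k by exact: pw_ge0 (ltW r0).
have pM k : pw r k <= Om by exact: pw_max.
have Hi : H%:R^-1 <= 6 / L%:R :> R.
  rewrite ler_pdivlMr// mulrC ler_pdivrMr//.
  by rewrite -natrM ler_nat.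
pose d m := pw r (c + s * m.+1) - pw r (c + s * m).
have step m : (trapezoid m.+1 - (1 - L%:R^-1) * trapezoid m) ^+ 2 <=
    3 * (L%:R^-1 ^+ 2 * trapezoid m ^+ 2 + d m ^+ 2 + Om ^+ 2 * (H%:R^-1 * (6 / L%:R))).
  have -> : trapezoid m.+1 - (1 - L%:R^-1) * trapezoid m =
      L%:R^-1 * trapezoid m + tau H m.+1 * d m + (tau H m.+1 - tau H m) * pw r (c + s * m).
    by rewrite /trapezoid /d; ring.
  have hd : (tau H m.+1 * d m) ^+ 2 <= d m ^+ 2.
    rewrite exprMn ler_piMl ?sqr_ge0// expr_le1// ?tau_ge0 ?tau_le1//.
  have ht : ((tau H m.+1 - tau H m) * pw r (c + s * m)) ^+ 2 <= Om ^+ 2 * (H%:R^-1 * (6 / L%:R)).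
    rewrite exprMn mulrC; apply: ler_pM; rewrite ?sqr_ge0//.
      by rewrite lerXn2r ?nnegrE ?(ltW Om0).
    rewrite -real_normK ?num_real// expr2; apply: ler_pM => //; first exact: tau_step.
    exact: le_trans (tau_step m H0) Hi.
  have three (x y z : R) : (x + y + z) ^+ 2 <= 3 * (x ^+ 2 + y ^+ 2 + z ^+ 2).
    rewrite -subr_ge0 (_ : _ - _ = (x - y) ^+ 2 + (y - z) ^+ 2 + (x - z) ^+ 2); last by ring.
    by rewrite !addr_ge0 ?sqr_ge0.
  apply: le_trans (three _ _ _) _; rewrite exprMn; apply: ler_wpM2l => //.
  by apply: lerD => //; apply: lerD.
apply: (@le_trans _ _ (\sum_(0 <= m < 3 * H) 3 * (L%:R^-1 ^+ 2 * trapezoid m ^+ 2 + d m ^+ 2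
    + Om ^+ 2 * (H%:R^-1 * (6 / L%:R))))); first by apply: ler_sum => m _; exact: step.
rewrite -mulr_sumr !big_split /= -mulr_sumr sumr_const_nat subn0.
have e1 : L%:R^-1 ^+ 2 * (\sum_(0 <= m < 3 * H) trapezoid m ^+ 2) <= 7 * Om ^+ 2 / L%:R.
  apply: le_trans (ler_wpM2l (sqr_ge0 _) trapezoid_energy) _.
  by rewrite le_eqVlt; apply/orP; left; apply/eqP; field; rewrite lt0r_neq0.
have e2 : \sum_(0 <= m < 3 * H) d m ^+ 2 <= 2 * Om ^+ 2 / L%:R.
  apply: le_trans (pw_progression_diff r0 c s (3 * H)) _; rewrite -/Om.
  rewrite ler_pdivlMr// mulrA mulrAC ler_pdivrMr//.
  have := ler_wpM2l (sqr_ge0 Om) sLr; lra.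
have e3 : (Om ^+ 2 * (H%:R^-1 * (6 / L%:R))) *+ (3 * H) = 18 * Om ^+ 2 / L%:R.
  by rewrite -mulr_natl natrM; field; rewrite !lt0r_neq0.
rewrite e3; have : 81 * Om ^+ 2 / L%:R = 3 * (7 * Om ^+ 2 / L%:R + 2 * Om ^+ 2 / L%:R + 18 * Om ^+ 2 / L%:R) by ring.
move=> ->; apply: ler_wpM2l => //; apply: lerD => //; exact: lerD.
Qed.

Let cc m : C := ((trapezoid m)%:C)%C.

(** [trig_mean_le] with [mu = L / Om], and Parseval's identity; [89 = (81 + 1) + 7]. *)
Lemma trapezoid_means (h := fun t => N (\sum_(0 <= m < 3 * H) cc m * cis ((s * m)%:R * t))) :
  avg h / Om + avg (fun t => h t ^+ 2) / (Om ^+ 2 * L%:R) <= 89.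
Proof.
have m1 : avg h <= 82 * Om.
  have mu0 : 0 < L%:R / Om by rewrite divr_gt0.
  have z1 : cc 0 = 0 by rewrite /cc /trapezoid tau0 mul0r.
  have z2 : cc (3 * H)%N = 0 by rewrite /cc /trapezoid tau_end mul0r.
  apply: le_trans (trig_mean_le s0 L0 mu0 z1 z2) _.
  rewrite (eq_bigr (fun m => (trapezoid m.+1 - (1 - L%:R^-1) * trapezoid m) ^+ 2)); last first.
    move=> m _; rewrite (_ : _ - _ = ((trapezoid m.+1 - (1 - L%:R^-1) * trapezoid m)%:C)%C).
      by rewrite normc_real real_normK// num_real.
    rewrite /cc; move: (trapezoid m.+1) (trapezoid m) (L%:R^-1) => x y z.
    by rewrite rmorphB rmorphM rmorphB rmorph1.
  apply: le_trans (lerD (ler_wpM2l (ltW mu0) trapezoid_variation) (lexx _)) _.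
  by rewrite le_eqVlt; apply/orP; left; apply/eqP; field; rewrite !lt0r_neq0.
have m2 : avg (fun t => h t ^+ 2) <= 7 * Om ^+ 2 * L%:R.
  rewrite parseval//; apply: le_trans trapezoid_energy; apply: ler_sum => m _.
  by rewrite /cc normc_real real_normK// num_real.
have -> : 89 = 82 + 7 :> R by ring.
apply: lerD; first by rewrite ler_pdivrMr.
have P0 : 0 < Om ^+ 2 * L%:R by rewrite mulr_gt0// exprn_gt0.
by rewrite (ler_pdivrMr _ _ P0) mulrA.
Qed.

End Trapezoid.

Section Rooms.
Context {R : realType}.

Lemma powR_eventually_ge (th x : R) : 0 < th -> eventually_nat (fun n => x <= n%:R `^ th).
Proof.
move=> th0; have [m1 H1] := eventually_ge (`|x| `^ th^-1).
exists m1 => n /H1 h; apply: le_trans (ler_norm x) _.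
have E : (`|x| `^ th^-1) `^ th = `|x| by rewrite -powRrM mulVf ?powRr1// lt0r_neq0.
by rewrite -E; apply: ge0_ler_powR; rewrite ?nnegrE ?powR_ge0 ?(ltW th0).
Qed.

(** The factor [s ^ - th] absorbs [B]. *)
Lemma room_const (g th c r0 : R) : g < 1 -> 0 < th -> th <= 2^-1 -> 0 <= g -> 0 < c ->
  room g (2^-1 - sigma g * th) r0 (fun=> c) th.
Proof.
move=> g1 th0 th2 g0 c0 B B0.
have sg0 : 0 < sigma g by rewrite /sigma lt_min; apply/andP; split; lra.
have sg2 : sigma g <= 2^-1 by rewrite /sigma ge_min lexx.
have st0 : 0 < sigma g * th by rewrite mulr_gt0.
have [s1 Hs] := powR_eventually_ge (16 * B / c) th0.
exists s1 => s /Hs hs s0; have sR : 0 < s%:R :> R by rewrite ltr0n.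
have [n1 Hn] := powR_eventually_ge (16 * B / c) st0.
exists (maxn n1 1) => n r; rewrite geq_max => /andP[/Hn hn n0] _ rn nr.
have nR : 0 < n%:R :> R by rewrite ltr0n.
have r_gt0 : 0 < r by lra.
have Om0 : 0 <= expR r / Num.sqrt r by rewrite divr_ge0 ?expR_ge0 ?sqrtr_ge0.
have -> : allowed (2^-1 - sigma g * th) (fun=> c) r =
    c / 4 * r `^ (sigma g * th) * (expR r / Num.sqrt r).
  rewrite /allowed -[RHS]mulrA; congr (_ * _); rewrite -powR12_sqrt ?(ltW r_gt0)//.
  rewrite mulrCA; congr (_ * _); rewrite -!powRN opprB -powRDp//.
apply: ler_wpM2r => //.
set A := n%:R `^ (sigma g * th); set S := s%:R `^ th; rewrite -/A in hn; rewrite -/S in hs.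
have A0 : 0 < A by rewrite powR_gt0.
have S0 : 0 < S by rewrite powR_gt0.
have maxle : Num.max 1 (n%:R `^ sigma g / s%:R) `^ th <= 1 + A / S.
  have [_|_] := leP (n%:R `^ sigma g / s%:R) 1.
    by rewrite powR1 lerDl divr_ge0// ltW.
  have -> : (n%:R `^ sigma g / s%:R) `^ th = A / S.
    rewrite /A /S powRM ?invr_ge0// -powRrM; congr (_ * _).
    by rewrite -powRN -[s%:R^-1]powR_inv1// -powRrM mulN1r.
  by rewrite lerDr.
have rA : A / 2 <= r `^ (sigma g * th).
  apply: (@le_trans _ _ ((n%:R / 2) `^ (sigma g * th))); last first.
    by apply: ge0_ler_powR; rewrite ?nnegrE ?(ltW st0) ?(ltW r_gt0) ?divr_ge0.
  rewrite powRM ?invr_ge0// -/A; apply: ler_wpM2l; first exact: ltW.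
  have h : sigma g * th <= 1 by nra.
  rewrite -[2^-1]powR_inv1// -powRrM mulN1r.
  by rewrite ler_powR ?ler1n// lerN2.
have h1 : B * A / S <= c / 16 * A.
  rewrite ler_pdivrMr// mulrAC [leRHS]mulrC -mulrA [leLHS]mulrC; apply: ler_wpM2l; first exact: ltW.
  by move: hs; rewrite ler_pdivrMr//; lra.
have h2 : B <= c / 16 * A by move: hn; rewrite ler_pdivrMr//; lra.
have h3 := ler_wpM2l B0 maxle.
have h4 : c / 4 * (A / 2) <= c / 4 * r `^ (sigma g * th) by apply: ler_wpM2l => //; rewrite divr_ge0// ltW.
apply: le_trans h3 _; apply: le_trans h4; rewrite mulrDr mulr1 mulrA; lra.
Qed.

(** Here the number of copies costs nothing, and [Psi r] eventually exceeds [B]. *)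
Lemma room_infty (g th r0 : R) (Psi : R -> R) : 0 <= g <= 1 -> 0 <= th -> sigma g = 0 \/ th = 0 ->
  (forall A, exists x, forall r, x <= r -> A <= Psi r) -> room g 2^-1 r0 Psi th.
Proof.
move=> g01 th0 deg HPsi B B0; exists 0%N => s _ s0.
have [x Hx] := HPsi (4 * B); have [n1 Hn] := eventually_ge (2 * x).
exists (maxn n1 1) => n r; rewrite geq_max => /andP[/Hn hn n0] _ rn nr.
have nR : 0 < n%:R :> R by rewrite ltr0n.
have r_gt0 : 0 < r by lra.
have -> : Num.max 1 (n%:R `^ sigma g / s%:R) `^ th = 1.
  case: deg => [->|->]; last by rewrite powRr0.
  by rewrite powRr0 mul1r max_l ?powR1// invf_le1 ?ler1n// ltr0n.
rewrite mulr1 /allowed powR12_sqrt ?(ltW r_gt0)//; apply: ler_wpM2r.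
  by rewrite divr_ge0 ?expR_ge0 ?sqrtr_ge0.
by have := Hx r; move=> /(_ ltac:(lra)); lra.
Qed.

End Rooms.

Section TrapezoidBlocks.
Context {R : realType}.
Local Notation C := R[i].

Lemma plateau_count H : H%:R <= \sum_(0 <= m < 3 * H) (H <= m <= 2 * H)%N%:R :> R.
Proof.
have h1 : (H <= 3 * H)%N by rewrite leq_pmull.
have h2 : (H <= 2 * H)%N by rewrite leq_pmull.
have h3 : (2 * H <= 3 * H)%N by rewrite leq_mul2r orbT.
rewrite (big_cat_nat (leq0n _) h1) /= (big_cat_nat h2 h3) /=.
have -> : \sum_(H <= m < 2 * H) (H <= m <= 2 * H)%N%:R = H%:R :> R.
  rewrite (eq_big_nat _ _ (F2 := fun=> 1)); last first.
    by move=> m /andP[Hm mH]; rewrite Hm (ltnW mH).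
  by rewrite sumr_const_nat mul2n -addnn addnK.
by rewrite addrCA lerDl addr_ge0// sumr_ge0.
Qed.

Lemma trunc_half (x : R) : 1 <= x -> x / 2 <= (Num.trunc x)%:R <= x.
Proof.
move=> x1; have x0 : 0 <= x by lra.
have h1 : (Num.trunc x)%:R <= x by rewrite truncn_le.
have h2 : x < (Num.trunc x).+1%:R by exact: truncnS_gt.
have h3 : 1 <= (Num.trunc x)%:R :> R.
  by rewrite ler1n; rewrite truncn_gt0.
rewrite -natr1 in h2; apply/andP; split; lra.
Qed.

(** Up to constants, [L] is the smaller of the numbers of copies that fit into the window
    and into the bulk of the Poisson weights. *)
Lemma trapezoid_sizes (g : R) (s : nat) : 0 <= g -> g < 1 -> (0 < s)%N ->
  eventually_nat (fun n => let X := n%:R `^ (1 - g) / (3 * s%:R) : R in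
    let Y := n%:R `^ sigma g / s%:R : R in
    let H := Num.trunc X in let L := Num.trunc Y in
    [/\ [/\ (0 < n)%N, (0 < H)%N & (0 < L)%N],
        X / 2 <= H%:R <= X, Y / 2 <= L%:R <= Y, (L <= 6 * H)%N &
        forall r : R, n%:R / 2 <= r -> r <= 8 * n%:R ->
          s%:R * L%:R <= 2 * Num.sqrt r /\
          ((3 * H <= 7 * L)%N \/ Num.sqrt r / s%:R + 1 <= 7 * L%:R)]).
Proof.
move=> g0 g1 s0; have sR : 0 < s%:R :> R by rewrite ltr0n.
have sg0 : 0 < sigma g by rewrite /sigma lt_min; apply/andP; split; lra.
have sg2 : sigma g <= 2^-1 by rewrite /sigma ge_min lexx.
have sg1 : sigma g <= 1 - g by rewrite /sigma ge_min lexx orbT.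
have [m1 H1] := powR_eventually_ge s%:R sg0.
have g10 : 0 < 1 - g by lra.
have [m2 H2] := powR_eventually_ge (3 * s%:R) g10.
exists (maxn (maxn m1 m2) 1) => n; rewrite !geq_max => /andP[/andP[/H1 n1 /H2 n2] n0].
move=> X Y H L.
have nR : 1 <= n%:R :> R by rewrite ler1n.
have X1 : 1 <= X by rewrite /X ler_pdivlMr ?mul1r// mulr_gt0.
have Y1 : 1 <= Y by rewrite /Y ler_pdivlMr ?mul1r.
have Hb := trunc_half X1; have Lb := trunc_half Y1; rewrite -/H in Hb; rewrite -/L in Lb.
have H0 : (0 < H)%N by rewrite truncn_gt0.
have L0 : (0 < L)%N by rewrite truncn_gt0.
have YX : Y <= 3 * X.
  have -> : 3 * X = n%:R `^ (1 - g) / s%:R by rewrite /X; field; rewrite lt0r_neq0.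
  by rewrite /Y ler_pM2r ?invr_gt0// ler_powR.
have [Hl Hu] := andP Hb; have [Ll Lu] := andP Lb.
split=> //.
  by rewrite -(ler_nat R) natrM; lra.
move=> r rn nr; have r_gt0 : 0 < r by lra.
split.
  apply: (@le_trans _ _ (n%:R `^ sigma g)).
    by rewrite mulrC -ler_pdivlMr.
  apply: (@le_trans _ _ (Num.sqrt (n%:R : R))).
    by rewrite -powR12_sqrt// ler_powR.
  have -> : 2 * Num.sqrt r = Num.sqrt (2 ^+ 2 * r) by rewrite sqrtrM// sqrtr_sqr ger0_norm.
  by apply: ler_wsqrtr; lra.
have [gh|gh] := leP g 2^-1; last first.
  left; have sE : sigma g = 1 - g by rewrite /sigma; apply/min_idPr; lra.
  have XY : 3 * X = Y by rewrite /X /Y sE; field; rewrite lt0r_neq0.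
  by rewrite -(ler_nat R) !natrM; lra.
right; have sE : sigma g = 2^-1 by rewrite /sigma; apply/min_idPl; lra.
have h : Num.sqrt r / s%:R <= 3 * Y.
  rewrite /Y sE mulrA ler_pM2r ?invr_gt0// powR12_sqrt//.
  have -> : 3 * Num.sqrt n%:R = Num.sqrt (3 ^+ 2 * n%:R) :> R.
    by rewrite sqrtrM// sqrtr_sqr ger0_norm.
  by apply: ler_wsqrtr; lra.
have L1 : 1 <= L%:R :> R by rewrite ler1n.
lra.
Qed.

Lemma trapezoid_blocks (g a r0 v : R) (Psi : R -> R) : 0 <= g -> g < 1 -> 1 <= v <= 2 ->
  room g a r0 Psi (1 - v^-1) ->
  forall t, exists K delta n0, [/\ 0 <= K, 0 < delta &
    forall n, (n0 <= n)%N -> exists b, block (beta_gamma g) v%:E a r0 Psi t K delta n b].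
Proof.
move=> g0 g1 v12 Hroom t; have /andP[v1 v2] := v12.
have g01 : 0 <= g <= 1 by rewrite g0 ltW.
have th0 : 0 <= 1 - v^-1 by rewrite subr_ge0 invf_le1//; lra.
have K0 : 0 < tnorm t + 1 :> R by rewrite ltr_wpDl// tnorm_ge0.
have B0 : 0 <= 89 * (tnorm t + 1) :> R by rewrite mulr_ge0// ltW.
have [s1 Hs] := Hroom _ B0.
have [s [s0 ss ts tail]] := @period_exists R t s1.
have [n1 Hn] := Hs s ss s0.
have sR : 0 < s%:R :> R by rewrite ltr0n.
have c0 : 0 < (6 * s%:R)^-1 :> R by rewrite invr_gt0 mulr_gt0.
have [delta d0 Hd] := @pattern_block R g a r0 v%:E Psi g01 t s 1 _ c0 s0 ts tail.
have [n2 H2] := trapezoid_sizes g0 g1 s0.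
exists (tnorm t), delta, (maxn n1 (maxn n2 s)); split; [exact: tnorm_ge0|exact: d0|].
move=> n; rewrite !geq_max => /andP[nn1 /andP[nn2 ns]].
have [] := H2 n nn2; set H := Num.trunc _; set L := Num.trunc _.
move=> [n0 H0 L0] /andP[Hl Hu] /andP[Ll Lu] LH sizes.
have HX : 3 * s%:R * H%:R <= n%:R `^ (1 - g) by rewrite mulrC -ler_pdivlMr ?mulr_gt0.
have Pn : n%:R `^ (1 - g) <= n%:R :> R.
  by rewrite -[leRHS]powRr1// ler_powR ?ler1n// gerBl.
pose e m : C := ((tau H m)%:C)%C.
exists (pattern (tcoef t) e s (3 * H) n).
have sHE : (s * (3 * H))%:R = 3 * s%:R * H%:R :> R by rewrite !natrM; ring.
have sH : (s * (3 * H) <= n)%N by rewrite -(ler_nat R) sHE; exact: le_trans HX Pn.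
apply: (Hd n (3 * H)%N e (fun m => H <= m <= 2 * H)%N) => //.
- by rewrite sHE mul1r.
- by move=> m; rewrite normc_real ger0_norm ?tau_ge0// tau_le1.
- by move=> m Hm; rewrite /e tau_plateau// rmorph1.
- apply: le_trans (plateau_count H); apply: le_trans Hl.
  by rewrite le_eqVlt; apply/orP; left; apply/eqP; field; rewrite lt0r_neq0.
move=> r rr rn nr; have [sLr narrow] := sizes r rn nr.
have nR : 1 <= n%:R :> R by rewrite ler1n.
have r_gt0 : 0 < r by lra.
have q0 : 0 < Num.sqrt r by rewrite sqrtr_gt0.
pose h i t := N (\sum_(0 <= m < 3 * H) ((trapezoid r (n + i) s H m)%:C)%C * cis ((s * m)%:R * t)).
have L1 : 1 <= L%:R :> R by rewrite ler1n.
apply: le_trans (@M_weighted_sum R (psum (pattern (tcoef t) e s (3 * H) n) (4 * n)) h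
  (fun i => N (tcoef t i : C)) s v r (tnorm t + 1) (expR r / Num.sqrt r) L%:R 89 _ v12 L1 K0 _ _ _ _ _ _ _ _) _.
- by move=> z; exact: psum_cont.
- by rewrite divr_gt0// expR_gt0.
- by rewrite ler1n.
- by move=> i; exact: normc_ge0.
- by rewrite tnorm_sum// lerDl.
- move=> i; apply: ccurve_normc; apply: ccurve_sum => k.
  by apply: ccurveM; [exact: ccurve_cst|exact: ccurve_cisM].
- by move=> i x; exact: normc_ge0.
- move=> x; apply: le_trans (psum_pattern_le _ _ _ _ sH) _; apply: ler_sum => i _.
  rewrite le_eqVlt; apply/orP; left; apply/eqP; congr (_ * _).
  have -> : \sum_(0 <= m < 3 * H) e m * (cis x ^+ (n + i + s * m) * ((pw r (n + i + s * m))%:C)%C) =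
     cis x ^+ (n + i) * \sum_(0 <= m < 3 * H) ((trapezoid r (n + i) s H m)%:C)%C * cis ((s * m)%:R * x).
    rewrite mulr_sumr; apply: eq_bigr => m _; rewrite /trapezoid /e (rmorphM _ (tau H m)) exprD [cis x ^+ (s * m)]cisMn.
    by ring.
  by rewrite Normc.normcM normcX normc_cis expr1n mul1r.
- move=> i; exact: trapezoid_means.
rewrite lee_fin; apply: le_trans (Hn n r nn1 rr rn nr).
rewrite mulrAC; apply: ler_wpM2r; first by rewrite divr_ge0 ?expR_ge0// ltW.
apply: ler_wpM2l => //; apply: ge0_ler_powR; rewrite ?nnegrE//.
by rewrite le_max Lu orbT.
Qed.

End TrapezoidBlocks.

(** * Existence, and the theorem *)

Section Existence.
Context {R : realType}.
Local Notation C := R[i].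

(** For [theta p = 1/2] the Rudin-Shapiro blocks are small enough, in the sup norm
    already; otherwise [p < 2] and the trapezoidal blocks have mean exponent [1 - 1 / p
    = theta p]. *)
Lemma exists_Ubeta_const (g c : R) (p : \bar R) : 0 <= g -> g < 1 -> (1 < p)%E -> 0 < c ->
  exists2 f : C -> C, Ubeta_freq_hypercyclic_D (beta_gamma g) f &
    forall r : R, 0 < r -> (Defs.M p f r <= (c * (expR r / r `^ alpha p g))%:E)%E.
Proof.
move=> g0 g1 p1 c0; rewrite alphaE//.
have g01 : 0 <= g <= 1 by rewrite g0 ltW.
have sg0 : 0 <= sigma g by rewrite /sigma le_min; apply/andP; split; lra.
have sg2 : sigma g <= 2^-1 by rewrite /sigma ge_min lexx.
have th0 := theta_gt0 p1; have th2 := theta_le (ltW p1).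
have a0 : 0 <= 2^-1 - sigma g * theta p by nra.
have a2 : 2^-1 - sigma g * theta p <= 2^-1 by nra.
have Hroom := room_const 0 g1 th0 th2 g0 c0.
have blocks : forall t, exists K delta n0, [/\ 0 <= K, 0 < delta & forall n, (n0 <= n)%N ->
    exists b, block (beta_gamma g) p (2^-1 - sigma g * theta p) 0 (fun=> c) t K delta n b].
  have [thE|[v [pE v12 thE]]] : theta p = 2^-1 \/
      exists v : R, [/\ p = v%:E, 1 <= v <= 2 & theta p = 1 - v^-1].
  - case: p p1 {a0 a2 th0 th2 Hroom} => [v|_|//]; last by left.
    rewrite lte_fin /= => v1; have [v2|v2] := ltP v 2; last by left.
    by right; exists v; split=> //; rewrite !ltW.
  - by apply: rs_blocks => //; [exact: ltW|rewrite -{2}thE].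
  - by rewrite {1}pE; apply: trapezoid_blocks => //; rewrite -thE.
have [f Hf Mf] := @assembly R (beta_gamma g) p _ c 0 (fun=> c) (ltW p1) a0 a2 c0 (fun _ _ _ => lexx c)
  (beta_gamma_ge1 g) blocks.
by exists f => // r r_gt0; apply: Mf => //; exact: ltW.
Qed.

(** In both cases the exponent [sigma * theta] vanishes, and a factor tending to
    infinity takes the place of the small constant. *)
Lemma exists_Ubeta_psi (g : R) (p : \bar R) (psi : R -> R) : 0 <= g <= 1 -> (1 <= p)%E ->
  g = 1 \/ p = 1%:E -> increasing_to_infty psi ->
  exists2 f : C -> C, Ubeta_freq_hypercyclic_D (beta_gamma g) f &
    \forall r \near +oo, (Defs.M p f r <= (psi r * (expR r / r `^ 2^-1))%:E)%E.
Proof.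
move=> g01 p1 gp [psi0 psi_mono psi_cvg]; have /andP[g0 g1] := g01.
have large A : exists x, forall r, x <= r -> A <= psi r.
  move/cvgryPge : psi_cvg => /(_ A) [x [_ Hx]]; exists (x + 1) => r xr.
  by apply: Hx; lra.
have [r0 Hr0] := large 1.
have blocks : forall t, exists K delta n0, [/\ 0 <= K, 0 < delta & forall n, (n0 <= n)%N ->
    exists b, block (beta_gamma g) p 2^-1 r0 psi t K delta n b].
  have [g1'|gn1] := eqVneq g 1.
    apply: rs_blocks => //; apply: room_infty => //; left.
    by rewrite g1' /sigma subrr min_r.
  have p1' : p = 1%:E by case: gp => // g1'; rewrite g1' eqxx in gn1.
  rewrite p1'; apply: trapezoid_blocks => //; first by rewrite lt_neqAle gn1.
    by rewrite lexx ler1n.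
  by rewrite invr1 subrr; apply: room_infty => //; right.
have h2 : 0 <= 2^-1 :> R by [].
have psi1 r : 0 < r -> r0 <= r -> 1 <= psi r by move=> _; exact: Hr0.
have [f Hf Mf] := @assembly R (beta_gamma g) p _ 1 r0 psi p1 h2 (lexx _) ltr01 psi1
  (beta_gamma_ge1 g) blocks.
exists f => //; exists (Num.max r0 0); split; first exact: num_real.
by move=> r; rewrite gt_max => /andP[/ltW r0r r_gt0]; exact: Mf.
Qed.

End Existence.

Theorem theorem1p6 (R : realType) (gamma : R) (hgamma : 0 <= gamma <= 1) :
  (forall p : \bar R, (1 < p)%E ->
    (gamma < 1 ->
      (forall c : R, 0 < c ->
        exists2 f : R[i] -> R[i],
          Ubeta_freq_hypercyclic_D (beta_gamma gamma) f &
          forall r : R, 0 < r ->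
            (M p f r <= (c * (expR r / r `^ alpha p gamma))%:E)%E)
      /\
      (forall f : R[i] -> R[i],
        Ubeta_freq_hypercyclic_D (beta_gamma gamma) f ->
        (0 < growth_limsup p (alpha p gamma) f)%E))
    /\
    (gamma = 1 ->
      [/\ forall f : R[i] -> R[i],
            Ubeta_freq_hypercyclic_D (beta_gamma 1) f <-> hypercyclic_D f,
          forall psi : R -> R, increasing_to_infty psi ->
            exists2 f : R[i] -> R[i],
              Ubeta_freq_hypercyclic_D (beta_gamma 1) f &
              \forall r \near +oo,
                (M p f r <= (psi r * (expR r / r `^ 2^-1))%:E)%E
        & forall f : R[i] -> R[i],
            Ubeta_freq_hypercyclic_D (beta_gamma 1) f ->
            growth_limsup p 2^-1 f = +oo%E]))
  /\
  ((forall psi : R -> R, increasing_to_infty psi ->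
      exists2 f : R[i] -> R[i],
        Ubeta_freq_hypercyclic_D (beta_gamma gamma) f &
        \forall r \near +oo,
          (M 1%:E f r <= (psi r * (expR r / r `^ 2^-1))%:E)%E)
   /\
   (forall f : R[i] -> R[i],
      Ubeta_freq_hypercyclic_D (beta_gamma gamma) f ->
      growth_limsup 1%:E 2^-1 f = +oo%E)).
Proof.
have /andP[g0 g1] := hgamma.
have one01 : 0 <= (1 : R) <= 1 by rewrite ler01 lexx.
split=> [p p1|].
  split=> [gl1|_].
    split=> [c c0|f]; first exact: exists_Ubeta_const.
    exact: Ubeta_growth_lower.
  split=> [f|psi Hpsi|f].
  - split; [exact: (Ubeta_hypercyclic (beta_gamma_ge1 1))|exact: hypercyclic_Ubeta1].
  - by apply: exists_Ubeta_psi => //; [exact: ltW|left].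
  - exact: (Ubeta_unbounded_growth (beta_gamma_ge1 1) (ltW p1)).
split=> [psi Hpsi|f]; first by apply: exists_Ubeta_psi => //; right.
exact: (Ubeta_unbounded_growth (beta_gamma_ge1 gamma) (lexx _)).
Qed.
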